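(* Let $\triangle$ be a regular triangulation of a polygonal domain $\Omega\subset\mathbb R^2$ and $d\ge1$. Then $$C_1^{\mathrm{div}}\,R\,D_0^{\mathrm{br}}=B_0C_0,\qquad B_0=\operatorname{diag}_e\bigl(|e|^{-1}\mathsf U_{d+1}\bigr)$$ (block diagonal over interior edges $e$). Consequently, with $V_h^0=\ker C_0$, $V^1_{h,\mathrm{div}}=\ker C_1^{\mathrm{div}}$ and $V_h^2=S^{-1}_{d-1}(\triangle)$, the sequence $$\mathbb R\hookrightarrow V_h^0\xrightarrow{R\nabla}V^1_{h,\mathrm{div}}\xrightarrow{\mathrm{div}}V_h^2\to0$$ is a subcomplex of $\mathbb R\hookrightarrow H^1(\Omega)\xrightarrow{R\nabla}H(\mathrm{div};\Omega)\xrightarrow{\mathrm{div}}L^2(\Omega)\to0$; it is exact when $\Omega$ is simply connected; and its middle space is the BDM space $\{v\in H(\mathrm{div};\Omega):v|_T\in[\mathcal P_d(T)]^2\ \forall T\in\triangle\}$. Replacing the local space $[\mathcal P_d(T)]^2$ by $\mathcal{RT}_d(T)$, with the same normal-coefficient jump functionals, gives the Raviart--Thomas space $\{v\in H(\mathrm{div};\Omega):v|_T\in\mathcal{RT}_d(T)\ \forall T\in\triangle\}$.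
   Context: Triangulation: $\triangle$ is a finite set of nondegenerate closed triangles whose union is $\overline\Omega$, with $\Omega$ the (connected) interior of that union; any two distinct triangles meet in the empty set, a common vertex, or a common edge. An interior edge is an edge shared by two triangles $T^+,T^-$. No boundary conditions are imposed. $\mathcal P_m(T)$ is the space of polynomials of total degree at most $m$ on $T$; $S^{-1}_m(\triangle)$ is the space of families $(s|_T)_{T\in\triangle}$ with $s|_T\in\mathcal P_m(T)$, no continuity being imposed across edges, identified with the concatenation of Bernstein coefficient vectors on the triangles (two such vectors for vector fields). $R(a_1,a_2)=(-a_2,a_1)$ is the rotation, also applied pointwise to vector fields and correspondingly to their coefficient vectors, $(c^x,c^y)\mapsto(-c^y,c^x)$. $\mathcal{RT}_d(T)=[\mathcal P_d(T)]^2\oplus x\,\widetilde{\mathcal P}_d(T)$, where $x$ is the position vector and $\widetilde{\mathcal P}_d$ the homogeneous polynomials of degree $d$; its normal components on edges are polynomials of degree at most $d$. Each interior edge $e$ has length $|e|$ and a fixed orientation with unit tangent $t_e$ pointing from its first endpoint $a$ to its second endpoint $b$, and unit normal $n_e=Rt_e$. The degree-$m$ coefficient vector on $e$ of a polynomial $p$ whose restriction to $e$ has degree at most $m$ is the vector $(r_0,\dots,r_m)$ with $p(a+t(b-a))=\sum_j r_j\binom mj t^j(1-t)^{m-j}$. For $u\in S^{-1}_{d+1}(\triangle)$, $C_{0,e}u$ is the degree-$(d+1)$ coefficient vector on $e$ of $u|_{T^+}$ minus that of $u|_{T^-}$. For $v\in[S^{-1}_d(\triangle)]^2$, $C^{\mathrm{div}}_{1,e}v$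 is the degree-$d$ coefficient vector on $e$ of $v|_{T^+}\cdot n_e$ minus that of $v|_{T^-}\cdot n_e$. $C_0$ and $C_1^{\mathrm{div}}$ are obtained by stacking these blocks over all interior edges. $D_0^{\mathrm{br}}:S^{-1}_{d+1}(\triangle)\to[S^{-1}_d(\triangle)]^2$ is the triangle-by-triangle gradient. $\mathsf U_m\in\mathbb R^{m\times(m+1)}$ is the matrix with $(\mathsf U_m r)_j=m(r_{j+1}-r_j)$, $j=0,\dots,m-1$. *)

(* Defs.v *)
From HB Require Import structures.
From mathcomp Require Import all_boot all_order all_algebra.
(* The notations of mpoly clash with those of mathcomp-analysis. *)
From mathcomp Require Import -(notations) mpoly.
From mathcomp Require Import all_classical all_reals all_analysis.

Set Implicit Arguments.
Unset Strict Implicit.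
Unset Printing Implicit Defensive.

Import Order.TTheory GRing.Theory Num.Theory numFieldNormedType.Exports.

Local Open Scope classical_set_scope.
Local Open Scope ring_scope.

(* The plane carries the product topology and product sigma-algebra; the norm
   of the normed module [R * R] is the max norm, hence [enorm]. *)
Notation plane R := (R * R)%type (only parsing).

Definition enorm (R : realType) (x : plane R) : R :=
  Num.sqrt (x.1 ^+ 2 + x.2 ^+ 2).

(* Rotation by a quarter turn, used for points and for polynomial fields. *)
Definition rot (V : zmodType) (v : V * V) : V * V := (- v.2, v.1).

Definition segment (R : realType) (a b : plane R) : set (plane R) :=
  [set x | exists2 t : R, 0 <= t <= 1 & x = a + t *: (b - a)].

Definition hull3 (R : realType) (P : 'I_3 -> plane R) : set (plane R) :=
  [set x | exists l : 'I_3 -> R,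
    [/\ forall k, 0 <= l k, \sum_k l k = 1 & x = \sum_k l k *: P k]].

Definition noncollinear (R : realType) (P : 'I_3 -> plane R) : Prop :=
  let v := P (inord 1) - P ord0 in
  let w := P (inord 2) - P ord0 in
  v.1 * w.2 - v.2 * w.1 != 0.

(* [a], [b] are the endpoints of an edge of both triangles, and the triangles
   meet exactly along that edge. *)
Definition share_edge (R : realType) (P Q : 'I_3 -> plane R) (a b : plane R) :
    Prop :=
  a != b /\
  [/\ exists k, P k = a, exists k, P k = b, exists k, Q k = a,
      exists k, Q k = b & hull3 P `&` hull3 Q = segment a b].

Definition share_vertex (R : realType) (P Q : 'I_3 -> plane R) (a : plane R) :
    Prop :=
  [/\ exists k, P k = a, exists k, Q k = a & hull3 P `&` hull3 Q = [set a]].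

(* Distinct indices give distinct triangles: by [conforming], two triangles
   with distinct indices cannot coincide. *)
Record triangulation (R : realType) := Triangulation {
  ntri : nat;
  vtx : 'I_ntri -> 'I_3 -> plane R;
  nondegenerate : forall T : 'I_ntri, noncollinear (vtx T);
  conforming : forall T T' : 'I_ntri, T != T' ->
    [\/ hull3 (vtx T) `&` hull3 (vtx T') = set0,
        exists a, share_vertex (vtx T) (vtx T') a |
        exists a b, share_edge (vtx T) (vtx T') a b] }.

Definition tri (R : realType) (Th : triangulation R) (T : 'I_(ntri Th)) :
  set (plane R) := hull3 (vtx T).

Definition Omega (R : realType) (Th : triangulation R) : set (plane R) :=
  interior (\bigcup_(T in [set: 'I_(ntri Th)]) tri T).

(* An enumeration without repetition of the interior edges, each with an
   arbitrary choice of orientation (from [ea] to [eb]) and an arbitrary,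
   independent choice of which adjacent triangle is called T^+. *)
Record interior_edges (R : realType) (Th : triangulation R) := InteriorEdges {
  nedge : nat;
  Tplus : 'I_nedge -> 'I_(ntri Th);
  Tminus : 'I_nedge -> 'I_(ntri Th);
  ea : 'I_nedge -> plane R;
  eb : 'I_nedge -> plane R;
  edge_neq : forall e, Tplus e != Tminus e;
  edge_shared : forall e,
    share_edge (vtx (Tplus e)) (vtx (Tminus e)) (ea e) (eb e);
  edge_all : forall (T T' : 'I_(ntri Th)) a b, T != T' ->
    share_edge (vtx T) (vtx T') a b ->
    exists e, segment (ea e) (eb e) = segment a b;
  edge_inj : forall e e',
    segment (ea e) (eb e) = segment (ea e') (eb e') -> e = e' }.

Definition elen (R : realType) (Th : triangulation R) (E : interior_edges Th)
  (e : 'I_(nedge E)) : R := enorm (eb e - ea e).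

Definition etan (R : realType) (Th : triangulation R) (E : interior_edges Th)
  (e : 'I_(nedge E)) : plane R := (elen e)^-1 *: (eb e - ea e).

Definition enormal (R : realType) (Th : triangulation R)
  (E : interior_edges Th) (e : 'I_(nedge E)) : plane R := rot (etan e).

Definition path_connected (R : realType) (A : set (plane R)) : Prop :=
  forall x y, A x -> A y -> exists g : R -> plane R,
    [/\ {within `[0, 1]%classic, continuous g},
        forall t, 0 <= t <= 1 -> A (g t), g 0 = x & g 1 = y].

Definition null_homotopic (R : realType) (A : set (plane R))
    (g : R -> plane R) : Prop :=
  exists H : R * R -> plane R,
    [/\ {within `[0, 1]%classic `*` `[0, 1]%classic, continuous H},
        forall s t, 0 <= s <= 1 -> 0 <= t <= 1 -> A (H (s, t)),
        forall t, 0 <= t <= 1 -> H (0, t) = g t,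
        forall t, 0 <= t <= 1 -> H (1, t) = g 0 &
        forall s, 0 <= s <= 1 -> H (s, 0) = g 0 /\ H (s, 1) = g 0].

Definition simply_connected (R : realType) (A : set (plane R)) : Prop :=
  path_connected A /\
  forall g : R -> plane R,
    {within `[0, 1]%classic, continuous g} ->
    (forall t, 0 <= t <= 1 -> A (g t)) -> g 0 = g 1 -> null_homotopic A g.

Definition mu2 (R : realType) :=
  (@lebesgue_measure R \x @lebesgue_measure R)%E.

(* Square integrability on [A] of the restriction of [f] to [A], through its
   extension by zero. *)
Definition L2 (R : realType) (A : set (plane R)) : set (plane R -> R) :=
  [set f | (fun x => \1_A x * f x) \in Lfun (@mu2 R) 2%:E].

Definition L2v (R : realType) (A : set (plane R)) :
    set (plane R -> plane R) :=
  [set v | L2 A (fun x => (v x).1) /\ L2 A (fun x => (v x).2)].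

Definition ae_on (R : realType) (U : Type) (A : set (plane R))
    (f g : plane R -> U) : Prop :=
  {ae @mu2 R, forall x, A x -> f x = g x}.

Definition dx (R : realType) (f : plane R -> R) : plane R -> R :=
  'D_((1, 0) : plane R) f.
Definition dy (R : realType) (f : plane R -> R) : plane R -> R :=
  'D_((0, 1) : plane R) f.

Fixpoint Ck (R : realType) (k : nat) (f : plane R -> R) : Prop :=
  if k is k'.+1 then
    [/\ continuous f,
        forall x, derivable f x ((1, 0) : plane R),
        forall x, derivable f x ((0, 1) : plane R),
        Ck k' (dx f) & Ck k' (dy f)]
  else continuous f.

Definition test_function (R : realType) (A : set (plane R))
    (phi : plane R -> R) : Prop :=
  (forall k, Ck k phi) /\
  exists K, [/\ compact K, K `<=` A & forall x, ~ K x -> phi x = 0].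

Definition weak_grad (R : realType) (A : set (plane R)) (u : plane R -> R)
    (g : plane R -> plane R) : Prop :=
  forall phi, test_function A phi ->
    (\int[@mu2 R]_(x in A) (u x * dx phi x) =
      - (\int[@mu2 R]_(x in A) ((g x).1 * phi x))) /\
    (\int[@mu2 R]_(x in A) (u x * dy phi x) =
      - (\int[@mu2 R]_(x in A) ((g x).2 * phi x))).

Definition weak_div (R : realType) (A : set (plane R))
    (v : plane R -> plane R) (w : plane R -> R) : Prop :=
  forall phi, test_function A phi ->
    \int[@mu2 R]_(x in A) ((v x).1 * dx phi x + (v x).2 * dy phi x) =
      - (\int[@mu2 R]_(x in A) (w x * phi x)).

Definition H1 (R : realType) (A : set (plane R)) : set (plane R -> R) :=
  [set u | L2 A u /\ exists2 g, L2v A g & weak_grad A u g].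

Definition Hdiv (R : realType) (A : set (plane R)) :
    set (plane R -> plane R) :=
  [set v | L2v A v /\ exists2 w, L2 A w & weak_div A v w].

Notation poly2 R := (mpoly 2 R).

Definition peval (R : realType) (p : poly2 R) (x : plane R) : R :=
  meval (fun i : 'I_2 => if i == ord0 then x.1 else x.2) p.

Definition veval (R : realType) (p : poly2 R * poly2 R) (x : plane R) :
  plane R := (peval p.1 x, peval p.2 x).

(* [mmeasure mdeg p] is [msize p], that is 1 + the total degree of [p]. *)
Definition Pol (R : realType) (m : nat) : set (poly2 R) :=
  [set p | (mmeasure mdeg p <= m.+1)%N].
Arguments Pol : clear implicits.

Definition VPol (R : realType) (m : nat) : set (poly2 R * poly2 R) :=
  [set v | Pol R m v.1 /\ Pol R m v.2].
Arguments VPol : clear implicits.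

Definition var (R : realType) (i : 'I_2) : poly2 R := mpolyX R (mnm1 i).

Definition RTpol (R : realType) (d : nat) : set (poly2 R * poly2 R) :=
  [set v | exists p q, [/\ VPol R d p, q \is ishomog1 d mdeg &
    v = (p.1 + var R ord0 * q, p.2 + var R ord_max * q)]].
Arguments RTpol : clear implicits.

Definition broken (R : realType) (Th : triangulation R) (m : nat) :
  set ('I_(ntri Th) -> poly2 R) := [set s | forall T, Pol R m (s T)].

Definition constf (R : realType) (Th : triangulation R) (c : R) :
  'I_(ntri Th) -> poly2 R := fun=> mpolyC 2 c.
Arguments constf [R] Th c _.

Definition D0br (R : realType) (Th : triangulation R)
    (u : 'I_(ntri Th) -> poly2 R) : 'I_(ntri Th) -> poly2 R * poly2 R :=
  fun T => (mderiv ord0 (u T), mderiv ord_max (u T)).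

Definition rotf (R : realType) (Th : triangulation R)
    (v : 'I_(ntri Th) -> poly2 R * poly2 R) :
    'I_(ntri Th) -> poly2 R * poly2 R :=
  fun T => rot (v T).

Definition divbr (R : realType) (Th : triangulation R)
    (v : 'I_(ntri Th) -> poly2 R * poly2 R) : 'I_(ntri Th) -> poly2 R :=
  fun T => mderiv ord0 (v T).1 + mderiv ord_max (v T).2.

(* The function on the plane given by a family: its polynomial on each open
   triangle, zero elsewhere (on Omega, only a null set is concerned). *)
Definition pw (R : realType) (Th : triangulation R)
    (s : 'I_(ntri Th) -> poly2 R) (x : plane R) : R :=
  \sum_T \1_(interior (tri T)) x * peval (s T) x.

Definition pwv (R : realType) (Th : triangulation R)
    (v : 'I_(ntri Th) -> poly2 R * poly2 R) (x : plane R) : plane R :=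
  (pw (fun T => (v T).1) x, pw (fun T => (v T).2) x).

(* Bernstein coefficient vector of [p] on the segment from [a] to [b]; it
   exists and is unique when [p] has degree at most [m] on a nontrivial
   segment, and is 0 by convention when there is none. *)
Definition ecoef (R : realType) (m : nat) (a b : plane R) (p : poly2 R) :
    'cV[R]_m.+1 :=
  xget 0 [set r : 'cV[R]_m.+1 | forall t : R,
    peval p (a + t *: (b - a)) =
    \sum_(j < m.+1) r j ord0 * 'C(m, j)%:R * t ^+ j * (1 - t) ^+ (m - j)].

Definition ncomp (R : realType) (n : plane R) (v : poly2 R * poly2 R) :
  poly2 R := n.1 *: v.1 + n.2 *: v.2.

Definition C0e (R : realType) (Th : triangulation R) (E : interior_edges Th)
    (m : nat) (e : 'I_(nedge E)) (u : 'I_(ntri Th) -> poly2 R) :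
    'cV[R]_m.+1 :=
  ecoef m (ea e) (eb e) (u (Tplus e)) - ecoef m (ea e) (eb e) (u (Tminus e)).

Definition C1dive (R : realType) (Th : triangulation R)
    (E : interior_edges Th) (m : nat) (e : 'I_(nedge E))
    (v : 'I_(ntri Th) -> poly2 R * poly2 R) : 'cV[R]_m.+1 :=
  ecoef m (ea e) (eb e) (ncomp (enormal e) (v (Tplus e))) -
  ecoef m (ea e) (eb e) (ncomp (enormal e) (v (Tminus e))).

(* In [C0] and [C1div], [m] is the degree of the coefficient vectors. *)
Definition C0 (R : realType) (Th : triangulation R) (E : interior_edges Th)
    (m : nat) (u : 'I_(ntri Th) -> poly2 R) :
    'cV[R]_(\sum_(e < nedge E) m.+1) :=
  \mxcol_(e < nedge E) C0e m e u.

Definition C1div (R : realType) (Th : triangulation R)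
    (E : interior_edges Th) (m : nat)
    (v : 'I_(ntri Th) -> poly2 R * poly2 R) :
    'cV[R]_(\sum_(e < nedge E) m.+1) :=
  \mxcol_(e < nedge E) C1dive m e v.

Definition Umx (R : realType) (m : nat) : 'M[R]_(m, m.+1) :=
  \matrix_(i, j) (m%:R * ((j == i.+1 :> nat)%:R - (j == i :> nat)%:R)).

Definition B0 (R : realType) (Th : triangulation R) (E : interior_edges Th)
    (d : nat) :
    'M[R]_(\sum_(e < nedge E) d.+1, \sum_(e < nedge E) d.+2) :=
  \mxblock_(e < nedge E, e' < nedge E)
    (if e == e' then (elen e)^-1 *: Umx R d.+1 else 0).

Definition V0 (R : realType) (Th : triangulation R) (E : interior_edges Th)
    (d : nat) : set ('I_(ntri Th) -> poly2 R) :=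
  [set u | broken d.+1 u /\ C0 E d.+1 u = 0].

Definition V1 (R : realType) (Th : triangulation R) (E : interior_edges Th)
    (d : nat) (loc : set (poly2 R * poly2 R)) :
    set ('I_(ntri Th) -> poly2 R * poly2 R) :=
  [set v | (forall T, loc (v T)) /\ C1div E d v = 0].

Definition V1div (R : realType) (Th : triangulation R)
    (E : interior_edges Th) (d : nat) := V1 E d (VPol R d).

Definition V2 (R : realType) (Th : triangulation R) (d : nat) :
  set ('I_(ntri Th) -> poly2 R) := broken d.-1.
Arguments V2 [R] Th d _.

Definition subspace (R : realType) (V : lmodType R) (A : set V) : Prop :=
  A 0 /\ forall (a : R) u v, A u -> A v -> A (a *: u + v).

(* The spaces are linear and included in the continuous ones (families being
   determined by the functions they define), the discrete differentials map
   each space to the next one with zero compositions, and they are the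
   restrictions of the weak differentials. *)
Definition fe_subcomplex (R : realType) (Th : triangulation R)
    (E : interior_edges Th) (d : nat) : Prop :=
  let O := Omega Th in
  [/\ [/\ subspace (V0 E d), subspace (V1div E d) & subspace (V2 Th d)],
      [/\ forall u, V0 E d u -> ae_on O (pw u) (cst 0) -> u = 0,
          forall v, V1div E d v -> ae_on O (pwv v) (cst 0) -> v = 0 &
          forall w, V2 Th d w -> ae_on O (pw w) (cst 0) -> w = 0],
      [/\ forall c, V0 E d (constf Th c),
          forall u, V0 E d u -> V1div E d (rotf (D0br u)) &
          forall v, V1div E d v -> V2 Th d (divbr v)],
      (forall c, rotf (D0br (constf Th c)) = 0) /\
      (forall u, V0 E d u -> divbr (rotf (D0br u)) = 0) &
      [/\ forall c, ae_on O (pw (constf Th c)) (cst c),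
          forall u, V0 E d u ->
            [/\ H1 O (pw u), weak_grad O (pw u) (pwv (D0br u)) &
                pwv (rotf (D0br u)) = (fun x => rot (pwv (D0br u) x))],
          forall v, V1div E d v ->
            Hdiv O (pwv v) /\ weak_div O (pwv v) (pw (divbr v)) &
          forall w, V2 Th d w -> L2 O (pw w)]].

Definition fe_exact (R : realType) (Th : triangulation R)
    (E : interior_edges Th) (d : nat) : Prop :=
  [/\ injective (constf Th),
      [set u | V0 E d u /\ rotf (D0br u) = 0] = range (constf Th),
      [set v | V1div E d v /\ divbr v = 0]
        = [set rotf (D0br u) | u in V0 E d] &
      [set divbr v | v in V1div E d] = V2 Th d].

(* [L2fields V] and [Hdiv_local loc] are sets of vector fields saturated for
   almost everywhere equality of measurable fields on Omega; measurability is
   required in the former because Borel measurability is not preserved under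
   almost everywhere equality. *)
Definition L2fields (R : realType) (Th : triangulation R)
    (V : set ('I_(ntri Th) -> poly2 R * poly2 R)) :
    set (plane R -> plane R) :=
  [set v | measurable_fun (Omega Th) v /\
           exists2 s, V s & ae_on (Omega Th) v (pwv s)].

Definition Hdiv_local (R : realType) (Th : triangulation R)
    (loc : set (poly2 R * poly2 R)) : set (plane R -> plane R) :=
  [set v | Hdiv (Omega Th) v /\
           forall T : 'I_(ntri Th), exists2 p, loc p & ae_on (tri T) v (veval p)].

(* Main.v *)
(* Along an edge, the normal component of a rotated gradient is the tangential
   derivative, and differentiation acts on Bernstein coefficients as [Umx];
   this is the commutation of the jumps.  Green's formula on each triangle,
   summed over the triangulation, shows that the distributional divergence of a
   piecewise polynomial field is its piecewise divergence plus the normal jumps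
   carried by the interior edges; testing with functions that concentrate on a
   piece of one edge, a field in H(div) has no jumps, whence the BDM and RT
   spaces.  For exactness at V1, the local stream functions of a divergence-free
   field agree up to constants on overlapping balls, and simple connectedness
   turns them into one function.  For surjectivity of the divergence, a broken
   solution is corrected by broken rotated gradients: bubbles handle the jumps of
   mean zero, and piecewise linear functions handle the means, by a duality
   argument that propagates zero from an edge on the boundary through the
   connected triangulation. *)
Require Import Defs.
From HB Require Import structures.
From mathcomp Require Import all_boot all_order all_algebra.
From mathcomp Require Import -(notations) mpoly.
From mathcomp Require Import all_classical all_reals all_analysis.
From mathcomp Require Import measurable_realfun ring lra zify.
(* Imported again so that [rot] is the rotation of [Defs] and not [seq.rot]. *)
Require Import Defs.

Set Implicit Arguments.
Unset Strict Implicit.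
Unset Printing Implicit Defensive.

Import Order.TTheory GRing.Theory Num.Theory numFieldNormedType.Exports.

Local Open Scope classical_set_scope.
Local Open Scope ring_scope.

(** * Polynomials in two variables *)

Section poly2_evaluation.
Variable R : realType.
Implicit Types (p q : poly2 R) (a b x : plane R).

(** Edge conditions are treated as equalities of univariate polynomials in the edge parameter: once
    degrees along edges are bounded, Bernstein coefficients are mere coordinates for them. The bound
    for the Raviart-Thomas space rests on the position vector having a constant normal component on
    a line.

    The obstacle that shapes the geometry is the vertices. Conformity constrains triangles only
    pairwise, no cyclic order of the triangles around a vertex is given, and the domain need not be
    Lipschitz. Hence no trace theorem and no walk around a vertex is used. Edge integrals ignore
    endpoints, bumps sit inside an edge, and connectedness is propagated along segments in general
    position, which miss all vertices because finitely many null sets cannot cover an open set. The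
    stream function is handled through its increments between two points of a common triangle; these
    are well defined across edges and at vertices alike.

    In the duality argument the unknowns are the values at the three vertices of each triangle
    separately, and the equations are the means of the jumps, one per interior edge. *)

Lemma poly2_ind (P : poly2 R -> Prop) :
  (forall c, P (mpolyC 2 c)) -> (forall i, P (var R i)) ->
  (forall p q, P p -> P q -> P (p + q)) ->
  (forall p q, P p -> P q -> P (p * q)) -> forall p, P p.
Proof.
move=> PC PX PD PM p; elim/(@mpolyind 2 R): p => [|c m p _ _ Pp].
  by rewrite -(mpolyC0 2); exact: PC.
apply: (PD) => //; rewrite -mul_mpolyC; apply: (PM); first exact: PC.
rewrite mpolyXE_id; apply: (big_ind P).
- by rewrite -(mpolyC1 2 R); exact: PC.
- by move=> *; exact: PM.
move=> i _; elim: (m i) => [|k IHk]; first by rewrite expr0 -(mpolyC1 2 R); exact: PC.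
by rewrite exprS; apply: (PM) => //; exact: PX.
Qed.

Lemma pevalC c x : peval (mpolyC 2 c) x = c :> R.
Proof. exact: mevalC. Qed.
Lemma peval0 x : peval 0 x = 0 :> R.
Proof. exact: meval0. Qed.
Lemma pevalD p q x : peval (p + q) x = peval p x + peval q x.
Proof. exact: mevalD. Qed.
Lemma pevalB p q x : peval (p - q) x = peval p x - peval q x.
Proof. exact: mevalB. Qed.
Lemma pevalN p x : peval (- p) x = - peval p x.
Proof. exact: mevalN. Qed.
Lemma pevalM p q x : peval (p * q) x = peval p x * peval q x.
Proof. exact: mevalM. Qed.
Lemma pevalZ c p x : peval (c *: p) x = c * peval p x.
Proof. exact: mevalZ. Qed.
Lemma pevalX i x : peval (var R i) x = if i == ord0 then x.1 else x.2.
Proof. exact: mevalXU. Qed.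

Lemma ord2_cases (i : 'I_2) : i = ord0 \/ i = ord_max.
Proof. by case: i => -[|[|//]] h; [left|right]; exact: val_inj. Qed.

Lemma mderiv_var i j : mderiv i (var R j) = mpolyC 2 (i == j)%:R.
Proof.
rewrite mderivX; case: (eqVneq i j) => [->|ij].
  have -> : mnm_sub (mnm1 j) (mnm1 j) = mnm0 by apply/mnmP => k; rewrite mnmBE subnn mnm0E.
  by rewrite mnm1E eqxx scale1r mpolyX0.
by rewrite mnm1E eq_sym (negbTE ij) scale0r mpolyC0.
Qed.

(** Substitution of the parametrized line, kept as a univariate polynomial so that degree,
    derivation and root counting are available along edges. *)
Definition lpoly a b p : {poly R} :=
  mmap (@polyC R)
    (fun i : 'I_2 => (if i == ord0 then a.1 else a.2)%:P +
       (if i == ord0 then (b - a).1 else (b - a).2) *: 'X) p.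

Lemma lpolyD a b p q : lpoly a b (p + q) = lpoly a b p + lpoly a b q.
Proof. exact: mmapD. Qed.
Lemma lpolyN a b p : lpoly a b (- p) = - lpoly a b p.
Proof. exact: mmapN. Qed.
Lemma lpolyM a b p q : lpoly a b (p * q) = lpoly a b p * lpoly a b q.
Proof. exact: (rmorphM (mmap _ _)). Qed.
Lemma lpolyC a b c : lpoly a b (mpolyC 2 c) = c%:P.
Proof. exact: mmapC. Qed.
Lemma lpolyZ a b c p : lpoly a b (c *: p) = c *: lpoly a b p.
Proof. by rewrite -mul_mpolyC lpolyM lpolyC mul_polyC. Qed.
Lemma lpolyX a b i : lpoly a b (var R i) = (if i == ord0 then a.1 else a.2)%:P +
       (if i == ord0 then (b - a).1 else (b - a).2) *: 'X.
Proof. by rewrite /lpoly mmapX mmap1U. Qed.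

Lemma lpolyE a b p t : (lpoly a b p).[t] = peval p (a + t *: (b - a)).
Proof.
elim/poly2_ind: p => [c|i|p q IHp IHq|p q IHp IHq].
- by rewrite lpolyC hornerC pevalC.
- rewrite lpolyX pevalX hornerD hornerC hornerZ hornerX.
  by case: (ord2_cases i) => -> /=; rewrite mulrC.
- by rewrite lpolyD hornerD pevalD IHp IHq.
- by rewrite lpolyM hornerM pevalM IHp IHq.
Qed.

Lemma size_lpoly a b p m : Pol R m p -> (size (lpoly a b p) <= m.+1)%N.
Proof.
rewrite /Pol /= => hp; rewrite /lpoly /mmap.
apply: (leq_trans (size_sum _ _ _)); apply/bigmax_leqP_seq => k kp _.
have hk : (mdeg k < m.+1)%N by apply: leq_trans (msize_mdeg_lt kp) hp.
rewrite mul_polyC; apply: leq_trans (size_scale_leq _ _) _.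
apply: leq_trans hk; rewrite mdegE /mmap1.
elim/big_ind2: _ => [|r1 n1 r2 n2 h1 h2|i _]; first by rewrite size_poly1.
  apply: (leq_trans (size_polyMleq _ _)); lia.
set l := (_ + _); have sl : (size l <= 2)%N.
  apply: (leq_trans (size_polyD _ _)); rewrite geq_max.
  rewrite (leq_trans (size_polyC_leq1 _)) //.
  by rewrite (leq_trans (size_scale_leq _ _)) // size_polyX.
apply: (leq_trans (size_poly_exp_leq _ _)); nia.
Qed.

Lemma deriv_lpoly a b p : (lpoly a b p)^`() =
  (b - a).1 *: lpoly a b (mderiv ord0 p) +
  (b - a).2 *: lpoly a b (mderiv ord_max p).
Proof.
elim/poly2_ind: p => [c|i|p q IHp IHq|p q IHp IHq].
- by rewrite lpolyC derivC !mderivC !lpolyC !scaler0 addr0.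
- rewrite lpolyX derivD derivC derivZ derivX add0r !mderiv_var !lpolyC.
  case: (ord2_cases i) => -> /=.
    by rewrite scaler0 addr0.
  by rewrite scaler0 add0r.
- by rewrite !mderivD !lpolyD derivD IHp IHq !scalerDr addrACA.
- rewrite !mderivM !lpolyM derivM IHp IHq !lpolyD !lpolyM.
  rewrite -!mul_polyC; ring.
Qed.

Lemma poly_ext (p q : {poly R}) : (forall t, p.[t] = q.[t]) -> p = q.
Proof.
move=> pq; apply/eqP; rewrite -subr_eq0; apply/negPn/negP => nz.
have := @max_poly_roots _ (p - q) [seq i%:R | i <- iota 0 (size (p - q))] nz.
rewrite size_map size_iota ltnn; case/(_ _ _)/Bool.diff_false_true.
  by apply/allP => x _; rewrite rootE !hornerE pq subrr.
by rewrite map_inj_uniq ?iota_uniq // => i j /eqP; rewrite eqr_nat => /eqP.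
Qed.

End poly2_evaluation.

(** * Bernstein coefficients as coordinates of univariate polynomials *)

Section bernstein.
Variable R : realType.
Implicit Types (p q : poly2 R) (a b x : plane R).

Definition bern m (r : 'cV[R]_m.+1) : {poly R} :=
  \sum_(j < m.+1) (r j ord0 * 'C(m, j)%:R) *: ('X^j * (1 - 'X) ^+ (m - j)).

Lemma horner_bern m (r : 'cV[R]_m.+1) t : (bern r).[t] =
  \sum_(j < m.+1) r j ord0 * 'C(m, j)%:R * t ^+ j * (1 - t) ^+ (m - j).
Proof.
rewrite /bern horner_sum; apply: eq_bigr => j _.
by rewrite hornerZ hornerM hornerXn horner_exp hornerD hornerN hornerC hornerX !mulrA.
Qed.

Lemma bern_lin m c (r s : 'cV[R]_m.+1) : bern (c *: r + s) = c *: bern r + bern s.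
Proof.
rewrite /bern scaler_sumr -big_split /=; apply: eq_bigr => j _.
by rewrite !mxE scalerA -scalerDl; congr (_ *: _); ring.
Qed.

(** The term of index [j] is divisible by ['X^j], so the system for the coefficients is triangular
    with diagonal entries ['C(m, j)]. *)
Lemma bern_inj m : injective (@bern m).
Proof.
suff b0 (r : 'cV[R]_m.+1) : bern r = 0 -> r = 0.
  move=> r s /eqP; rewrite -subr_eq0 => /eqP rs; apply/eqP; rewrite -subr_eq0.
  by apply/eqP/b0; rewrite -scaleN1r addrC bern_lin scaleN1r addrC.
move=> br; apply/matrixP => j k; rewrite !mxE (ord1 k) {k}.
have [n] := ubnP (j : nat); elim: n j => // n IHn j jn.
have := congr1 (fun s : {poly R} => s`_j) br.
rewrite /bern coef_sum coef0 (bigD1 j) //= coefZ coefXnM ltnn subnn.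
rewrite -horner_coef0 horner_exp !hornerE subr0 expr1n mulr1 big1.
  rewrite addr0 => /eqP; rewrite mulf_eq0 pnatr_eq0 -leqn0 leqNgt bin_gt0.
  by rewrite -ltnS ltn_ord orbF => /eqP.
move=> i ij; rewrite coefZ coefXnM; case: ltnP => [_|]; first by rewrite mulr0.
rewrite leq_eqVlt => /orP[/eqP/val_inj e|ij']; first by rewrite e eqxx in ij.
by rewrite IHn ?mul0r //; apply: (leq_trans ij').
Qed.

(** Products of powers of ['X] and [1 - 'X] of degree below [m] are raised to degree [m] by repeated
    multiplication with ['X + (1 - 'X)]; [l] is the missing degree. *)
Lemma bern_exists m (p : {poly R}) : (size p <= m.+1)%N ->
  exists r : 'cV[R]_m.+1, p = bern r.
Proof.
move=> sp; pose B := fun s : {poly R} => exists r : 'cV[R]_m.+1, s = bern r.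
have B0 : B 0.
  exists 0; rewrite /bern big1 // => j _; by rewrite mxE mul0r scale0r.
have BD c (q s : {poly R}) : B q -> B s -> B (c *: q + s).
  by move=> [r1 ->] [r2 ->]; exists (c *: r1 + r2); rewrite bern_lin.
have BX l : forall k, (k + l <= m)%N -> B ('X^(m - k - l) * (1 - 'X) ^+ k).
  elim: l => [|l IHl] k kl.
    have km : (m - k < m.+1)%N by lia.
    exists (\col_j (if j == Ordinal km then 'C(m, m - k)%:R^-1 else 0)).
    rewrite /bern (bigD1 (Ordinal km)) //= big1 => [|i /negbTE ik]; last first.
      by rewrite mxE ik mul0r scale0r.
    rewrite mxE eqxx mulVf ?scale1r ?addr0 ?subn0 ?subKn //; first lia.
    by rewrite pnatr_eq0 -lt0n bin_gt0; lia.
  have h1 := IHl k.+1; have h2 := IHl k.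
  have -> : 'X^(m - k - l.+1) * (1 - 'X) ^+ k =
      1 *: ('X^(m - k.+1 - l) * (1 - 'X) ^+ k.+1) + 'X^(m - k - l) * (1 - 'X) ^+ k
      :> {poly R}.
    rewrite scale1r; have -> : (m - k.+1 - l = m - k - l.+1)%N by lia.
    have -> : (m - k - l = (m - k - l.+1).+1)%N by lia.
    rewrite !exprS; ring.
  by apply: BD; [apply: h1|apply: h2]; lia.
rewrite -[p](@coefK) poly_def; elim/big_ind: _ => //.
  by move=> x y Bx By; rewrite -[x]scale1r; apply: BD.
move=> i _; rewrite -[_ *: _]addr0; apply: BD => //.
have := BX (m - i)%N 0%N; rewrite expr0 mulr1 subn0.
have -> : (m - (m - i) = i)%N by have := ltn_ord i; lia.
by apply; lia.
Qed.

(** Each basis product differentiates to two products of degree [m]; after a shift of index both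
    binomial weights become [m.+1] times ['C(m, j)], and neighbouring coefficients combine into
    differences. *)
Lemma deriv_bern m (r : 'cV[R]_m.+2) : (bern r)^`() = bern (Umx R m.+1 *m r).
Proof.
have dt (j : nat) : ('X^j * (1 - 'X) ^+ (m.+1 - j))^`() =
    j%:R *: ('X^(j.-1) * (1 - 'X) ^+ (m.+1 - j)) -
    (m.+1 - j)%:R *: ('X^j * (1 - 'X) ^+ (m - j)) :> {poly R}.
  rewrite derivM derivXn deriv_exp derivB derivX derivC sub0r.
  rewrite -(scaler_nat j 'X^(j.-1)) -(scaler_nat (m.+1 - j)).
  rewrite -!mul_polyC; have -> : ((m.+1 - j).-1 = m - j)%N by lia.
  ring.
rewrite /bern raddf_sum /=.
under eq_bigr do rewrite derivZ dt scalerBr !scalerA.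
rewrite big_split /= sumrN.
rewrite big_ord_recl mulr0 scale0r add0r [X in _ - X]big_ord_recr /=.
rewrite subnn mulr0 scale0r addr0 -sumrN -big_split /=; apply: eq_bigr => j _.
have jm := ltn_ord j.
have -> : (bump 0 j = j.+1)%N by []; rewrite subSS /= -scalerBl; congr (_ *: _).
rewrite mxE.
have -> : \sum_j0 Umx R m.+1 j j0 * r j0 ord0 =
   m.+1%:R * (r (lift ord0 j) ord0 - r (widen_ord (leqnSn _) j) ord0).
  rewrite (bigD1 (lift ord0 j)) //= (bigD1 (widen_ord (leqnSn _) j)); last first.
    by apply/eqP => /(congr1 val) /=; rewrite /bump /=; lia.
  rewrite big1 => [|i /andP[/negbTE i1 /negbTE i2]]; rewrite !mxE.
    rewrite /= /bump /= !add1n eqxx.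
    have -> : (j.+1 == j)%N = false by lia.
    have -> : (nat_of_ord j == j.+1)%N = false by lia.
    rewrite eqxx /=; ring.
  by rewrite -!val_eqE /= /bump /= add1n in i1 i2; rewrite i1 i2 subr0 mulr0 mul0r.
have e1 : 'C(m.+1, j.+1)%:R * j.+1%:R = m.+1%:R * 'C(m, j)%:R :> R.
  by rewrite -!natrM mul_bin_diag mulnC.
have e2 : 'C(m.+1, j)%:R * (m.+1 - j)%:R = m.+1%:R * 'C(m, j)%:R :> R.
  by rewrite -!natrM mul_bin_down mulnC.
rewrite -!mulrA e1 e2; ring.
Qed.

(** The degree bound makes the set in [ecoef] nonempty, so its default value 0 does not
    intervene. *)
Lemma ecoefP m a b p : (size (lpoly a b p) <= m.+1)%N ->
  lpoly a b p = bern (ecoef m a b p).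
Proof.
case/bern_exists => r pr; apply: poly_ext => t.
rewrite lpolyE horner_bern; rewrite /ecoef.
set S := [set r | _]; have : S (xget 0 S); last exact.
by apply: (@xgetPex _ 0 S); exists r => u; rewrite -lpolyE pr horner_bern.
Qed.

Lemma ecoef_eq m a b p q : (size (lpoly a b p) <= m.+1)%N ->
  (size (lpoly a b q) <= m.+1)%N ->
  ecoef m a b p - ecoef m a b q = 0 <-> lpoly a b p = lpoly a b q.
Proof.
move=> sp sq; split => [/eqP|e].
  by rewrite subr_eq0 => /eqP e; rewrite (ecoefP sp) (ecoefP sq) e.
by apply/eqP; rewrite subr_eq0; apply/eqP/bern_inj; rewrite -ecoefP // -ecoefP.
Qed.
End bernstein.

(** * Degree counts, polynomial stream functions and the commuting identity *)

Section polyspaces.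
Variable R : realType.
Implicit Types (p q : poly2 R) (a b x : plane R).

Lemma PolD m c p q : Pol R m p -> Pol R m q -> Pol R m (c *: p + q).
Proof.
rewrite /Pol /= => hp hq; apply: (leq_trans (msizeD_le _ _)); rewrite geq_max hq.
by rewrite andbT; apply: leq_trans hp; exact: msizeZ_le.
Qed.

Lemma Pol0 m : Pol R m 0.
Proof. by rewrite /Pol /= mmeasure0. Qed.

Lemma PolZ m c p : Pol R m p -> Pol R m (c *: p).
Proof. by move=> hp; rewrite -[_ *: _]addr0; apply: PolD => //; exact: Pol0. Qed.

Lemma PolN m p : Pol R m p -> Pol R m (- p).
Proof. by rewrite -scaleN1r; exact: PolZ. Qed.

Lemma PolC m c : Pol R m (mpolyC 2 c).
Proof. by rewrite /Pol /= msizeC; case: eqP. Qed.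

Lemma Pol_sum m (I : Type) (r : seq I) (P : pred I) (F : I -> poly2 R) :
  (forall i, P i -> Pol R m (F i)) -> Pol R m (\sum_(i <- r | P i) F i).
Proof.
move=> h; elim/big_ind: _ => //; first exact: Pol0.
by move=> p q hp hq; rewrite -[p]scale1r; apply: PolD.
Qed.

Lemma PolM m n p q : Pol R m p -> Pol R n q -> Pol R (m + n) (p * q).
Proof.
rewrite /Pol /= => hp hq.
have [->|p0] := eqVneq p 0; first by rewrite mul0r mmeasure0.
have [->|q0] := eqVneq q 0; first by rewrite mulr0 mmeasure0.
rewrite msizeM //.
have aux (i j : nat) : (i <= m.+1)%N -> (j <= n.+1)%N -> ((i + j).-1 <= (m + n).+1)%N.
  by lia.
exact: aux.
Qed.

Lemma Pol_var i : Pol R 1 (var R i).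
Proof. by rewrite /Pol /= msizeX mdeg1. Qed.

Lemma Pol_mderiv m i p : Pol R m p -> Pol R m.-1 (mderiv i p).
Proof.
rewrite /Pol /= => hp; rewrite /mderiv; apply: Pol_sum => k _.
case: (eqVneq (k i) 0%N) => [->|ki]; first by rewrite mul0r scale0r; exact: Pol0.
case: (eqVneq (mcoeff k p) 0) => [->|kp]; first by rewrite mulr0 scale0r; exact: Pol0.
apply: PolZ; rewrite /Pol /= msizeX.
have kd : (mdeg k < m.+1)%N.
  by apply: leq_trans hp; apply: msize_mdeg_lt; rewrite mcoeff_msupp.
have : (mdeg (mnm_sub k (mnm1 i)) + mdeg (mnm1 i) = mdeg k)%N.
  rewrite -mdegD; congr mdeg; apply/mnmP => j.
  rewrite mnmDE mnmBE mnm1E subnK //; case: eqP => [<-|//].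
  by rewrite lt0n.
by rewrite mdeg1; lia.
Qed.

Lemma mderiv_eq0 i p k : mderiv i p = 0 -> k \in msupp p -> k i = 0%N.
Proof.
move=> dp kp; apply/eqP/negPn/negP => ki.
have := congr1 (mcoeff (mnm_sub k (mnm1 i))) dp.
have e : mnm_add (mnm_sub k (mnm1 i)) (mnm1 i) = k.
  apply/mnmP => j; rewrite mnmDE mnmBE mnm1E subnK //; case: eqP => [<-|//].
  by rewrite lt0n.
rewrite mcoeff_mderiv e mcoeff0 => /eqP; rewrite mulrn_eq0 /=.
by rewrite -[_ == 0]negbK -mcoeff_msupp kp.
Qed.

Lemma mderiv_const p : mderiv ord0 p = 0 -> mderiv ord_max p = 0 ->
  p = mpolyC 2 (mcoeff mnm0 p).
Proof.
move=> d0 d1; apply/mpolyP => k; rewrite mcoeffC.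
case: (eqVneq mnm0 k) => [<-|k0]; first by rewrite mulr1.
rewrite mulr0; apply/eqP/negPn/negP; rewrite -mcoeff_msupp => kp.
case/eqP: k0; apply/mnmP => i; rewrite mnm0E.
by case: (ord2_cases i) => ->; rewrite (mderiv_eq0 _ kp).
Qed.

Definition antideriv (i : 'I_2) p : poly2 R :=
  \sum_(k <- msupp p) (mcoeff k p / (k i).+1%:R) *: mpolyX R (mnm_add k (mnm1 i)).

Lemma mderiv_antideriv i p : mderiv i (antideriv i p) = p.
Proof.
rewrite /antideriv raddf_sum /= [RHS]mpolyE; apply: eq_bigr => k _.
rewrite mderivZ mderivX mnmDE mnm1E eqxx addn1 scalerA divfK ?pnatr_eq0 //.
by congr (_ *: mpolyX _ _); exact: addmK.
Qed.

Lemma mderiv_antideriv0 i j p : j != i -> mderiv j p = 0 ->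
  mderiv j (antideriv i p) = 0.
Proof.
move=> ji dp; rewrite /antideriv raddf_sum /= big_seq big1 // => k kp.
rewrite mderivZ mderivX mnmDE mnm1E (mderiv_eq0 dp kp) eq_sym (negbTE ji).
by rewrite scale0r scaler0.
Qed.

Lemma Pol_antideriv i m p : Pol R m p -> Pol R m.+1 (antideriv i p).
Proof.
move=> hp; rewrite /antideriv big_seq; apply: Pol_sum => k kp; apply: PolZ.
rewrite /Pol /= msizeX mdegD mdeg1 addn1 ltnS.
exact: leq_trans (msize_mdeg_lt kp) hp.
Qed.

(** The stream function integrates [v2] in the first variable. [w] is the defect left in the second
    equation; zero divergence says that [w] does not depend on the first variable, so its integral
    in the second one does not disturb the first equation. *)
Lemma poly_stream m (v : poly2 R * poly2 R) : VPol R m v ->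
  mderiv ord0 v.1 + mderiv ord_max v.2 = 0 ->
  exists2 u, Pol R m.+1 u & rot (mderiv ord0 u, mderiv ord_max u) = v.
Proof.
case: v => v1 v2 [/= h1 h2] dv.
pose w := - v1 - mderiv ord_max (antideriv ord0 v2).
have dw : mderiv ord0 w = 0.
  rewrite mderivB mderivN mderiv_comm mderiv_antideriv.
  by rewrite -opprD dv oppr0.
have hw : Pol R m w.
  rewrite /w -scaleN1r; apply: PolD => //; apply: PolN.
  exact: (@Pol_mderiv m.+1) (Pol_antideriv _ h2).
exists (antideriv ord0 v2 + antideriv ord_max w).
  by rewrite -[antideriv ord0 v2]scale1r; apply: PolD; apply: Pol_antideriv.
rewrite /rot /= !mderivD !mderiv_antideriv (mderiv_antideriv0 _ dw) //.
by rewrite addr0 /w; congr (_, _); ring.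
Qed.

Lemma lpoly_ncomp a b (n : plane R) (v : poly2 R * poly2 R) :
  lpoly a b (ncomp n v) = n.1 *: lpoly a b v.1 + n.2 *: lpoly a b v.2.
Proof. by rewrite /ncomp lpolyD !lpolyZ. Qed.

(* The only property of the local space [loc] on which the interelement
   conditions rely; [n] is any normal to the line through [a] and [b]. *)
Definition normal_deg (d : nat) (loc : set (poly2 R * poly2 R)) :=
  forall a b n v, n.1 * (b - a).1 + n.2 * (b - a).2 = 0 -> loc v ->
    (size (lpoly a b (ncomp n v)) <= d.+1)%N.

Lemma VPol_normal_deg d : normal_deg d (VPol R d).
Proof.
move=> a b n v _ [h1 h2]; apply: size_lpoly; rewrite /ncomp.
by apply: PolD => //; exact: PolZ.
Qed.

(* Along a line orthogonal to [n] the scalar product of [n] with the position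
   vector is constant, so the part [x * q] adds nothing to the degree. *)
Lemma RTpol_normal_deg d : normal_deg d (RTpol R d).
Proof.
move=> a b n v nab [p [q [[h1 h2] hq ->]]].
have hq' : Pol R d q.
  rewrite /Pol /= msizeE; apply/bigmax_leqP_seq => k kq _; rewrite ltnS.
  by move/allP: hq => /(_ _ kq) /= /eqP ->.
have -> : lpoly a b (ncomp n (p.1 + var R ord0 * q, p.2 + var R ord_max * q)) =
   lpoly a b (ncomp n p + (n.1 * a.1 + n.2 * a.2) *: q).
  rewrite lpolyD !lpoly_ncomp /= !lpolyD !lpolyM !lpolyX /= lpolyZ -!mul_polyC.
  have {}nab : n.1%:P * (b - a).1%:P + n.2%:P * (b - a).2%:P = 0 :> {poly R}.
    by rewrite -!polyCM -polyCD nab.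
  have -> : (n.1 * a.1 + n.2 * a.2)%:P = n.1%:P * a.1%:P + n.2%:P * a.2%:P :> {poly R}.
    by rewrite polyCD !polyCM.
  set s1 := (b - a).1%:P in nab *; set s2 := (b - a).2%:P in nab *.
  transitivity (n.1%:P * lpoly a b p.1 + n.2%:P * lpoly a b p.2 +
    (n.1%:P * a.1%:P + n.2%:P * a.2%:P) * lpoly a b q +
    (n.1%:P * s1 + n.2%:P * s2) * ('X * lpoly a b q)); first ring.
  by rewrite nab mul0r addr0.
apply: size_lpoly; rewrite addrC; apply: PolD => //.
by rewrite /ncomp; apply: PolD => //; exact: PolZ.
Qed.

Variable Th : triangulation R.
Variable E : interior_edges Th.

Lemma enormal_orth (e : 'I_(nedge E)) :
  (enormal e).1 * (eb e - ea e).1 + (enormal e).2 * (eb e - ea e).2 = 0.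
Proof.
rewrite /enormal /etan /rot; case: (eb e - ea e) => y z /=.
by rewrite /GRing.scale /=; ring.
Qed.

Lemma mxcol_eq0 m (F : 'I_(nedge E) -> 'cV[R]_m) :
  \mxcol_(e < nedge E) F e = 0 <-> forall e, F e = 0.
Proof.
split => [h e|h].
  by have := congr1 (fun A => submxcol A e) h; rewrite mxcolK submxcol0.
by apply/mxcolP => e; rewrite mxcolK submxcol0.
Qed.

Lemma C0P m (u : 'I_(ntri Th) -> poly2 R) : broken m u ->
  C0 E m u = 0 <-> forall e : 'I_(nedge E),
    lpoly (ea e) (eb e) (u (Tplus e)) = lpoly (ea e) (eb e) (u (Tminus e)).
Proof.
move=> hu; have s T a b := size_lpoly a b (hu T).
rewrite /C0 mxcol_eq0; split => h e; have := h e; rewrite /C0e.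
  by rewrite ecoef_eq.
by move=> he; apply/ecoef_eq.
Qed.

Lemma C1divP d loc (v : 'I_(ntri Th) -> poly2 R * poly2 R) :
  normal_deg d loc -> (forall T, loc (v T)) ->
  C1div E d v = 0 <-> forall e : 'I_(nedge E),
    lpoly (ea e) (eb e) (ncomp (enormal e) (v (Tplus e))) =
    lpoly (ea e) (eb e) (ncomp (enormal e) (v (Tminus e))).
Proof.
move=> hl hv.
have s (T : 'I_(ntri Th)) (e : 'I_(nedge E)) := hl _ _ _ _ (enormal_orth e) (hv T).
rewrite /C1div mxcol_eq0; split => h e; have := h e; rewrite /C1dive.
  by rewrite ecoef_eq.
by move=> he; apply/ecoef_eq.
Qed.

Lemma broken_grad d (u : 'I_(ntri Th) -> poly2 R) : broken d.+1 u ->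
  forall T, VPol R d (rotf (D0br u) T).
Proof.
move=> hu T; split; rewrite /rotf /D0br /rot /=.
  by apply/PolN; exact: (@Pol_mderiv d.+1).
exact: (@Pol_mderiv d.+1).
Qed.

Lemma lpoly_normal_rotgrad (u : 'I_(ntri Th) -> poly2 R) (e : 'I_(nedge E)) T :
  lpoly (ea e) (eb e) (ncomp (enormal e) (rotf (D0br u) T)) =
  (elen e)^-1 *: (lpoly (ea e) (eb e) (u T))^`().
Proof.
rewrite deriv_lpoly lpoly_ncomp /enormal /etan /rotf /D0br.
case: (eb e - ea e) => y z /=; rewrite lpolyN -!mul_polyC !polyCN.
by rewrite ![(_ *: _)%:P]polyCM; ring.
Qed.

Lemma C1div_rotgrad d (u : 'I_(ntri Th) -> poly2 R) : broken d.+1 u ->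
  C1div E d (rotf (D0br u)) = B0 E d *m C0 E d.+1 u.
Proof.
move=> hu; rewrite /B0 /C0 mxblockEh mul_mxrow_mxcol.
apply/mxcolP => e; rewrite /C1div mxcolK submxcol_sum.
under eq_bigr do rewrite -submxcol_mul mxcolK.
rewrite (bigD1 e) //= big1 ?addr0 ?eqxx => [|e' /negbTE ne]; last first.
  by rewrite eq_sym ne mul0mx.
have hv := broken_grad hu.
have s T : (size (lpoly (ea e) (eb e) (ncomp (enormal e) (rotf (D0br u) T))) <= d.+1)%N.
  by apply: VPol_normal_deg (hv T); exact: enormal_orth.
have su T a b := size_lpoly a b (hu T).
(* Coefficient vectors are compared through the polynomials they represent, on which [Umx] acts as
   derivation. *)
apply: bern_inj; rewrite /C1dive /C0e addrC -scaleN1r bern_lin scaleN1r -!ecoefP //.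
rewrite -scalemxAl -[X in bern X]addr0 bern_lin -deriv_bern.
have -> : bern (0 : 'cV[R]_d.+1) = 0.
  by rewrite /bern big1 // => j _; rewrite mxE mul0r scale0r.
rewrite addr0 (_ : bern (_ - _) = lpoly (ea e) (eb e) (u (Tplus e)) -
    lpoly (ea e) (eb e) (u (Tminus e))); last first.
  by rewrite addrC -scaleN1r bern_lin scaleN1r -!ecoefP // addrC.
by rewrite derivB scalerBr !lpoly_normal_rotgrad addrC.
Qed.

End polyspaces.

(** * Triangles and triangulations *)

Section triangle_geometry.
Variable R : realType.
Implicit Types (a b x y z v w : plane R) (P Q : 'I_3 -> plane R) (k j : 'I_3).

Definition cross v w : R := v.1 * w.2 - v.2 * w.1.

(** Twice the signed area. Vertices are numbered by the integers modulo 3, written [0], [1],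
    [1 + 1], so that cyclic shifts of the numbering make sense. *)
Definition area P : R := cross (P 1 - P 0) (P (1 + 1) - P 0).

Lemma noncollinear_area P : noncollinear P = (area P != 0) :> Prop.
Proof.
rewrite /noncollinear /area /cross.
have -> : inord 1 = 1 :> 'I_3 by apply: val_inj; rewrite /= inordK.
by have -> : inord 2 = 1 + 1 :> 'I_3 by apply: val_inj; rewrite /= inordK.
Qed.

Lemma ord3_cases k : [\/ k = 0, k = 1 | k = 1 + 1].
Proof.
case: k => -[|[|[|//]]] h; [apply: Or31|apply: Or32|apply: Or33]; exact: val_inj.
Qed.

Lemma ord3_eqs : (((1 + 1 + 1)%R = 0%R :> 'I_3) * ((1 + (1 + 1))%R = 0%R :> 'I_3) *
  ((1 + 1 + (1 + 1))%R = 1%R :> 'I_3))%type.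
Proof. by split; [split|]; apply: val_inj. Qed.

Lemma sum3 (V : nmodType) (F : 'I_3 -> V) : \sum_k F k = F 0 + F 1 + F (1 + 1).
Proof.
rewrite !big_ord_recl big_ord0 addr0 addrA; congr (F _ + F _ + F _); exact: val_inj.
Qed.

(** The barycentric coordinate at vertex [k] as a quotient of signed areas: an affine function on
    the whole plane, zero on the line of the opposite edge. *)
Definition bary P k x : R := cross (P (k + 1) - x) (P (k + (1 + 1)) - x) / area P.

Lemma bary_sum P x : area P != 0 -> \sum_k bary P k x = 1.
Proof.
move=> P0; rewrite sum3 /bary !add0r !ord3_eqs -!mulrDl.
rewrite -[RHS](divff P0); congr (_ / _); rewrite /area /cross.
case: (P 0) (P 1) (P (1 + 1)) x => [? ?] [? ?] [? ?] [? ?] /=; ring.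
Qed.

Lemma bary_comb P x : area P != 0 -> x = \sum_k bary P k x *: P k.
Proof.
move=> P0; rewrite sum3 /bary !add0r !ord3_eqs; move: P0.
rewrite /area /cross.
case: (P 0) (P 1) (P (1 + 1)) x => [? ?] [? ?] [? ?] [? ?] /= P0.
by congr (_, _); rewrite /= /GRing.scale /=; field.
Qed.

Lemma bary_affine P k a b t :
  bary P k (a + t *: (b - a)) = (1 - t) * bary P k a + t * bary P k b.
Proof.
rewrite /bary !mulrA -mulrDl; congr (_ / _); rewrite /cross.
case: (P (k + 1)) (P (k + (1 + 1))) a b => [? ?] [? ?] [? ?] [? ?] /=.
by rewrite /GRing.scale /=; ring.
Qed.

Lemma bary_vtx P k j : area P != 0 -> bary P k (P j) = (j == k)%:R.
Proof.
move=> P0; apply: (mulIf P0); rewrite /bary divfK //; rewrite /area /cross.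
case: (ord3_cases j) => ->; case: (ord3_cases k) => ->; rewrite ?add0r ?ord3_eqs /=;
case: (P 0) (P 1) (P (1 + 1)) => [? ?] [? ?] [? ?] /=; ring.
Qed.

Lemma bary_baryc P (l : 'I_3 -> R) k : area P != 0 -> \sum_j l j = 1 ->
  bary P k (\sum_j l j *: P j) = l k.
Proof.
move=> P0; rewrite !sum3 => l1; apply: (mulIf P0); rewrite /bary divfK //.
have {l1} l0 : l 0 = 1 - l 1 - l (1 + 1) by rewrite -l1; ring.
have [k0|k0|k0] := ord3_cases k; rewrite k0 ?add0r ?ord3_eqs l0;
move: (l 1) (l (1 + 1)) => l1 l2; rewrite /area /cross;
case: (P 0) (P 1) (P (1 + 1)) => [? ?] [? ?] [? ?] /=;
rewrite /GRing.scale /=; ring.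
Qed.

Lemma hull3E P : area P != 0 -> hull3 P = [set x | forall k, 0 <= bary P k x].
Proof.
move=> P0; apply/seteqP; split => x /=.
  by move=> [l [l0 l1 ->]] k; rewrite bary_baryc.
move=> xP; exists (bary P ^~ x); split => //; first exact: bary_sum.
exact: bary_comb.
Qed.

Lemma bary_inj P x y : area P != 0 -> (forall k, bary P k x = bary P k y) -> x = y.
Proof.
move=> P0 xy; rewrite (bary_comb x P0) (bary_comb y P0).
by apply: eq_bigr => k _; rewrite xy.
Qed.

Lemma continuous_affine2 (c0 c1 c2 : R) :
  continuous (fun x : plane R => c0 + c1 * x.1 + c2 * x.2).
Proof.
move=> x; apply: cvgD; last by apply: cvgM; [exact: cvg_cst|exact: cvg_snd].
by apply: cvgD; [exact: cvg_cst|apply: cvgM; [exact: cvg_cst|exact: cvg_fst]].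
Qed.

Lemma bary_affine2 P k : exists c0 c1 c2 : R,
  bary P k = fun x => c0 + c1 * x.1 + c2 * x.2.
Proof.
rewrite /bary /cross; case: (P (k + 1)) (P (k + (1 + 1))) => [a1 a2] [b1 b2] /=.
exists ((a1 * b2 - a2 * b1) / area P), ((a2 - b2) / area P), ((b1 - a1) / area P).
by apply/funext => -[x1 x2] /=; ring.
Qed.

Lemma continuous_bary P k : continuous (bary P k).
Proof. by have [c0 [c1 [c2 ->]]] := bary_affine2 P k; exact: continuous_affine2. Qed.

Lemma closed_hull3 P : area P != 0 -> closed (hull3 P).
Proof.
move=> P0; rewrite hull3E //.
have -> : [set x | forall k, 0 <= bary P k x] =
    \bigcap_(k in [set: 'I_3]) (bary P k @^-1` [set r | 0 <= r]).
  by apply/seteqP; split => x /= h k => [_|]; exact: h.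
apply: closed_bigI => k _; apply: closed_comp; last exact: closed_ge.
by move=> x _; exact: continuous_bary.
Qed.

Lemma interior_move (A : set (plane R)) x v : interior A x ->
  \forall t \near (0 : R), A (x + t *: v).
Proof.
rewrite /interior /= => Ax.
have c : (fun t : R => x + t *: v) @ (0 : R) --> x + (0 : R) *: v.
  by apply: cvgD; [exact: cvg_cst|exact: scalel_continuous].
rewrite scale0r addr0 in c.
exact: c Ax.
Qed.

Lemma near0_gt0 (A : set R) : (\forall t \near (0 : R), A t) ->
  exists2 e : R, 0 < e & forall t, `|t| <= e -> A t.
Proof.
move=> /nbhs_ballP[e /= e0 h]; exists (e / 2); first by rewrite divr_gt0.
move=> t te; apply: h; rewrite /ball /= sub0r normrN.
by apply: (le_lt_trans te); rewrite ltr_pdivrMr // ltr_pMr // ltr1n.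
Qed.

(** If a barycentric coordinate vanished at an interior point, a small move away from vertex [k]
    would make it negative. Conversely, positivity of three continuous functions is an open
    condition. *)
Lemma interior_hull3 P : area P != 0 ->
  interior (hull3 P) = [set x | forall k, 0 < bary P k x].
Proof.
move=> P0; apply/seteqP; split => x /=.
  move=> xP k; have := interior_subset xP; rewrite hull3E //= => xh.
  rewrite lt_neqAle xh andbT eq_sym; apply/eqP => xk.
  have [e e0 he] := near0_gt0 (interior_move (P k - x) xP).
  have := he (- e); rewrite normrN ger0_norm ?(ltW e0) // lexx => /(_ isT).
  rewrite hull3E // => /(_ k); rewrite bary_affine xk mulr0 add0r bary_vtx // eqxx mulr1.
  by rewrite oppr_ge0 leNgt e0.
move=> xP; rewrite hull3E //; rewrite /interior /=.
have h k : nbhs x [set y | 0 < bary P k y].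
  exact: cvgr_gt (continuous_bary (P := P) (k := k) (x := x)) _ (xP k).
by apply: filterS (filterI (h 0) (filterI (h 1) (h (1 + 1)))) => y [? [? ?]] k;
  case: (ord3_cases k) => ->; apply: ltW.
Qed.

End triangle_geometry.

Section edges_of_a_triangle.
Variable R : realType.
Implicit Types (a b x y z v w : plane R) (P Q : 'I_3 -> plane R) (k j : 'I_3).

Definition is_edge P k a b :=
  (P (k + 1) = a /\ P (k + (1 + 1)) = b) \/ (P (k + 1) = b /\ P (k + (1 + 1)) = a).

Definition open_edge P k : set (plane R) :=
  [set x | [/\ bary P k x = 0, 0 < bary P (k + 1) x & 0 < bary P (k + (1 + 1)) x]].

Lemma is_edgeC P k a b : is_edge P k a b -> is_edge P k b a.
Proof. by case; [right|left]. Qed.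

Lemma ord3_neq k : (((k + 1)%R != k) * ((k + (1 + 1))%R != k) *
  ((k + 1)%R != (k + (1 + 1))%R))%type.
Proof. by split; [split|]; case: (ord3_cases k) => ->. Qed.

Lemma ord3_eqF k : ((((k + 1)%R == k) = false) * ((k == (k + 1)%R) = false) *
  (((k + (1 + 1))%R == k) = false) * ((k == (k + (1 + 1))%R) = false) *
  (((k + 1)%R == (k + (1 + 1))%R) = false) * (((k + (1 + 1))%R == (k + 1)%R) = false))%type.
Proof. by do !split; case: (ord3_cases k) => ->. Qed.

Lemma ord3_casek k j : [\/ j = k, j = k + 1 | j = k + (1 + 1)].
Proof.
have [e|e|e] := ord3_cases (j - k).
- by apply: Or31; apply/eqP; rewrite -subr_eq0 e.
- by apply: Or32; rewrite -e addrC subrK.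
- by apply: Or33; rewrite -e addrC subrK.
Qed.

Lemma sum3k k (V : nmodType) (F : 'I_3 -> V) :
  \sum_j F j = F k + F (k + 1) + F (k + (1 + 1)).
Proof.
case: (ord3_cases k) => ->; rewrite sum3 ?add0r ?ord3_eqs //.
  by rewrite -addrA addrC.
by rewrite addrC addrA.
Qed.

Lemma ord3_pair (i j : 'I_3) : i != j -> exists k,
  (k + 1 = i /\ k + (1 + 1) = j) \/ (k + 1 = j /\ k + (1 + 1) = i).
Proof.
case: (ord3_cases i) => ->; case: (ord3_cases j) => -> //= _;
 [exists (1 + 1)|exists 1|exists (1 + 1)|exists 0|exists 1|exists 0];
 (try by left; split; apply: val_inj); right; split; apply: val_inj => //.
Qed.

Lemma area_bary P k y : area P != 0 ->
  area P * bary P k y = cross (P (k + (1 + 1)) - P (k + 1)) (y - P (k + 1)).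
Proof.
move=> P0; rewrite mulrC /bary divfK // /cross.
case: (P (k + 1)) (P (k + (1 + 1))) y => [? ?] [? ?] [? ?] /=; ring.
Qed.

Lemma crossC_base a b y : cross (a - b) (y - b) = - cross (b - a) (y - a).
Proof. rewrite /cross; case: a b y => [? ?] [? ?] [? ?] /=; ring. Qed.

(** The boolean [s] tells whether [(a, b)] runs against the cyclic order of the vertices; it is the
    source of the orientation signs in Green's formula. *)
Lemma is_edge_sign P k a b : area P != 0 -> is_edge P k a b ->
  exists s : bool, [/\ P (k + 1) = (if s then b else a), P (k + (1 + 1)) = (if s then a else b) &
    forall y, cross (b - a) (y - a) = (-1) ^+ s * (area P * bary P k y)].
Proof.
move=> P0 [[<- <-]|[<- <-]]; [exists false|exists true]; split => // y.
  by rewrite expr0 mul1r area_bary.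
by rewrite expr1 mulN1r area_bary // crossC_base.
Qed.

Lemma is_edge_cross P k a b : area P != 0 -> is_edge P k a b ->
  cross (b - a) (P k - a) != 0.
Proof.
move=> P0 /(is_edge_sign P0)[s [_ _ ->]]; rewrite bary_vtx // eqxx mulr1.
by rewrite mulf_neq0 // signr_eq0.
Qed.

Lemma bary_edge P k a b y : area P != 0 -> is_edge P k a b ->
  bary P k y = cross (b - a) (y - a) / cross (b - a) (P k - a).
Proof.
move=> P0 h; have := is_edge_cross P0 h; have [s [_ _ e]] := is_edge_sign P0 h.
move=> c0; apply: (mulIf c0); rewrite divfK // !e bary_vtx // eqxx mulr1; ring.
Qed.

Lemma hull3_vtx P k : area P != 0 -> hull3 P (P k).
Proof. by move=> P0; rewrite hull3E // => j; rewrite bary_vtx. Qed.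

Lemma hull3_edge P k a b : area P != 0 -> is_edge P k a b -> hull3 P a /\ hull3 P b.
Proof. by move=> P0 [[<- <-]|[<- <-]]; split; exact: hull3_vtx. Qed.

Lemma is_edge_neq P k a b : area P != 0 -> is_edge P k a b -> a != b.
Proof.
move=> P0 /(is_edge_cross P0); apply: contraNneq => ->.
by rewrite subrr /cross !mul0r subrr.
Qed.

Lemma vtx_inj P : area P != 0 -> injective P.
Proof.
move=> P0 i j ij; apply/eqP/negPn/negP => ne.
have := bary_vtx i j P0; rewrite -ij bary_vtx // eqxx eq_sym (negbTE ne) => /eqP.
by rewrite oner_eq0.
Qed.

Lemma is_edge_bary0 P k a b : area P != 0 -> is_edge P k a b ->
  bary P k a = 0 /\ bary P k b = 0.
Proof.
move=> P0 [[<- <-]|[<- <-]]; rewrite !bary_vtx // ?(negbTE (ord3_neq k).1.1);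
by rewrite (negbTE (ord3_neq k).1.2).
Qed.

Lemma is_edge_vtx P k i a b : area P != 0 -> is_edge P k a b ->
  (P i = a \/ P i = b) <-> i != k.
Proof.
move=> P0 h; have [ka kb] := is_edge_bary0 P0 h; split.
  apply: contraPneq => ->.
  by case=> e; [move: ka|move: kb]; rewrite -e bary_vtx // eqxx; apply/eqP/oner_neq0.
case: (ord3_casek k i) => ->; rewrite ?eqxx // => _.
  by case: h => -[<- <-]; [left|right].
by case: h => -[<- <-]; [right|left].
Qed.

Lemma is_edge_uniq P k k' a b : area P != 0 -> is_edge P k a b -> is_edge P k' a b ->
  k = k'.
Proof.
move=> P0 h h'; apply/eqP/negPn/negP.
by move/(is_edge_vtx _ P0 h'); rewrite (is_edge_vtx _ P0 h) eqxx.
Qed.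

Lemma segment_end a b : segment a b a /\ segment a b b.
Proof.
split; first by exists 0; rewrite ?lexx ?ler01 // scale0r addr0.
by exists 1; rewrite ?lexx ?ler01 // scale1r addrCA subrr addr0.
Qed.

Lemma segmentC a b : segment a b = segment b a.
Proof.
suff h (c d : plane R) : segment c d `<=` segment d c by apply/seteqP; split; exact: h.
move=> x [t /= /andP[t0 t1] ->]; exists (1 - t); first by rewrite subr_ge0 t1 gerBl t0.
by case: c d => [? ?] [? ?]; congr (_, _); rewrite /= /GRing.scale /=; ring.
Qed.

Lemma segment_sub P k a b : area P != 0 -> is_edge P k a b ->
  segment a b = [set x | hull3 P x /\ bary P k x = 0].
Proof.
move=> P0; wlog ab : a b / P (k + 1) = a /\ P (k + (1 + 1)) = b.
  move=> h [[h1 h2]|[h1 h2]]; first by apply: h => //; left.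
  by rewrite segmentC; apply: h => //; left.
move=> _; case: ab => <- <-; apply/seteqP; split => x.
  move=> [t /= /andP[t0 t1] ->]; split; last first.
    by rewrite bary_affine !bary_vtx // (negbTE (ord3_neq k).1.1)
     (negbTE (ord3_neq k).1.2) !mulr0 addr0.
  rewrite hull3E // => j; rewrite bary_affine !bary_vtx // addr_ge0 ?mulr_ge0 //.
  by rewrite subr_ge0.
move=> [hx xk]; have := bary_sum x P0; rewrite (sum3k k) xk add0r => x1.
move: hx; rewrite hull3E //= => hx.
exists (bary P (k + (1 + 1)) x); first by rewrite hx /= -x1 lerDr.
have [n1 n2 n3] : [/\ (k == k + 1) = false, (k == k + (1 + 1)) = false
   & (k + (1 + 1) == k + 1) = false].
  by rewrite ![k == _]eq_sym [_ == k + 1]eq_sym !(negbTE (ord3_neq k).1.1)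
   !(negbTE (ord3_neq k).1.2) !(negbTE (ord3_neq k).2).
apply: (bary_inj P0) => j; rewrite bary_affine !bary_vtx //.
case: (ord3_casek k j) => ->; rewrite !(negbTE (ord3_neq k).1.1, negbTE (ord3_neq k).1.2,
  negbTE (ord3_neq k).2, n3, eqxx, xk) !(mulr0, mulr1, addr0, add0r) //.
by rewrite -x1 addrK.
Qed.

(** The endpoints of each segment are written with parameters in the other one. Since 0 and 1 are
    the extreme points of the unit interval, the parameters [u] and [w] must be 0 and 1 in some
    order. *)
Lemma segment_inj a b a' b' : a != b -> segment a b = segment a' b' ->
  (a = a' /\ b = b') \/ (a = b' /\ b = a').
Proof.
move=> ab e; have [ha hb] := segment_end a b; have [ha' hb'] := segment_end a' b'.
rewrite e in ha hb; rewrite -e in ha' hb'.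
case: ha => s /= /andP[s0 s1]; case: hb => t /= /andP[t0 t1].
case: ha' => u /= /andP[u0 u1] ->; case: hb' => w /= /andP[w0 w1] ->.
have -> : a + w *: (b - a) - (a + u *: (b - a)) = (w - u) *: (b - a).
  by rewrite opprD addrACA subrr add0r scalerBl.
rewrite !scalerA -!addrA -!scalerDl => /eqP eb /eqP ea.
have ba : b - a != 0 by rewrite subr_eq0 eq_sym.
have {}ea : u + s * (w - u) = 0.
  apply/eqP; move: ea; rewrite -subr_eq0 opprD addrA subrr sub0r oppr_eq0.
  by rewrite scaler_eq0 (negbTE ba) orbF.
have {}eb : u + t * (w - u) = 1.
  apply/eqP; rewrite -subr_eq0; move: eb.
  rewrite -subr_eq0 opprD addrA -[X in X - _]scale1r -scalerBl.
  by rewrite scaler_eq0 (negbTE ba) orbF -oppr_eq0 opprB.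
have h1 : (1 - s) * u = 0 by nra.
have h2 : s * w = 0 by nra.
have [u0'|u0'] := eqVneq u 0.
  have w1' : w = 1 by nra.
  by left; rewrite u0' w1' scale0r addr0 scale1r addrCA subrr addr0.
have s1' : s = 1.
  by move/eqP: h1; rewrite mulf_eq0 (negbTE u0') orbF subr_eq0 => /eqP.
have w0' : w = 0 by move: h2; rewrite s1' mul1r.
have u1' : u = 1 by nra.
by right; rewrite u1' w0' scale0r addr0 scale1r addrCA subrr addr0.
Qed.

Lemma open_edge_segment P k a b x : area P != 0 -> is_edge P k a b ->
  open_edge P k x -> segment a b x.
Proof.
move=> P0 h [xk x1 x2]; rewrite (segment_sub P0 h) hull3E //; split => // j.
by case: (ord3_casek k j) => ->; rewrite ?xk // ltW.
Qed.

Lemma open_edge_param P k a b t : area P != 0 -> is_edge P k a b ->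
  0 < t < 1 -> open_edge P k (a + t *: (b - a)).
Proof.
move=> P0 h /andP[t0 t1].
have n3 : k + (1 + 1) == k + 1 = false by rewrite eq_sym (negbTE (ord3_neq k).2).
have := is_edge_bary0 P0 h; rewrite /open_edge /= !bary_affine => -[-> ->].
split; first by rewrite !mulr0 addr0.
  by case: h => -[<- <-]; rewrite !bary_vtx // eqxx ?n3 !(mulr0, mulr1, addr0, add0r) // subr_gt0.
case: h => -[<- <-]; rewrite !bary_vtx // eqxx ?(negbTE (ord3_neq k).2);
by rewrite !(mulr0, mulr1, addr0, add0r) // subr_gt0.
Qed.

End edges_of_a_triangle.

(** * Consequences of conformity *)

Section triangulation_geometry.
Variables (R : realType) (Th : triangulation R).
Implicit Types (a b x y z v w : plane R) (T : 'I_(ntri Th)) (k j : 'I_3).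

Lemma vtx_area T : area (vtx T) != 0.
Proof. by have := nondegenerate T; rewrite noncollinear_area. Qed.
Local Hint Resolve vtx_area : core.

(** What the three cases of conformity have in common: the intersection of distinct triangles lies
    on a line. *)
Lemma meet_collinear T T' x y z : T != T' ->
  (tri T `&` tri T') x -> (tri T `&` tri T') y -> (tri T `&` tri T') z ->
  cross (y - x) (z - x) = 0.
Proof.
move=> ne; case: (conforming ne) => [e0|[a [_ _ ea]]|[a [b [_ [_ _ _ _ eab]]]]].
- by rewrite /tri e0.
- rewrite /tri ea /= => -> -> ->; by rewrite !subrr /cross !mul0r subrr.
- rewrite /tri eab => -[s _ ->] [t _ ->] [u _ ->]; rewrite /cross.
  by case: a b {eab} => [? ?] [? ?] /=; rewrite /GRing.scale /=; ring.
Qed.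

Lemma interior_disjoint T T' x : T != T' -> interior (tri T) x ->
  interior (tri T') x -> False.
Proof.
move=> ne xT xT'.
have [e1 e10 h1] := near0_gt0 (filterI (interior_move (1, 0) xT) (interior_move (0, 1) xT)).
have [e2 e20 h2] := near0_gt0 (filterI (interior_move (1, 0) xT') (interior_move (0, 1) xT')).
pose e := Num.min e1 e2; have e0 : 0 < e by rewrite lt_min e10.
have [|y1 z1] := h1 e; first by rewrite gtr0_norm // ge_min lexx.
have [|y2 z2] := h2 e; first by rewrite gtr0_norm // ge_min lexx orbT.
have := meet_collinear ne (conj (interior_subset xT) (interior_subset xT'))
  (conj y1 y2) (conj z1 z2).
have ad v : x + v - x = v by rewrite addrAC subrr add0r.
rewrite !ad /cross /= /GRing.scale /= !mulr0 !mulr1 subr0.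
by move/eqP; rewrite mulf_eq0 orbb (gt_eqF e0).
Qed.

Lemma divr_gt0_mul (s t : R) : t != 0 -> (0 < s / t) = (0 < s * t).
Proof.
move=> t0; have t2 : 0 < t ^+ 2 by rewrite exprn_even_gt0.
by rewrite -(pmulr_lgt0 (s / t) t2) expr2 mulrA divfK.
Qed.

(** Were both third vertices on the same side, a point slightly off the midpoint [m] of the edge
    towards [c] would belong to both triangles, as do [a] and [b], against the collinearity of
    common points. *)
Lemma opposite_sides T T' k k' a b : T != T' ->
  is_edge (vtx T) k a b -> is_edge (vtx T') k' a b ->
  cross (b - a) (vtx T k - a) * cross (b - a) (vtx T' k' - a) < 0.
Proof.
move=> ne h h'; set c := vtx T k; set c' := vtx T' k'.
have cn0 : cross (b - a) (c - a) != 0 by exact: is_edge_cross h.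
have cn0' : cross (b - a) (c' - a) != 0 by exact: is_edge_cross h'.
rewrite lt_neqAle mulf_neq0 //= leNgt; apply/negP => cc.
have bc : 0 < bary (vtx T') k' c.
  by rewrite (bary_edge _ _ h') // divr_gt0_mul.
pose m := a + 2^-1 *: (b - a).
have [e1 e10 h1] : exists2 e : R, 0 < e & forall t, `|t| <= e ->
    forall j, j != k' -> 0 < bary (vtx T') j (m + t *: (c - m)).
  have hm : forall j, j != k' -> 0 < bary (vtx T') j m.
    have [_ m1 m2] : open_edge (vtx T') k' m.
      by apply: (open_edge_param _ h') => //; rewrite invr_gt0 ltr0n invf_lt1 ?ltr1n.
    by move=> j; case: (ord3_casek k' j) => -> //; rewrite eqxx.
  apply: (near0_gt0 (A := fun t => forall j, j != k' -> 0 < bary (vtx T') j (m + t *: (c - m)))).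
  apply: (@filter_forall _ _ (fun (j : 'I_3) t => j != k' ->
    0 < bary (vtx T') j (m + t *: (c - m))) (nbhs (0 : R)) _) => j.
  have [jk|jk] := eqVneq j k'; first by near=> t.
  suff : \forall t \near (0 : R), 0 < bary (vtx T') j (m + t *: (c - m)).
    by apply: filterS => t ? _.
  have : interior [set y | 0 < bary (vtx T') j y] m.
    exact: cvgr_gt (continuous_bary (P := vtx T') (k := j) (x := m)) _ (hm j jk).
  by move=> im; exact: (interior_move (c - m) im).
pose e := Num.min e1 1; have e0 : 0 < e by rewrite lt_min e10 ltr01.
have e1' : e <= 1 by rewrite ge_min lexx orbT.
have [aT bT] := hull3_edge (vtx_area T) h.
have [aT' bT'] := hull3_edge (vtx_area T') h'.
pose y := m + e *: (c - m).
have yT : tri T y.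
  rewrite /tri hull3E // => j; rewrite bary_affine addr_ge0 // mulr_ge0 ?subr_ge0 ?(ltW e0) //.
    have : hull3 (vtx T) m.
      have : segment a b m by exists 2^-1 => //; rewrite invr_ge0 ler0n invf_le1 ?ler1n.
      by rewrite (segment_sub _ h) // => -[].
    by rewrite hull3E.
  by rewrite bary_vtx.
have yT' : tri T' y.
  rewrite /tri hull3E // => j; have [->|jk] := eqVneq j k'.
    rewrite bary_affine addr_ge0 // mulr_ge0 ?subr_ge0 ?(ltW e0) ?(ltW bc) //.
    have : segment a b m by exists 2^-1 => //; rewrite invr_ge0 ler0n invf_le1 ?ler1n.
    by rewrite (segment_sub _ h') // => -[_ ->].
  by apply/ltW/h1 => //; rewrite gtr0_norm // ge_min lexx.
have := meet_collinear ne (conj aT aT') (conj bT bT') (conj yT yT').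
have -> : cross (b - a) (y - a) = e * cross (b - a) (c - a).
  rewrite /y /m /cross; case: (a) (b) (c) => [? ?] [? ?] [? ?] /=.
  by rewrite /GRing.scale /=; field.
by move/eqP; rewrite mulf_eq0 (negbTE cn0) (gt_eqF e0).
Unshelve. all: by end_near.
Qed.

Lemma no_three_signs (p1 p2 p3 : R) : p3 * p2 < 0 -> p3 * p1 < 0 -> p1 * p2 < 0 -> False.
Proof. by nra. Qed.

(** Three third vertices cannot lie pairwise on opposite sides of one line. *)
Lemma two_sides T1 T2 T3 k1 k2 k3 a b :
  is_edge (vtx T1) k1 a b -> is_edge (vtx T2) k2 a b -> is_edge (vtx T3) k3 a b ->
  T1 != T2 -> T3 = T1 \/ T3 = T2.
Proof.
move=> h1 h2 h3 n12.
have [->|n13] := eqVneq T3 T1; first by left.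
have [->|n23] := eqVneq T3 T2; first by right.
by case: (no_three_signs (opposite_sides n23 h3 h2) (opposite_sides n13 h3 h1)
  (opposite_sides n12 h1 h2)).
Qed.

Lemma share_edgeP (P Q : 'I_3 -> plane R) a b : share_edge P Q a b ->
  (exists k, is_edge P k a b) /\ (exists k, is_edge Q k a b).
Proof.
move=> [ab [[i ia] [j jb] [i' ia'] [j' jb'] _]]; split.
  have ij : i != j by apply: contraNneq ab => e; rewrite -ia -jb e.
  have [k [] [ki kj]] := ord3_pair ij; exists k; [left|right]; by rewrite ki kj.
have ij : i' != j' by apply: contraNneq ab => e; rewrite -ia' -jb' e.
have [k [] [ki kj]] := ord3_pair ij; exists k; [left|right]; by rewrite ki kj.
Qed.

(** Two common points rule out the first two cases of conformity. In the third, the shared edge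
    contains [a] and [b], and among the edges of [T] only edge [k] does. *)
Lemma share_edge_intro T T' k k' a b : T != T' ->
  is_edge (vtx T) k a b -> is_edge (vtx T') k' a b -> share_edge (vtx T) (vtx T') a b.
Proof.
move=> ne h h'; have ab := is_edge_neq (vtx_area T) h.
have [aT bT] := hull3_edge (vtx_area T) h.
have [aT' bT'] := hull3_edge (vtx_area T') h'.
case: (conforming ne) => [e0|[c [_ _ ec]]|[a' [b' s]]].
- by have : set0 a by rewrite -e0.
- have : [set c] a by rewrite -ec.
  have : [set c] b by rewrite -ec.
  by move=> /= bc ac; rewrite bc ac eqxx in ab.
have [[j hj] _] := share_edgeP s.
have [ab' [pa pb qa qb eI]] := s.
have [_ aj] : [set x | hull3 (vtx T) x /\ bary (vtx T) j x = 0] a.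
  by rewrite -(segment_sub _ hj) // -eI.
have [_ bj] : [set x | hull3 (vtx T) x /\ bary (vtx T) j x = 0] b.
  by rewrite -(segment_sub _ hj) // -eI.
have jk : j = k.
  apply/eqP/negPn/negP => /(is_edge_vtx j (vtx_area T) h) [] e.
    by move: aj; rewrite -e bary_vtx // eqxx; apply/eqP/oner_neq0.
  by move: bj; rewrite -e bary_vtx // eqxx; apply/eqP/oner_neq0.
rewrite jk in hj.
have [[-> ->] //|[-> ->]] : (a = a' /\ b = b') \/ (a = b' /\ b = a').
  by case: h hj => -[<- <-] [] [<- <-]; [left|right|right|left].
split; first by rewrite eq_sym.
by split => //; rewrite eI segmentC.
Qed.

(* Triangles are closed and finitely many. *)
Lemma near_tri_subset x : \forall y \near x, forall T, tri T y -> tri T x.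
Proof.
apply: (@filter_forall _ _ (fun T y => tri T y -> tri T x) (nbhs x) _) => T.
have [xT|xT] := pselect (tri T x); first by near=> y.
have : open (~` tri T) by apply: closed_openC; exact: closed_hull3.
rewrite openE => /(_ x xT); rewrite /interior /=.
by apply: filterS => y yT /yT.
Unshelve. all: by end_near.
Qed.

Lemma interior_Omega T : interior (tri T) `<=` Omega Th.
Proof. by apply: interiorS => x xT; exists T. Qed.

Lemma open_edge_tri T k x : open_edge (vtx T) k x -> tri T x.
Proof.
move=> xk; have h : is_edge (vtx T) k (vtx T (k + 1)) (vtx T (k + (1 + 1))) by left.
by have := open_edge_segment (vtx_area T) h xk; rewrite (segment_sub _ h) // => -[].
Qed.

(** A point of an open edge is not a vertex, so the triangles share a whole edge; among the edges of
    [T] only edge [k] contains the point. *)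
Lemma open_edge_meet T T' k x : T != T' -> open_edge (vtx T) k x -> tri T' x ->
  exists k', is_edge (vtx T') k' (vtx T (k + 1)) (vtx T (k + (1 + 1))).
Proof.
move=> ne xk xT'; have xT := open_edge_tri xk.
case: (xk) => xk0 xk1 xk2.
case: (conforming ne) => [e0|[c [[i ic] _ ec]]|[a [b s]]].
- by have : set0 x by rewrite -e0.
- have : [set c] x by rewrite -ec.
  move=> /= xc; exfalso; move: xk1 xk2; rewrite xc -ic !bary_vtx //.
  by case: (ord3_casek k i) => ->; rewrite ?eqxx ?ord3_eqF ltxx.
have [[j hj] [j' hj']] := share_edgeP s; exists j'.
have [ab' [pa pb qa qb eI]] := s.
have [_ xj] : [set y | hull3 (vtx T) y /\ bary (vtx T) j y = 0] x.
  by rewrite -(segment_sub _ hj) // -eI.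
have jk : j = k.
  case: (ord3_casek k j) => // e; exfalso; move: xk1 xk2; rewrite -e xj ltxx //.
rewrite jk in hj.
by case: hj => -[<- <-] in hj' *; [|exact: is_edgeC].
Qed.

(** If [T] were the only triangle through [x], some neighbourhood of [x] would lie in [T], and [x]
    would be interior to [T] although one of its barycentric coordinates is zero. *)
Lemma open_edge_shared T k x : open_edge (vtx T) k x -> Omega Th x ->
  exists T' k', T != T' /\
    is_edge (vtx T') k' (vtx T (k + 1)) (vtx T (k + (1 + 1))).
Proof.
move=> xk xO; have h : is_edge (vtx T) k (vtx T (k + 1)) (vtx T (k + (1 + 1))) by left.
have [T' [ne xT']] : exists T', T != T' /\ tri T' x.
  apply: contrapT => hn.
  have : interior (tri T) x.
    rewrite /interior /=; move: xO; rewrite /Omega /interior /= => xO.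
    apply: filterS (filterI xO (near_tri_subset x)) => y [[T' _ yT'] hy].
    have [->//|ne] := eqVneq T T'.
    by exfalso; apply: hn; exists T'; split => //; exact: hy.
  rewrite /tri interior_hull3 // => /(_ k); case: xk => -> _ _.
  by rewrite ltxx.
by have [k' hk'] := open_edge_meet ne xk xT'; exists T', k'.
Qed.

(** Near [x] the coordinates that are positive at [x] remain so in both triangles, and the two that
    vanish on the edge have opposite signs, the third vertices being on opposite sides. Hence every
    nearby point lies in one of the triangles. *)
Lemma open_edge_interior T T' k k' a b x : T != T' ->
  is_edge (vtx T) k a b -> is_edge (vtx T') k' a b -> open_edge (vtx T) k x ->
  interior (tri T `|` tri T') x.
Proof.
move=> ne h h' xk; have := opposite_sides ne h h' => opp.
have [t t01 xt] : exists2 t, 0 < t < 1 & x = a + t *: (b - a).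
  have [t /= /andP[t0 t1] xt] := open_edge_segment (vtx_area T) h xk.
  have [_ x1 x2] := xk.
  have tn0 : t != 0.
    apply/eqP => t0'; move: xt; rewrite t0' scale0r addr0 => xa.
    by move: x1 x2; rewrite xa; case: h => -[e1 e2]; rewrite -?e1 -?e2 !bary_vtx //
      ?ord3_eqF ltxx.
  have tn1 : t != 1.
    apply/eqP => t1'; move: xt; rewrite t1' scale1r addrCA subrr addr0 => xa.
    by move: x1 x2; rewrite xa; case: h => -[e1 e2]; rewrite -?e1 -?e2 !bary_vtx //
      ?ord3_eqF ltxx.
  by exists t => //; rewrite !lt_neqAle eq_sym tn0 tn1 t0.
have xk' : open_edge (vtx T') k' x by rewrite xt; exact: open_edge_param h' _.
have cb (T0 : 'I_(ntri Th)) j : 0 < bary (vtx T0) j x -> \forall y \near x, 0 < bary (vtx T0) j y.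
  by move=> xj; exact: cvgr_gt (continuous_bary (P := vtx T0) (k := j) (x := x)) _ xj.
have [_ /cb p1 /cb p2] := xk; have [_ /cb q1 /cb q2] := xk'.
rewrite /interior /=; near=> y.
have [yk|yk] := leP 0 (bary (vtx T) k y).
  left; rewrite /tri hull3E // => j; case: (ord3_casek k j) => -> //; apply: ltW;
  by near: y.
right; rewrite /tri hull3E // => j; case: (ord3_casek k' j) => ->; apply: ltW;
  last 2 first; try by near: y.
move: yk; rewrite !(bary_edge _ _ h) // !(bary_edge _ _ h') //.
move: opp; set c := cross _ _; set c' := cross _ _; set z := cross _ _ => cc.
have cn0 : c != 0 by exact: is_edge_cross h.
have cn0' : c' != 0 by exact: is_edge_cross h'.
have cc' : c / c' < 0 by rewrite -oppr_gt0 -mulNr divr_gt0_mul // mulNr oppr_gt0.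
move=> zc; have -> : z / c' = (z / c) * (c / c').
  by rewrite mulrA divfK.
by rewrite nmulr_rgt0.
Unshelve. all: by end_near.
Qed.

End triangulation_geometry.

(** * Interior edges and their two sides *)

Section interior_edges_geometry.
Variables (R : realType) (Th : triangulation R) (E : interior_edges Th).
Implicit Types (a b x y z v w : plane R) (T : 'I_(ntri Th)) (k j : 'I_3).
Implicit Type e : 'I_(nedge E).

(** The pairs [(e, s)] enumerate the incidences of triangles with interior edges, which treats both
    sides of an edge uniformly. *)
Definition eT e (s : bool) : 'I_(ntri Th) := if s then Tplus e else Tminus e.

Lemma eT_edge e s : exists k, is_edge (vtx (eT e s)) k (ea e) (eb e).
Proof. by have [h1 h2] := share_edgeP (edge_shared e); case: s. Qed.

Definition ek e s : 'I_3 := sval (cid (eT_edge e s)).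

Lemma ekP e s : is_edge (vtx (eT e s)) (ek e s) (ea e) (eb e).
Proof. exact: (svalP (cid (eT_edge e s))). Qed.

Lemma eTN e s : eT e s != eT e (~~ s).
Proof. by case: s; rewrite /= ?[Tminus e == _]eq_sym edge_neq. Qed.

Lemma edge_neq_ab e : ea e != eb e.
Proof. by have [] := edge_shared e. Qed.

Lemma edge_enum T T' k k' a b : T != T' ->
  is_edge (vtx T) k a b -> is_edge (vtx T') k' a b ->
  exists e s, T = eT e s /\ k = ek e s.
Proof.
move=> ne h h'; have sh := share_edge_intro ne h h'.
have [e es] := edge_all E ne sh.
have {}h : is_edge (vtx T) k (ea e) (eb e).
  case: (segment_inj (edge_neq_ab e) es) => -[-> ->] //.
  exact: is_edgeC.
exists e.
have [eT1|eT1] := two_sides (ekP e true) (ekP e false) h (edge_neq e);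
 [exists true|exists false]; split => //.
- by apply: (is_edge_uniq (vtx_area T) h); rewrite {1}eT1; exact: ekP.
- by apply: (is_edge_uniq (vtx_area T) h); rewrite {1}eT1; exact: ekP.
Qed.

Lemma edge_onto T k x : open_edge (vtx T) k x -> Omega Th x ->
  exists e s, T = eT e s /\ k = ek e s.
Proof.
move=> xk xO; have [T' [k' [ne h]]] := open_edge_shared xk xO.
by apply: (edge_enum ne _ h); left.
Qed.

Lemma same_edge e e' T k : is_edge (vtx T) k (ea e) (eb e) ->
  is_edge (vtx T) k (ea e') (eb e') -> e = e'.
Proof.
move=> h h'; apply: edge_inj.
by rewrite (segment_sub (vtx_area T) h) (segment_sub (vtx_area T) h').
Qed.

(** Allows sums over all edges of all triangles to be regrouped by interior edges. Two interior
    edges with a common incidence are the same segment, and the two sides of an edge are distinct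
    triangles. *)
Lemma edge_pair_inj : injective (fun es : 'I_(nedge E) * bool =>
  (eT es.1 es.2, ek es.1 es.2)).
Proof.
move=> [e s] [e' s'] /= [eT0 ek0].
have ee : e = e'.
  by apply: (same_edge (ekP e s)); rewrite eT0 ek0; exact: ekP.
rewrite -ee in eT0 *; congr (_, _); apply/eqP/negPn/negP => ss.
have e1 : s' = ~~ s by case: s s' ss {eT0 ek0} => -[].
by have := eTN e s; rewrite -e1 eT0 eqxx.
Qed.

Definition epoint e (t : R) : plane R := ea e + t *: (eb e - ea e).

Lemma epoint_open e s t : 0 < t < 1 -> open_edge (vtx (eT e s)) (ek e s) (epoint e t).
Proof. exact: open_edge_param (vtx_area _) (ekP e s). Qed.

Lemma epoint_interior e t : 0 < t < 1 ->
  interior (tri (Tplus e) `|` tri (Tminus e)) (epoint e t).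
Proof.
move=> t01; apply: (open_edge_interior (edge_neq e) (ekP e true) (ekP e false)).
exact: epoint_open e true t t01.
Qed.

Lemma epoint_Omega e t : 0 < t < 1 -> Omega Th (epoint e t).
Proof.
move=> t01.
have sub : tri (Tplus e) `|` tri (Tminus e) `<=` \bigcup_(T in [set: 'I_(ntri Th)]) tri T.
  by move=> y [] yT; [exists (Tplus e)|exists (Tminus e)].
have sub' : interior (tri (Tplus e) `|` tri (Tminus e)) `<=` Omega Th by apply: interiorS.
exact/sub'/epoint_interior.
Qed.

(** A triangle of [e'] containing the point must be one of the two triangles of [e], and there the
    point has a single vanishing barycentric coordinate, the one of [e]. *)
Lemma epoint_other e e' t : 0 < t < 1 -> e' != e ->
  ~ segment (ea e') (eb e') (epoint e t).
Proof.
move=> t01 ne xe'; set x := epoint e t in xe'.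
have := xe'; rewrite (segment_sub (vtx_area _) (ekP e' true)) => -[xT xk].
have [s es] : exists s, eT e' true = eT e s.
  have [e1|e1] := eqVneq (eT e true) (eT e' true); first by exists true.
  have [k' hk'] := open_edge_meet e1 (epoint_open e true t01) xT.
  have hk : is_edge (vtx (eT e' true)) k' (ea e) (eb e).
    by case: (ekP e true) hk' => -[-> ->] // /is_edgeC.
  have [|] := two_sides (ekP e true) (ekP e false) hk (edge_neq e) => e2.
    by exists true.
  by exists false.
rewrite es in xk; have [x0 x1 x2] := epoint_open e s t01.
have kk : ek e' true = ek e s.
  case: (ord3_casek (ek e s) (ek e' true)) => // e2; exfalso.
    by move: x1; rewrite -e2 xk ltxx.
  by move: x2; rewrite -e2 xk ltxx.
move/eqP: ne; apply; apply: (same_edge (ekP e' true)).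
by rewrite es kk; exact: ekP.
Qed.

End interior_edges_geometry.

(** * Integration in the plane *)

HB.instance Definition _ (R : realType) := Measure.on (@mu2 R).

(* The plane with its product sigma-algebra fixed, for measurability statements. *)
Notation mplane R := (measurableTypeR R * measurableTypeR R)%type (only parsing).
Notation meas A := (@measurable _ (measurableTypeR _ * measurableTypeR _)%type A) (only parsing).

Section plane_measure.
Variable R : realType.
Implicit Types (A B : set (plane R)) (a b x y v w p : plane R).
Local Notation leb := (@lebesgue_measure R).

(** The sigma-algebra of the plane is the product one, so an open set has to be written as a
    countable union of rectangles, here with rational endpoints. *)
Lemma open_measurable2 A : open A -> meas A.
Proof.
move=> oA; suff : measurable A by [].
pose box (q : rat * rat * (rat * rat)) : set (plane R) :=
  `](ratr q.1.1 : R), ratr q.1.2[ `*` `](ratr q.2.1 : R), ratr q.2.2[.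
have -> : A = \bigcup_q (if `[< box q `<=` A >] then box q else set0).
  apply/seteqP; split => x; last first.
    by move=> [q _]; case: asboolP => [h|_] => [/h|[]].
  move=> Ax; have := oA; rewrite openE => /(_ x Ax); rewrite /interior /=.
  move=> /nbhs_ballP[e /= e0 he].
  have [q1 hq1] := @rat_in_itvoo R (x.1 - e) x.1 (ltac:(by rewrite ltrBlDr ltrDl)).
  have [q2 hq2] := @rat_in_itvoo R x.1 (x.1 + e) (ltac:(by rewrite ltrDl)).
  have [q3 hq3] := @rat_in_itvoo R (x.2 - e) x.2 (ltac:(by rewrite ltrBlDr ltrDl)).
  have [q4 hq4] := @rat_in_itvoo R x.2 (x.2 + e) (ltac:(by rewrite ltrDl)).
  move: hq1 hq2 hq3 hq4; rewrite !in_itv /=.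
  move=> /andP[a1 a2] /andP[b1 b2] /andP[c1 c2] /andP[d1 d2].
  have bq : box ((q1, q2), (q3, q4)) `<=` A.
    move=> y [/=]; rewrite !in_itv /= => /andP[y1 y2] /andP[y3 y4]; apply: he.
    by split; rewrite /ball /=; rewrite ltr_norml; apply/andP; split; lra.
  exists ((q1, q2), (q3, q4)) => //; case: asboolP => // _.
  by split => /=; rewrite in_itv /=; apply/andP.
apply: countable_bigcupT_measurable => // q; case: ifP => _ //.
by apply: measurableX; exact: measurable_itv.
Qed.

Lemma closed_measurable2 A : closed A -> meas A.
Proof.
move=> cA; have := measurableC (open_measurable2 (closed_openC cA)).
by rewrite setCK.
Qed.

Lemma continuous_measurable2 (f : plane R -> R) : continuous f ->
  measurable_fun setT (f : mplane R -> R).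
Proof.
move=> cf; suff : measurable_fun setT f by [].
 apply: (measurability _ (RGenOpens.measurableE R)).
move=> _ [_ [a [b ->] <-]]; rewrite setTI; apply: open_measurable2.
by apply: open_comp => // ? _; exact: cf.
Qed.

(** Uniqueness of Lebesgue measure: the pushforward scaled by [|a|] agrees with it on half-open
    intervals. For negative [a] the preimage is half-open at the other end, with the same length. *)
Lemma lebesgue_affine (a b : R) (A : set R) : a != 0 -> measurable A ->
  (`|a|%:E * leb ((fun x : R => a * x + b)%R @^-1` A))%E = leb A.
Proof.
move=> a0 mA.
have mf : @measurable_fun _ _ (measurableTypeR R) (measurableTypeR R) setT
    (fun x : R => a * x + b).
  apply: continuous_measurable_fun => x; apply: cvgD; last exact: cvg_cst.
  by apply: cvgM; [exact: cvg_cst|exact: cvg_id].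
pose pm : {measure set (measurableTypeR R) -> \bar R} :=
  measure_function_pushforward__canonical__measure_function_Measure leb mf.
pose m : {measure set (measurableTypeR R) -> \bar R} := mscale (NngNum (normr_ge0 a)) pm.
suff h : forall X, ocitv X -> leb X = m X by rewrite (lebesgue_measure_unique h mA).
move=> _ [[c d] _ <-] /=.
rewrite /m /mscale /= /pushforward.
have [cd|dc] := ltP c d; last first.
  by rewrite set_itv_ge ?preimage_set0 ?measure0 ?mule0 // -leNgt bnd_simp.
have [ap|an|a0'] := ltgtP 0 a; last by rewrite -a0' eqxx in a0.
  have -> : (fun x : R => a * x + b) @^-1` `]c, d] = `](c - b) / a, (d - b) / a]%classic.
    apply/seteqP; split => x /=; rewrite !in_itv /= ltr_pdivrMr // ler_pdivlMr //
      ltrBlDr lerBrDr mulrC //.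
  rewrite !lebesgue_measure_itv /= !lte_fin cd ltr_pM2r ?invr_gt0 // ltrD2r cd.
  by rewrite -!EFinD -EFinM gtr0_norm //; congr EFin; field.
have -> : (fun x : R => a * x + b) @^-1` `]c, d] = `[(d - b) / a, (c - b) / a[%classic.
  apply/seteqP; split => x /=; rewrite !in_itv /= ler_ndivrMr // ltr_ndivlMr //
      ltrBlDr lerBrDr mulrC andbC //.
rewrite !lebesgue_measure_itv /= !lte_fin cd ltr_nM2r ?invr_lt0 // ltrD2r cd.
by rewrite -!EFinD -EFinM ltr0_norm //; congr EFin; field; rewrite lt_eqF.
Qed.

(** Cavalieri's principle: on every vertical line the map is affine with the same slope [c]. *)
Lemma mu2_fiber (c : R) (h : R -> R) A : c != 0 -> measurable_fun setT h -> meas A ->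
  (`|c|%:E * @mu2 R ((fun x : plane R => (x.1, c * x.2 + h x.1)%R) @^-1` A))%E = @mu2 R A.
Proof.
move=> c0 mh mA; have mB : meas ((fun x : plane R => (x.1, c * x.2 + h x.1)) @^-1` A).
  rewrite -[X in measurable X]setTI; apply: measurable_fun_pair => //.
  apply: measurable_funD; last exact: measurableT_comp mh measurable_fst.
  by apply: measurable_funM => //; exact: measurable_snd.
rewrite /mu2 /product_measure1 -ge0_integralZl//=; last first.
  exact: measurable_fun_xsection.
apply: eq_integral => x _ /=.
rewrite -(@lebesgue_affine c (h x) (xsection A x)) //; last exact: measurable_xsection.
Qed.

(** The two iterated product measures agree on rectangles, hence everywhere. *)
Lemma mu2_swap A : meas A ->
  @mu2 R ((fun x : plane R => (x.2, x.1)) @^-1` A) = @mu2 R A.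
Proof.
move=> mA; have e : (leb \x leb)%E A = (leb \x^ leb)%E A.
  by apply: product_measure_unique => //= B C mB mC; rewrite product_measure2E.
rewrite {2}/mu2 e /mu2 /product_measure1 /product_measure2.
by apply: eq_integral => x _ /=; rewrite xsectionE ysectionE.
Qed.

End plane_measure.

Section affine_change_of_variables.
Variable R : realType.
Implicit Types (A B D : set (plane R)) (a b x y v w p : plane R).
Local Notation leb := (@lebesgue_measure R).

Definition affmap p v w (x : plane R) : plane R := p + x.1 *: v + x.2 *: w.

Lemma continuous_affmap p v w : continuous (affmap p v w).
Proof.
move=> x; apply: cvgD; first apply: cvgD; first exact: cvg_cst.
  by apply: cvgZ; [exact: cvg_fst|exact: cvg_cst].
by apply: cvgZ; [exact: cvg_snd|exact: cvg_cst].
Qed.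

Lemma measurable_preimage_cont (f : plane R -> plane R) A :
  continuous f -> meas A -> meas (f @^-1` A).
Proof.
move=> cf mA; rewrite -[X in measurable X]setTI.
have -> : f = fun x => ((f x).1, (f x).2) by apply/funext => x; case: (f x).
apply: measurable_fun_pair => //; apply: continuous_measurable2 => x.
  by apply: continuous_comp; [exact: cf|exact: cvg_fst].
by apply: continuous_comp; [exact: cf|exact: cvg_snd].
Qed.

Lemma measurable_affine1 (c d : R) : measurable_fun setT (fun x : R => c + d * x).
Proof.
by apply: measurable_funD => //; apply: measurable_funM.
Qed.

Lemma continuous_swap : continuous (fun x : plane R => (x.2, x.1) : plane R).
Proof.
by move=> x; exact: (@cvg_pair _ _ _ (nbhs x) (nbhs x.2) (nbhs x.1) _ _ _
  (fun x => x.2) (fun x => x.1) cvg_snd cvg_fst).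
Qed.

(** When [v.1] is nonzero, the map factors into two maps that are affine on vertical lines,
    interleaved with exchanges of coordinates; their slopes [v.1] and [c] multiply to the
    determinant. When [v.1] is zero, [w.1] is not, and the axes are exchanged. *)
Lemma mu2_affine p v w A : cross v w != 0 -> meas A ->
  (`|cross v w|%:E * @mu2 R (affmap p v w @^-1` A))%E = @mu2 R A.
Proof.
wlog v1 : v w A / v.1 != 0.
  move=> h d0 mA; have [v10|v1] := eqVneq v.1 0; last exact: h.
  have w1 : w.1 != 0.
    by apply: contraNneq d0 => w10; rewrite /cross v10 w10 mul0r mulr0 subrr.
  rewrite -(mu2_swap (A := affmap p v w @^-1` A)); last first.
    by apply: measurable_preimage_cont => //; exact: continuous_affmap.
  have -> : (fun x : plane R => (x.2, x.1)) @^-1` (affmap p v w @^-1` A) =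
      affmap p w v @^-1` A.
    by apply/funext => x; rewrite /preimage /affmap /= addrAC.
  have dE : cross v w = - cross w v by rewrite /cross; ring.
  by rewrite dE normrN h // -oppr_eq0 -dE.
move=> d0 mA; pose c := cross v w / v.1.
have c0 : c != 0 by rewrite mulf_neq0 ?invr_eq0.
pose h (z : R) := (p.2 - v.2 / v.1 * p.1) + v.2 / v.1 * z.
pose g (z : R) := p.1 + w.1 * z.
pose G (x : plane R) : plane R := (x.1, c * x.2 + h x.1).
pose F (x : plane R) : plane R := (x.1, v.1 * x.2 + g x.1).
pose sw (x : plane R) : plane R := (x.2, x.1).
have -> : affmap p v w @^-1` A = sw @^-1` (F @^-1` (sw @^-1` (G @^-1` A))).
  apply/funext => x; rewrite /preimage; congr A.
  rewrite /affmap /sw /F /G /h /g /c /cross /=.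
  by case: p v w x v1 {d0 c0 c h g F G} => [? ?] [? ?] [? ?] [? ?] /= v1;
    congr (_, _); rewrite /= /GRing.scale /=; field.
have cG : continuous G.
  have -> : G = affmap (0, p.2 - v.2 / v.1 * p.1) (1, v.2 / v.1) (0, c).
    by apply/funext => -[? ?]; rewrite /G /h /affmap; congr (_, _);
     rewrite /= /GRing.scale /=; ring.
  exact: continuous_affmap.
have cF : continuous F.
  have -> : F = affmap (0, p.1) (1, w.1) (0, v.1).
    by apply/funext => -[? ?]; rewrite /F /g /affmap; congr (_, _);
     rewrite /= /GRing.scale /=; ring.
  exact: continuous_affmap.
have mh : measurable_fun setT h by exact: measurable_affine1.
have mg : measurable_fun setT g by exact: measurable_affine1.
have mG := measurable_preimage_cont cG mA.
have mS := measurable_preimage_cont continuous_swap mG.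
have mF := measurable_preimage_cont cF mS.
rewrite mu2_swap // -(mu2_fiber c0 mh mA).
rewrite -(mu2_swap mG) -(mu2_fiber v1 mg mS).
by rewrite muleA -EFinM -normrM /c divfK.
Qed.

Lemma ge0_integral_affine p v w (D : set (mplane R)) (f : mplane R -> \bar R) : cross v w != 0 ->
  meas D -> measurable_fun D f -> (forall x, D x -> (0 <= f x)%E) ->
  (\int[@mu2 R]_(x in D) f x =
   `|cross v w|%:E * \int[@mu2 R]_(x in affmap p v w @^-1` D) f (affmap p v w x))%E.
Proof.
move=> d0 mD mf f0.
have mphi : @measurable_fun _ _ (mplane R) (mplane R) setT (affmap p v w).
  by move=> _ B mB; rewrite setTI; apply: measurable_preimage_cont => //; exact: continuous_affmap.
pose pm : {measure set (mplane R) -> \bar R} :=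
  measure_function_pushforward__canonical__measure_function_Measure (@mu2 R) mphi.
pose m : {measure set (mplane R) -> \bar R} := mscale (NngNum (normr_ge0 (cross v w))) pm.
rewrite (@eq_measure_integral _ _ _ _ m); last first.
  by move=> A mA _; rewrite /= /mscale /= /pushforward mu2_affine.
rewrite (@ge0_integral_mscale _ (mplane R) R pm D mD (NngNum (normr_ge0 (cross v w))) f mf f0).
have f0' : {in D, forall x, (0 <= f x)%E} by move=> x; rewrite inE; exact: f0.
have e := @ge0_integral_pushforward _ _ (mplane R) (mplane R) R _ mphi (@mu2 R) D f mD mf f0'.
exact: (congr1 (fun z => (`|cross v w|%:E * z)%E) e).
Qed.

Definition box (M : R) : set (plane R) := `[- M, M]%classic `*` `[- M, M]%classic.

Lemma boxP M x : box M x <-> `|x.1| <= M /\ `|x.2| <= M.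
Proof. by rewrite /box /= !in_itv /= !ler_norml; split => -[]. Qed.

Lemma compact_box M : compact (box M).
Proof. by apply: compact_setX; exact: segment_compact. Qed.

Lemma mu2_box M : (@mu2 R (box M) < +oo)%E.
Proof.
have -> : @mu2 R (box M) = (leb `[(- M)%R, M]%classic * leb `[(- M)%R, M]%classic)%E.
  by rewrite /mu2 /box product_measure1E //; exact: measurable_itv.
by rewrite !lebesgue_measure_itv /=; case: ifP => _; rewrite -?EFinD -?EFinM ?mule0 ?ltry.
Qed.

Definition bounded2 A := exists M, A `<=` box M.

Lemma mu2_bounded A : meas A -> bounded2 A -> (@mu2 R A < +oo)%E.
Proof.
move=> mA [M AM]; apply: (le_lt_trans _ (mu2_box M)); apply: le_measure => //; rewrite inE //.
by apply: measurableX; exact: measurable_itv.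
Qed.

Lemma continuous_bound (f : plane R -> R) A : continuous f -> bounded2 A ->
  exists2 C, 0 <= C & forall x, A x -> `|f x| <= C.
Proof.
move=> cf [M AM].
have : compact (f @` box M).
  apply: continuous_compact; last exact: compact_box.
  by apply: continuous_subspaceT => x; exact: cf.
move/compact_bounded => [C [_ hC]]; exists (`|C| + 1); first by rewrite addr_ge0.
by move=> x Ax; apply: hC; [rewrite ltr_pwDr // ler_norm|exists x => //; exact: AM].
Qed.

Lemma integrable_bounded (f : plane R -> R) A : meas A -> bounded2 A ->
  measurable_fun A (f : mplane R -> R) -> (exists C, forall x, A x -> `|f x| <= C) ->
  (@mu2 R).-integrable A (EFin \o f).
Proof.
move=> mA bA mf [C hC]; apply: measurable_bounded_integrable => //.
  exact: mu2_bounded.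
exists C; split; first by rewrite num_real.
by move=> C' CC' x /= Ax; apply: (le_trans (hC x Ax)); exact: ltW.
Qed.

Lemma integrable_continuous (f : plane R -> R) A : meas A -> bounded2 A ->
  continuous f -> (@mu2 R).-integrable A (EFin \o f).
Proof.
move=> mA bA cf; have [C _ hC] := continuous_bound cf bA.
apply: integrable_bounded => //; last by exists C.
by apply: measurable_funTS; exact: continuous_measurable2.
Qed.

Lemma fineMB (c : R) (s t : \bar R) : s \is a fin_num -> t \is a fin_num ->
  fine (c%:E * s - c%:E * t)%E = c * fine (s - t)%E.
Proof. by case: s => [s| |] //; case: t => [t| |] // _ _; rewrite /= mulrBr. Qed.

Lemma integral_affine p v w D (f : plane R -> R) : cross v w != 0 ->
  meas D -> bounded2 D -> bounded2 (affmap p v w @^-1` D) -> continuous f ->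
  \int[@mu2 R]_(x in D) f x =
   `|cross v w| * \int[@mu2 R]_(x in affmap p v w @^-1` D) f (affmap p v w x).
Proof.
move=> d0 mD bD bD' cf.
have mD' := measurable_preimage_cont (@continuous_affmap p v w) mD.
have cf' : continuous (f \o affmap p v w).
  by move=> x; apply: continuous_comp; [exact: continuous_affmap|exact: cf].
have i1 := integrable_continuous mD bD cf.
have i2 := integrable_continuous mD' bD' cf'.
have mf : measurable_fun D (EFin \o f : mplane R -> \bar R).
  by apply/measurable_EFinP/measurable_funTS; exact: continuous_measurable2.
rewrite /Rintegral [in LHS]integralE.
rewrite (ge0_integral_affine p d0 mD (measurable_funepos mf)) //.
rewrite (ge0_integral_affine p d0 mD (measurable_funeneg mf)) //.
have := integral_fune_fin_num mD' (integrable_funepos mD' i2).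
have := integral_fune_fin_num mD' (integrable_funeneg mD' i2).
have e1 : ((EFin \o (f \o affmap p v w))^\+ = (EFin \o f)^\+ \o affmap p v w)%E.
  by rewrite -funepos_comp.
have e2 : ((EFin \o (f \o affmap p v w))^\- = (EFin \o f)^\- \o affmap p v w)%E.
  by rewrite -funeneg_comp.
rewrite [X in _ = _ * fine X]integralE e1 e2 => fn fp.
exact: (fineMB _ fp fn).
Qed.

Lemma hull3_bounded (P : 'I_3 -> plane R) : bounded2 (hull3 P).
Proof.
exists (\sum_k (`|(P k).1| + `|(P k).2|)) => x [l [l0 l1 ->]].
have l1' k : l k <= 1 by rewrite -l1 (bigD1 k) //= lerDl sumr_ge0.
have s1 : (\sum_k l k *: P k).1 = \sum_k l k * (P k).1.
  by rewrite !sum3.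
have s2 : (\sum_k l k *: P k).2 = \sum_k l k * (P k).2.
  by rewrite !sum3.
apply/boxP; rewrite s1 s2; split; apply: (le_trans (ler_norm_sum _ _ _));
  apply: ler_sum => k _; rewrite normrM ger0_norm //.
- by rewrite (le_trans (ler_piMl _ _)) // ?lerDl.
- by rewrite (le_trans (ler_piMl _ _)) // ?lerDr.
Qed.

(** If [c2] is nonzero every vertical section is a single point; otherwise the axes are
    exchanged. *)
Lemma null_line (c0 c1 c2 : R) : (c1 != 0) || (c2 != 0) ->
  (@mu2 R).-negligible [set x | c0 + c1 * x.1 + c2 * x.2 = 0].
Proof.
move=> c12; set L := [set x | _].
have cL : closed L.
  have -> : L = (fun x : plane R => c0 + c1 * x.1 + c2 * x.2) @^-1` [set 0] by [].
  by apply: closed_comp; [move=> x _; exact: continuous_affine2|exact: closed_eq].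
have mL := closed_measurable2 cL.
apply/negligibleP => //.
have key (d0 d1 d2 : R) B : d2 != 0 -> measurable B ->
    B = [set x | d0 + d1 * x.1 + d2 * x.2 = 0] -> @mu2 R B = 0.
  move=> d20 mB BE; rewrite /mu2 /product_measure1 integral0_eq // => x _ /=.
  have -> : xsection B x = [set (- d0 - d1 * x) / d2].
    rewrite xsectionE BE; apply/seteqP; split => y /=.
      move=> e; apply: (mulIf d20); rewrite divfK //.
      by apply/eqP; rewrite -subr_eq0; apply/eqP; rewrite -[RHS]e; ring.
    by move=> ->; field.
  by rewrite lebesgue_measure_set1.
have [c20|c20] := eqVneq c2 0; last exact: (key c0 c1 c2).
rewrite c20 eqxx orbF in c12.
suff : @mu2 R L = 0%E by [].
rewrite -(mu2_swap mL); apply: (key c0 c2 c1) => //.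
  by apply: measurable_preimage_cont => //; exact: continuous_swap.
by apply/seteqP; split => x; rewrite /L /=; rewrite addrAC.
Qed.

Lemma null_bary (P : 'I_3 -> plane R) k : area P != 0 ->
  (@mu2 R).-negligible [set x | bary P k x = 0].
Proof.
move=> P0; have [c0 [c1 [c2 e]]] := bary_affine2 P k; rewrite e; apply: null_line.
apply/negPn/negP; rewrite negb_or !negbK => /andP[/eqP c10 /eqP c20].
have h x : bary P k x = c0 by rewrite e c10 c20 !mul0r !addr0.
have := h (P k); have := h (P (k + 1)); rewrite !bary_vtx // eqxx.
have -> : k + 1 == k = false by case: (ord3_cases k) => ->.
by move=> <- /eqP; rewrite oner_eq0.
Qed.

Lemma null_boundary (P : 'I_3 -> plane R) : area P != 0 ->
  (@mu2 R).-negligible (hull3 P `\` interior (hull3 P)).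
Proof.
move=> P0; have n k := null_bary k P0.
have := negligibleU (negligibleU (n 0) (n 1)) (n (1 + 1)).
apply: negligibleS => x; rewrite interior_hull3 // hull3E //= => -[x0].
move=> /existsNP[k] /negP; rewrite -leNgt => xk.
have {}xk : bary P k x = 0 by apply/eqP; rewrite eq_le xk x0.
by case: (ord3_cases k) xk => -> xk; [left; left|left; right|right].
Qed.

End affine_change_of_variables.

(** * Chain rule and fundamental theorem of calculus *)

Section calculus.
Variable R : realType.
Implicit Types (x v p q : plane R) (f : plane R -> R).
Local Notation leb := (@lebesgue_measure R).

Lemma quotient_line f x v s :
  (fun h : R => h^-1 *: (((fun t : R => f (x + t *: v)) \o shift s) (h *: (1 : R)) -
    f (x + s *: v))) =
  (fun h : R => h^-1 *: ((f \o shift (x + s *: v)) (h *: v) - f (x + s *: v))).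
Proof.
apply/funext => h /=; congr (_ *: (f _ - _)).
by rewrite [h *: (1 : R)]mulr1 scalerDl addrCA addrA.
Qed.

Lemma is_derive_line f x v s : derivable f (x + s *: v) v ->
  is_derive s (1 : R) (fun t => f (x + t *: v)) ('D_v f (x + s *: v)).
Proof.
move=> df; apply: DeriveDef.
  by rewrite /derivable quotient_line.
by rewrite /derive quotient_line.
Qed.

Lemma mvt_step (g dg : R -> R) (a h : R) : (forall t, is_derive t (1 : R) g (dg t)) ->
  exists2 c, `|c| <= `|h| & g (a + h) - g a = h * dg (a + c).
Proof.
move=> gd.
have cg (A : set R) : {within A, continuous g}.
  apply: continuous_subspaceT => t; apply: differentiable_continuous.
  by apply/derivable1_diffP; have := gd t => -[].
have [h0|h0] := leP 0 h.
  have [|c] := @MVT_segment R g dg a (a + h) _ (fun t _ => gd t) (cg _).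
    by rewrite lerDl.
  rewrite in_itv /= => /andP[c0 c1] e; exists (c - a); last first.
    by rewrite subrKC e addrAC subrr add0r mulrC.
  by rewrite !ger0_norm ?subr_ge0 // lerBlDl.
have [|c] := @MVT_segment R g dg (a + h) a _ (fun t _ => gd t) (cg _).
  by rewrite gerDl ltW.
rewrite in_itv /= => /andP[c0 c1] e; exists (c - a).
  by rewrite !ler0_norm ?subr_le0 // ?lerN2 ?lerBrDl // ltW.
by rewrite subrKC -[LHS]opprB e opprD addrA subrr sub0r mulrN opprK mulrC.
Qed.

(** [Ck] only provides derivatives along the axes. An increment along [v] is split into a vertical
    and a horizontal step, each is given by the mean value theorem, and the limit follows from the
    continuity of the partial derivatives. *)
Lemma C1_chain f p v t : Ck 1 f ->
  is_derive t (1 : R) (fun s => f (p + s *: v))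
    (v.1 * dx f (p + t *: v) + v.2 * dy f (p + t *: v)).
Proof.
move=> [cf fx fy /= cx cy]; set q := p + t *: v.
have gx (b : R) s : is_derive s (1 : R) (fun s => f (s, b)) (dx f (s, b)).
  have e r : (0, b) + r *: (1, 0) = (r, b) :> plane R.
    by congr (_, _); rewrite /= /GRing.scale /= ?mulr1 ?mulr0 ?add0r ?addr0.
  have := @is_derive_line f (0, b) (1, 0) s; rewrite e => /(_ (fx _)).
  by under eq_fun do rewrite e.
have gy (a : R) s : is_derive s (1 : R) (fun s => f (a, s)) (dy f (a, s)).
  have e r : (a, 0) + r *: (0, 1) = (a, r) :> plane R.
    by congr (_, _); rewrite /= /GRing.scale /= ?mulr1 ?mulr0 ?add0r ?addr0.
  have := @is_derive_line f (a, 0) (0, 1) s; rewrite e => /(_ (fy _)).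
  by under eq_fun do rewrite e.
have /choice[c hc] : forall h : R, exists c : R * R,
    [/\ `|c.1| <= `|h * v.1|, `|c.2| <= `|h * v.2| &
    f (q + h *: v) - f q = h * v.1 * dx f (q.1 + c.1, q.2 + h * v.2) +
      h * v.2 * dy f (q.1, q.2 + c.2)].
  move=> h.
  have [c1 h1 e1] := mvt_step q.1 (h * v.1) (gx (q.2 + h * v.2)).
  have [c2 h2 e2] := mvt_step q.2 (h * v.2) (gy q.1).
  exists (c1, c2); split => //=; rewrite -e1 -e2.
  have -> : q + h *: v = (q.1 + h * v.1, q.2 + h * v.2) by [].
  by rewrite [in f q](surjective_pairing q) addrA subrK.
have h0 (w : R) : (fun h : R => h * w) @ (0 : R)^' --> (0 : R).
  rewrite -[X in _ --> X](mul0r w); apply: cvgM; last exact: cvg_cst.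
  exact: nbhs_dnbhs.
have n0 (w : R) : (fun h : R => `|h * w|) @ (0 : R)^' --> (0 : R).
  by rewrite -[X in _ --> X](@normr0 _ R); apply: cvg_norm; exact: h0.
have sq (u : R -> R) (w : R) : (forall h, `|u h| <= `|h * w|) -> u @ (0 : R)^' --> (0 : R).
  move=> hu; apply/cvgr0Pnorm_lt => e e0.
  have := n0 w => /cvgr0Pnorm_lt /(_ e e0); apply: filterS => h.
  by rewrite normr_id; apply: le_lt_trans.
have pairc (u w : R -> R) : u @ (0 : R)^' --> q.1 -> w @ (0 : R)^' --> q.2 ->
    (fun h => (u h, w h) : plane R) @ (0 : R)^' --> q.
  move=> uq wq; rewrite [X in _ --> X](surjective_pairing q).
  exact: (@cvg_pair _ _ _ ((0 : R)^') (nbhs q.1) (nbhs q.2) _ _ _ u w uq wq).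
have l1 : (fun h : R => dx f (q.1 + (c h).1, q.2 + h * v.2)) @ (0 : R)^' --> dx f q.
  apply: (@cvg_comp _ _ _ (fun h => (q.1 + (c h).1, q.2 + h * v.2) : plane R) (dx f) _ (nbhs q)).
    apply: pairc.
      rewrite -[X in _ --> X]addr0; apply: cvgD; first exact: cvg_cst.
      by apply: (sq _ v.1) => h; case: (hc h).
    by rewrite -[X in _ --> X]addr0; apply: cvgD; [exact: cvg_cst|exact: h0].
  exact: cx.
have l2 : (fun h : R => dy f (q.1, q.2 + (c h).2)) @ (0 : R)^' --> dy f q.
  apply: (@cvg_comp _ _ _ (fun h => (q.1, q.2 + (c h).2) : plane R) (dy f) _ (nbhs q)).
    apply: pairc; first exact: cvg_cst.
    rewrite -[X in _ --> X]addr0; apply: cvgD; first exact: cvg_cst.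
    by apply: (sq _ v.2) => h; case: (hc h).
  exact: cy.
have L : (fun h : R => h^-1 *: (((fun t : R => f (p + t *: v)) \o shift t) (h *: (1 : R)) - f q))
    @ (0 : R)^' --> v.1 * dx f q + v.2 * dy f q.
  have : (fun h : R => v.1 * dx f (q.1 + (c h).1, q.2 + h * v.2) +
      v.2 * dy f (q.1, q.2 + (c h).2)) @ (0 : R)^' --> v.1 * dx f q + v.2 * dy f q.
    by apply: cvgD; [exact: (cvgM (cvg_cst v.1) l1)|exact: (cvgM (cvg_cst v.2) l2)].
  apply: cvg_trans; apply: near_eq_cvg; near=> h.
  have hn0 : h != 0 by near: h; exact: nbhs_dnbhs_neq.
  have -> : ((fun t0 : R => f (p + t0 *: v)) \o shift t) h%:A = f (q + h *: v).
    by rewrite /= /q [h%:A]mulr1 scalerDl addrCA addrC.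
  have [_ _ ->] := hc h.
  by rewrite [X in _ = X]/GRing.scale /= mulrDr !mulrA mulVf // !mul1r.
by apply: DeriveDef; [apply/cvg_ex; eexists; exact: L|exact: cvg_lim L].
Unshelve. all: by end_near.
Qed.

Lemma cont_integrable (g : R -> R) (a b : R) : continuous g ->
  leb.-integrable `[a, b] (EFin \o g).
Proof.
move=> cg; apply: continuous_compact_integrable; first exact: segment_compact.
by apply: continuous_subspaceT => x; exact: cg.
Qed.

Lemma FTC2 (g dg : R -> R) (a b : R) : a <= b ->
  (forall t, is_derive t (1 : R) g (dg t)) -> continuous dg ->
  \int[leb]_(t in `[a, b]) dg t = g b - g a.
Proof.
move=> ab gd cdg; move: ab; rewrite le_eqVlt => /predU1P[->|ab].
  by rewrite set_itv1 Rintegral_set1 subrr.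
have cg t : {for t, continuous g}.
  apply: differentiable_continuous.
  by apply/derivable1_diffP; have := gd t => -[].
rewrite /Rintegral (@continuous_FTC2 _ dg g a b ab) //.
- by apply: continuous_subspaceT => x; exact: cdg.
- split.
  + by move=> t _; have := gd t => -[].
  + by apply: cvg_at_right_filter; exact: cg.
  + by apply: cvg_at_left_filter; exact: cg.
- by move=> t _; rewrite derive1E; have := gd t => -[].
Qed.

Lemma Rint01_rev (g : R -> R) : continuous g ->
  \int[leb]_(t in `[0, 1]) g (1 - t) = \int[leb]_(t in `[0, 1]) g t.
Proof.
move=> cg; rewrite [RHS]Rintegration_by_substitution_onem ?ler01 ?lexx //.
  by have -> : unstable.onem (1 : R) = 0 by exact: subrr.
by apply: continuous_subspaceT => x; exact: cg.
Qed.

End calculus.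

(** * Green's formula and test functions *)

Section green.
Variable R : realType.
Implicit Types (x v w p q a b : plane R) (f g : plane R -> R).
Local Notation leb := (@lebesgue_measure R).

Definition reft : set (plane R) := [set x | [/\ 0 <= x.1, 0 <= x.2 & x.1 + x.2 <= 1]].

Lemma closed_reft : closed reft.
Proof.
have -> : reft = [set x | 0 <= (0 : R) + 1 * x.1 + 0 * x.2] `&`
   ([set x | 0 <= (0 : R) + 0 * x.1 + 1 * x.2] `&` [set x | 0 <= (1 : R) + -1 * x.1 + -1 * x.2]).
  apply/seteqP; split => x; rewrite /reft /= ?(mul0r, mul1r, add0r, addr0, mulN1r).
    by case=> ? ? ?; split => //; split => //; lra.
  by case=> ? [? ?]; split => //; lra.
have h (c0 c1 c2 : R) : closed [set x : plane R | 0 <= c0 + c1 * x.1 + c2 * x.2].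
  apply: (@closed_comp _ _ (fun x : plane R => c0 + c1 * x.1 + c2 * x.2) [set r | 0 <= r]).
    by move=> x _; exact: continuous_affine2.
  exact: closed_ge.
by apply: closedI; [exact: h|apply: closedI; exact: h].
Qed.

Lemma meas_reft : meas reft.
Proof. exact: closed_measurable2 closed_reft. Qed.

Lemma bounded_reft : bounded2 reft.
Proof. by exists 1 => x [x1 x2 x3]; apply/boxP; rewrite !ger0_norm //; split; lra. Qed.

(** Fubini, then the fundamental theorem of calculus on each horizontal section [[0, 1 - t]]. *)
Lemma ref_d1 g gs : continuous gs ->
  (forall x, is_derive x.1 (1 : R) (fun s => g (s, x.2)) (gs x)) ->
  \int[@mu2 R]_(x in reft) gs x =
  \int[leb]_(t in `[0, 1]) (g (1 - t, t) - g (0, t)).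
Proof.
move=> cgs dg; rewrite Rintegral_mkcond [RHS]Rintegral_mkcond.
have ig : (@mu2 R).-integrable setT (EFin \o (gs \_ reft)).
  have := integrable_continuous meas_reft bounded_reft cgs.
  by rewrite integrable_mkcond; [rewrite restrict_EFin|exact: meas_reft].
rewrite /Rintegral; congr fine.
rewrite -(@integral21_prod_meas1 _ _ (measurableTypeR R) (measurableTypeR R) R leb leb _ ig).
apply: eq_integral => t _; rewrite /fubini_G.
transitivity (\int[leb]_(s in [set s | reft (s, t)]) (gs (s, t))%:E)%E.
  rewrite [RHS]integral_mkcond; apply: eq_integral => s _; rewrite /patch /=.
  have -> : (s \in [set s | reft (s, t)]) = ((s, t) \in reft) by [].
  by case: ifP.
rewrite /patch mem_setE in_itv /=.
case: ifPn => [/andP[t0 t1]|tn]; last first.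
  rewrite (_ : [set s | reft (s, t)] = set0) ?integral_set0 //.
  apply/seteqP; split => // s [/= s0 t0 st]; move: tn; rewrite t0 /=; lra.
have -> : [set s | reft (s, t)] = `[0, 1 - t]%classic.
  apply/seteqP; split => s; rewrite /reft /= in_itv /=.
    by case=> s0 _ st; rewrite s0; lra.
  by move=> /andP[s0 st]; split => //; lra.
have ct : continuous (fun s : R => gs (s, t)).
  move=> s; apply: (@cvg_comp _ _ _ (fun s : R => (s, t) : plane R) gs _ (nbhs (s, t))).
    exact: (@cvg_pair _ _ _ (nbhs s) (nbhs s) (nbhs t) _ _ _ id (cst t) cvg_id (cvg_cst t)).
  exact: cgs.
have t1' : 0 <= 1 - t by rewrite subr_ge0.
have dg' (s : R) : is_derive s (1 : R) (fun s => g (s, t)) (gs (s, t)) by exact: (dg (s, t)).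
rewrite -(FTC2 t1' dg' ct) /Rintegral fineK //.
by apply: integrable_fin_num => //; exact: cont_integrable.
Qed.

Lemma cross_swap : cross (0, 1) (1, 0) = -1 :> R.
Proof. by rewrite /cross /= mul0r mulr1 sub0r. Qed.

Lemma ref_d2 g gt : continuous gt ->
  (forall x, is_derive x.2 (1 : R) (fun t => g (x.1, t)) (gt x)) ->
  \int[@mu2 R]_(x in reft) gt x =
  \int[leb]_(s in `[0, 1]) (g (s, 1 - s) - g (s, 0)).
Proof.
move=> cgt dg.
have pre : affmap 0 (0, 1) (1, 0) @^-1` reft = reft.
  apply/seteqP; split => x; rewrite /reft /affmap /= ?(mulr0, mulr1, add0r, addr0) /GRing.scale /=
    ?(mulr0, mulr1, add0r, addr0); by case=> ? ? ?; split => //; rewrite addrC.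
have c0 : cross (0, 1) (1, 0) != 0 :> R by rewrite cross_swap oppr_eq0 oner_eq0.
rewrite (@integral_affine R 0 _ _ _ _ c0 meas_reft bounded_reft _ cgt) pre;
  last exact: bounded_reft.
rewrite cross_swap normrN1 mul1r.
have e x : affmap 0 (0, 1) (1, 0) x = (x.2, x.1) :> plane R.
  by congr (_, _); rewrite /= /GRing.scale /= ?(mulr0, mulr1, add0r, addr0).
have -> : (fun x => gt (affmap 0 (0, 1) (1, 0) x)) = (fun x => gt (x.2, x.1)).
  by apply/funext => x; rewrite e.
have cgt' : continuous (fun x : plane R => gt (x.2, x.1)).
  by move=> x; apply: continuous_comp; [exact: continuous_swap|exact: cgt].
have dg' x : is_derive x.1 (1 : R) (fun s => g ((s, x.2).2, (s, x.2).1)) (gt (x.2, x.1)).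
  by move=> /=; exact: (dg (x.2, x.1)).
by rewrite (ref_d1 (g := fun x => g (x.2, x.1)) cgt' dg').
Qed.

Lemma preimage_affmap (P : 'I_3 -> plane R) : area P != 0 ->
  affmap (P 0) (P 1 - P 0) (P (1 + 1) - P 0) @^-1` hull3 P = reft.
Proof.
move=> P0; rewrite hull3E //; apply/seteqP.
pose l (x : plane R) (k : 'I_3) : R :=
  if k == 0 then 1 - x.1 - x.2 else if k == 1 then x.1 else x.2.
have e x : affmap (P 0) (P 1 - P 0) (P (1 + 1) - P 0) x = \sum_k l x k *: P k.
  rewrite sum3 /l /= /affmap; case: (P 0) (P 1) (P (1 + 1)) => [? ?] [? ?] [? ?].
  by congr (_, _); rewrite /= /GRing.scale /=; ring.
have l1 x : \sum_k l x k = 1 by rewrite sum3 /l /=; ring.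
split => x /=.
  move=> h; have h' k : 0 <= l x k by have := h k; rewrite e bary_baryc.
  have := h' 0; have := h' 1; have := h' (1 + 1); rewrite /l /= => ? ? ?.
  by split => //; lra.
move=> [x1 x2 x3] k; rewrite e bary_baryc //.
by rewrite /l; case: (ord3_cases k) => -> //=; lra.
Qed.

(* The flux of the field [(F1, F2)] through the segment, the normal being the
   clockwise rotation of [b - a] (not normalized). *)
Definition eflux a b (F1 F2 : plane R -> R) : R :=
  \int[leb]_(t in `[0, 1]) ((b - a).2 * F1 (a + t *: (b - a)) - (b - a).1 * F2 (a + t *: (b - a))).

Lemma continuous_line a b : continuous (fun t : R => a + t *: (b - a)).
Proof. by move=> t; apply: cvgD; [exact: cvg_cst|exact: scalel_continuous]. Qed.

Lemma continuous_eflux a b (F1 F2 : plane R -> R) : continuous F1 -> continuous F2 ->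
  continuous (fun t : R => (b - a).2 * F1 (a + t *: (b - a)) - (b - a).1 * F2 (a + t *: (b - a))).
Proof.
move=> c1 c2 t.
have h (F : plane R -> R) : continuous F ->
    (fun t : R => F (a + t *: (b - a))) @ t --> F (a + t *: (b - a)).
  move=> cF; apply: (@cvg_comp _ _ _ (fun t : R => a + t *: (b - a)) F _ (nbhs (a + t *: (b - a)))).
    exact: continuous_line.
  exact: cF.
exact: (cvgB (cvgM (cvg_cst (b - a).2) (h _ c1)) (cvgM (cvg_cst (b - a).1) (h _ c2))).
Qed.

Lemma eflux_rev a b F1 F2 : continuous F1 -> continuous F2 ->
  eflux b a F1 F2 = - eflux a b F1 F2.
Proof.
move=> c1 c2; rewrite /eflux -[in RHS]Rint01_rev; last exact: continuous_eflux.
rewrite -[RHS]mulN1r -RintegralZl //; last first.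
  apply: cont_integrable => t.
  apply: (@continuous_comp _ _ _ (fun t : R => 1 - t)
    (fun t : R => (b - a).2 * F1 (a + t *: (b - a)) - (b - a).1 * F2 (a + t *: (b - a)))).
    by apply: cvgB; [exact: cvg_cst|exact: cvg_id].
  exact: continuous_eflux.
apply: eq_Rintegral => t _.
have -> : b + t *: (a - b) = a + (1 - t) *: (b - a).
  by case: a b => [? ?] [? ?]; congr (_, _); rewrite /= /GRing.scale /=; ring.
by rewrite -(opprB b a) /=; ring.
Qed.

Lemma Ck1_continuous f : Ck 1 f -> [/\ continuous f, continuous (dx f) & continuous (dy f)].
Proof. by case. Qed.

Lemma green_triangle (P : 'I_3 -> plane R) (F1 F2 : plane R -> R) : area P != 0 ->
  Ck 1 F1 -> Ck 1 F2 ->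
  \int[@mu2 R]_(x in hull3 P) (dx F1 x + dy F2 x) =
  Num.sg (area P) * \sum_k eflux (P (k + 1)) (P (k + (1 + 1))) F1 F2.
Proof.
move=> P0 h1 h2; have [c1 c1x c1y] := Ck1_continuous h1; have [c2 c2x c2y] := Ck1_continuous h2.
pose p := P 0; pose v := P 1 - P 0; pose w := P (1 + 1) - P 0.
have d0 : cross v w != 0 by [].
have cdiv : continuous (fun x => dx F1 x + dy F2 x).
  by move=> x; exact: (cvgD (c1x x) (c2y x)).
have pre := preimage_affmap P0.
have mT : @measurable _ (mplane R) (hull3 P) by exact: closed_measurable2 (closed_hull3 P0).
have bpre : bounded2 (affmap p v w @^-1` hull3 P) by rewrite pre; exact: bounded_reft.
rewrite (integral_affine d0 mT (hull3_bounded P) bpre cdiv) pre.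
pose G x := affmap p v w x.
have cG : continuous G by exact: continuous_affmap.
(* [(A, B)] is the Piola transform of the field: the inverse of the Jacobian matrix of [G], times
   its determinant, applied to it. Its divergence [As + Bt] is the determinant times the divergence
   of the field. *)
pose A x := w.2 * F1 (G x) - w.1 * F2 (G x).
pose B x := v.1 * F2 (G x) - v.2 * F1 (G x).
pose As x := w.2 * (v.1 * dx F1 (G x) + v.2 * dy F1 (G x)) -
   w.1 * (v.1 * dx F2 (G x) + v.2 * dy F2 (G x)).
pose Bt x := v.1 * (w.1 * dx F2 (G x) + w.2 * dy F2 (G x)) -
   v.2 * (w.1 * dx F1 (G x) + w.2 * dy F1 (G x)).
have cc f : continuous f -> continuous (fun x => f (G x)).
  by move=> cf x; apply: continuous_comp; [exact: cG|exact: cf].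
have cl (r s : R) f g : continuous f -> continuous g ->
    continuous (fun x => r * f x + s * g x).
  move=> cf cg x; exact: (cvgD (cvgM (cvg_cst r) (cf x)) (cvgM (cvg_cst s) (cg x))).
have clB (r s : R) f g : continuous f -> continuous g ->
    continuous (fun x => r * f x - s * g x).
  move=> cf cg x; exact: (cvgB (cvgM (cvg_cst r) (cf x)) (cvgM (cvg_cst s) (cg x))).
have cA : continuous A by apply: clB; exact: cc.
have cB : continuous B by apply: clB; exact: cc.
have cAs : continuous As by apply: clB; apply: cl; exact: cc.
have cBt : continuous Bt by apply: clB; apply: cl; exact: cc.
have dl (f : R -> R) g (r s df dg t : R) : is_derive t (1 : R) f df ->
    is_derive t (1 : R) (fun t => r * f t) (r * df).
  by move=> hf; exact: (@is_deriveZ _ _ _ f r t 1 df hf).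
have dlB (f g : R -> R) (r s df dg t : R) : is_derive t (1 : R) f df ->
    is_derive t (1 : R) g dg ->
    is_derive t (1 : R) (fun t => r * f t - s * g t) (r * df - s * dg).
  move=> hf hg.
  exact: (is_deriveB (@is_deriveZ _ _ _ f r t 1 df hf) (@is_deriveZ _ _ _ g s t 1 dg hg)).
have dA x : is_derive x.1 (1 : R) (fun s => A (s, x.2)) (As x).
  have e s : G (s, x.2) = (p + x.2 *: w) + s *: v by rewrite /G /affmap /= addrAC.
  have ex : G x = (p + x.2 *: w) + x.1 *: v by rewrite -e -surjective_pairing.
  rewrite /A /As ex; under eq_fun do rewrite e.
  by apply: (dlB (fun s => F1 (p + x.2 *: w + s *: v)) (fun s => F2 (p + x.2 *: w + s *: v)));
    exact: C1_chain.
have dB x : is_derive x.2 (1 : R) (fun t => B (x.1, t)) (Bt x).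
  have e t : G (x.1, t) = (p + x.1 *: v) + t *: w by [].
  have ex : G x = (p + x.1 *: v) + x.2 *: w by [].
  rewrite /B /Bt ex; under eq_fun do rewrite e.
  by apply: (dlB (fun s => F2 (p + x.1 *: v + s *: w)) (fun s => F1 (p + x.1 *: v + s *: w)));
    exact: C1_chain.
have I1 := ref_d1 cAs dA; have I2 := ref_d2 cBt dB.
have e1 : cross v w * \int[@mu2 R]_(x in reft) (dx F1 (G x) + dy F2 (G x)) =
    \int[@mu2 R]_(x in reft) As x + \int[@mu2 R]_(x in reft) Bt x.
  rewrite -RintegralD; [|exact: meas_reft|exact: integrable_continuous meas_reft bounded_reft cAs
    |exact: integrable_continuous meas_reft bounded_reft cBt].
  rewrite -RintegralZl; [|exact: meas_reft|].
    by apply: eq_Rintegral => x _; rewrite /As /Bt /cross; ring.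
  exact: integrable_continuous meas_reft bounded_reft (cc _ cdiv).
have -> : `|cross v w| = Num.sg (area P) * cross v w.
  exact: normrEsg.
rewrite -mulrA e1 I1 I2; congr (_ * _).
have l2 (f : plane R -> R) (h k : R -> R) : continuous f -> continuous h -> continuous k ->
    continuous (fun t : R => f (h t, k t)).
  move=> cf ch ck t.
  apply: (@cvg_comp _ _ _ (fun s : R => (h s, k s) : plane R) f _ (nbhs (h t, k t))).
    exact: (@cvg_pair _ _ _ (nbhs t) (nbhs (h t)) (nbhs (k t)) _ _ _ h k (ch t) (ck t)).
  exact: cf.
have cid : continuous (fun t : R => t) by move=> t; exact: cvg_id.
have ccst (r : R) : continuous (fun t : R => r) by move=> t; exact: cvg_cst.
have c1m : continuous (fun t : R => 1 - t).
  by move=> t; apply: cvgB; [exact: cvg_cst|exact: cvg_id].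
have mI : measurable (`[0, 1]%classic : set (measurableTypeR R)) by exact: measurable_itv.
have iA1 := cont_integrable 0 1 (l2 A _ _ cA c1m cid).
have iA0 := cont_integrable 0 1 (l2 A _ _ cA (ccst 0) cid).
have iB1 := cont_integrable 0 1 (l2 B _ _ cB cid c1m).
have iB1' := cont_integrable 0 1 (l2 B _ _ cB c1m cid).
have iB0 := cont_integrable 0 1 (l2 B _ _ cB cid (ccst 0)).
rewrite (RintegralB mI iA1 iA0) (RintegralB mI iB1 iB0).
(* Each leg of the reference triangle carries one boundary term, the hypotenuse one from each
   direction; these two are brought to the same parametrization. *)
have -> : \int[leb]_(t in `[0, 1]) B (t, 1 - t) = \int[leb]_(t in `[0, 1]) B (1 - t, t).
  rewrite -(@Rint01_rev R (fun t => B (1 - t, t))); last exact: l2.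
  by apply: eq_Rintegral => t _; rewrite subKr.
rewrite sum3 add0r !ord3_eqs add0r.
have -> : eflux (P (1 + 1)) (P 0) F1 F2 = - \int[leb]_(t in `[0, 1]) A (0, t).
  rewrite eflux_rev //; congr (- _); apply: eq_Rintegral => t _.
  by rewrite /A /G /affmap /= scale0r addr0.
have -> : eflux (P 0) (P 1) F1 F2 = - \int[leb]_(t in `[0, 1]) B (t, 0).
  rewrite -[RHS]mulN1r -(RintegralZl _ mI iB0).
  apply: eq_Rintegral => t _.
  by rewrite /B /G /affmap /= scale0r addr0 -/p -/v; ring.
have -> : eflux (P 1) (P (1 + 1)) F1 F2 = \int[leb]_(t in `[0, 1]) A (1 - t, t) +
    \int[leb]_(t in `[0, 1]) B (1 - t, t).
  rewrite -(RintegralD mI iA1 iB1').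
  apply: eq_Rintegral => t _; rewrite /A /B.
  have -> : P 1 + t *: (P (1 + 1) - P 1) = G (1 - t, t).
    rewrite /G /affmap /v /w /p /=; case: (P 0) (P 1) (P (1 + 1)) => [? ?] [? ?] [? ?].
    by congr (_, _); rewrite /= /GRing.scale /=; ring.
  have -> : P (1 + 1) - P 1 = w - v by rewrite /w /v opprB addrA subrK.
  by rewrite /=; ring.
by rewrite addrACA -!addrA; congr (_ + _); rewrite addrCA addrC -addrA.
Qed.

End green.

(** * Smoothness of polynomials and of functions of an affine form *)

Section smooth_functions.
Variable R : realType.
Implicit Types (x v : plane R) (f g : plane R -> R).

Lemma is_derive_linear f x v : (forall (a : R) y z, f (a *: y + z) = a * f y + f z) ->
  is_derive x v f (f v).
Proof.
move=> fl.
have L : (fun h : R => h^-1 *: ((f \o shift x) (h *: v) - f x)) @ (0 : R)^' --> f v.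
  have c : (fun _ : R => f v) @ (0 : R)^' --> f v by exact: cvg_cst.
  apply: cvg_trans c; apply: near_eq_cvg; near=> h.
  rewrite /= fl addrK /GRing.scale /= mulKf //.
  by near: h; exact: nbhs_dnbhs_neq.
by apply: DeriveDef; [apply/cvg_ex; eexists; exact: L|exact: cvg_lim L].
Unshelve. all: by end_near.
Qed.

Lemma is_derive_peval (p : poly2 R) x :
  is_derive x ((1, 0) : plane R) (peval p) (peval (mderiv ord0 p) x) /\
  is_derive x ((0, 1) : plane R) (peval p) (peval (mderiv ord_max p) x).
Proof.
elim/poly2_ind: p x => [c|i|p q IHp IHq|p q IHp IHq] x.
- have -> : peval (mpolyC 2 c) = cst c by apply/funext => y; rewrite pevalC.
  by rewrite !mderivC !peval0; split; exact: is_derive_cst.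
- have -> : peval (var R i) = fun y => if i == ord0 then y.1 else y.2.
    by apply/funext => y; rewrite pevalX.
  rewrite !mderiv_var !pevalC.
  case: (ord2_cases i) => -> /=.
    by split; [exact: (@is_derive_linear (fun y => y.1) x (1, 0))
              |exact: (@is_derive_linear (fun y => y.1) x (0, 1))].
  by split; [exact: (@is_derive_linear (fun y => y.2) x (1, 0))
              |exact: (@is_derive_linear (fun y => y.2) x (0, 1))].
- have -> : peval (p + q) = peval p + peval q by apply/funext => y; rewrite pevalD.
  by rewrite !mderivD !pevalD; split; apply: is_deriveD;
    [case: (IHp x)|case: (IHq x)|case: (IHp x)|case: (IHq x)].
- have -> : peval (p * q) = peval p * peval q by apply/funext => y; rewrite pevalM.
  have [p0 p1] := IHp x; have [q0 q1] := IHq x.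
  rewrite !mderivM !pevalD !pevalM; split.
    have := is_deriveM p0 q0; rewrite /GRing.scale /= addrC.
    by rewrite [X in X + _]mulrC.
  have := is_deriveM p1 q1; rewrite /GRing.scale /= addrC.
  by rewrite [X in X + _]mulrC.
Qed.

Lemma continuous_peval (p : poly2 R) : continuous (peval p).
Proof.
elim/poly2_ind: p => [c|i|p q IHp IHq|p q IHp IHq] x.
- have -> : peval (mpolyC 2 c) = cst c by apply/funext => y; rewrite pevalC.
  exact: cvg_cst.
- have -> : peval (var R i) = fun y => if i == ord0 then y.1 else y.2.
    by apply/funext => y; rewrite pevalX.
  by case: eqP => _; [exact: cvg_fst|exact: cvg_snd].
- have -> : peval (p + q) = peval p + peval q by apply/funext => y; rewrite pevalD.
  exact: (cvgD (IHp x) (IHq x)).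
- have -> : peval (p * q) = peval p * peval q by apply/funext => y; rewrite pevalM.
  exact: (cvgM (IHp x) (IHq x)).
Qed.

Lemma dx_peval (p : poly2 R) : dx (peval p) = peval (mderiv ord0 p).
Proof. by apply/funext => x; have [h _] := is_derive_peval p x; case: h. Qed.

Lemma dy_peval (p : poly2 R) : dy (peval p) = peval (mderiv ord_max p).
Proof. by apply/funext => x; have [_ h] := is_derive_peval p x; case: h. Qed.

Lemma Ck_peval k (p : poly2 R) : Ck k (peval p).
Proof.
elim: k p => [|k IHk] p /=; first exact: continuous_peval.
split; first exact: continuous_peval.
- by move=> x; have [h _] := is_derive_peval p x; case: h.
- by move=> x; have [_ h] := is_derive_peval p x; case: h.
- by rewrite dx_peval.
- by rewrite dy_peval.
Qed.

Lemma CkW k f : Ck k.+1 f -> Ck k f.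
Proof.
elim: k f => [|k IHk] f [cf fx fy cx cy]; first exact: cf.
by split; [exact: cf|exact: fx|exact: fy|exact: (IHk _ cx)|exact: (IHk _ cy)].
Qed.

Lemma dx_add f g : (forall x, derivable f x ((1, 0) : plane R)) ->
  (forall x, derivable g x ((1, 0) : plane R)) -> dx (f + g) = dx f + dx g.
Proof. by move=> hf hg; apply/funext => x; rewrite /dx deriveD. Qed.
Lemma dy_add f g : (forall x, derivable f x ((0, 1) : plane R)) ->
  (forall x, derivable g x ((0, 1) : plane R)) -> dy (f + g) = dy f + dy g.
Proof. by move=> hf hg; apply/funext => x; rewrite /dy deriveD. Qed.
Lemma dx_mul f g : (forall x, derivable f x ((1, 0) : plane R)) ->
  (forall x, derivable g x ((1, 0) : plane R)) -> dx (f * g) = f * dx g + g * dx f.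
Proof. by move=> hf hg; apply/funext => x; rewrite /dx deriveM. Qed.
Lemma dy_mul f g : (forall x, derivable f x ((0, 1) : plane R)) ->
  (forall x, derivable g x ((0, 1) : plane R)) -> dy (f * g) = f * dy g + g * dy f.
Proof. by move=> hf hg; apply/funext => x; rewrite /dy deriveM. Qed.

Lemma Ck_add k f g : Ck k f -> Ck k g -> Ck k (f + g).
Proof.
elim: k f g => [|k IHk] f g /=.
  by move=> cf cg x; exact: (cvgD (cf x) (cg x)).
move=> [cf fx fy cfx cfy] [cg gx gy cgx cgy]; split.
- by move=> x; exact: (cvgD (cf x) (cg x)).
- by move=> x; exact: derivableD.
- by move=> x; exact: derivableD.
- by rewrite (dx_add fx gx); exact: (IHk _ _ cfx cgx).
- by rewrite (dy_add fy gy); exact: (IHk _ _ cfy cgy).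
Qed.

Lemma Ck_mul k f g : Ck k f -> Ck k g -> Ck k (f * g).
Proof.
elim: k f g => [|k IHk] f g.
  by move=> cf cg x; exact: (cvgM (cf x) (cg x)).
move=> hf hg; have hf' := CkW hf; have hg' := CkW hg.
move: hf hg => [cf fx fy cfx cfy] [cg gx gy cgx cgy]; split.
- by move=> x; exact: (cvgM (cf x) (cg x)).
- by move=> x; exact: derivableM.
- by move=> x; exact: derivableM.
- by rewrite (dx_mul fx gx); apply: Ck_add; [exact: (IHk _ _ hf' cgx)|exact: (IHk _ _ hg' cfx)].
- by rewrite (dy_mul fy gy); apply: Ck_add; [exact: (IHk _ _ hf' cgy)|exact: (IHk _ _ hg' cfy)].
Qed.

(** A function [G 0] given together with all its derivatives, so that smoothness in the plane is
    proved by induction on the order of differentiation. *)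
Definition smooth_seq (G : nat -> R -> R) :=
  forall n t, is_derive t (1 : R) (G n) (G n.+1 t).

Lemma smooth_seq_continuous G n : smooth_seq G -> continuous (G n).
Proof.
move=> hG t; apply: differentiable_continuous.
by apply/derivable1_diffP; have := hG n t => -[].
Qed.

Lemma is_derive_of_line f x v (df : R) :
  is_derive (0 : R) (1 : R) (fun t => f (x + t *: v)) df -> is_derive x v f df.
Proof.
have q0 := quotient_line f x v 0; rewrite scale0r addr0 in q0.
move=> [h1 h2]; apply: DeriveDef.
  by move: h1; rewrite /derivable scale0r addr0 q0.
by move: h2; rewrite /derive scale0r addr0 q0.
Qed.

Lemma is_derive_ridge G n (c0 c1 c2 : R) x v : smooth_seq G ->
  is_derive x v (fun y : plane R => G n (c0 + c1 * y.1 + c2 * y.2))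
   ((c1 * v.1 + c2 * v.2) * G n.+1 (c0 + c1 * x.1 + c2 * x.2)).
Proof.
move=> hG; apply: is_derive_of_line.
pose m := c1 * v.1 + c2 * v.2; pose l := c0 + c1 * x.1 + c2 * x.2.
have -> : (fun t : R => G n (c0 + c1 * (x + t *: v).1 + c2 * (x + t *: v).2)) =
    G n \o horner (l%:P + m *: 'X).
  apply/funext => t /=; rewrite hornerD hornerC hornerZ hornerX; congr (G n _).
  by rewrite /l /m; case: (x) (v) => [? ?] [? ?] /=; rewrite /GRing.scale /=; ring.
have h0 : (l%:P + m *: 'X).[0] = l by rewrite !hornerE ?mulr0 ?addr0.
have h1 := is_derive_poly (l%:P + m *: 'X) 0.
have hg : is_derive (l%:P + m *: 'X).[0] (1 : R) (G n) (G n.+1 l) by rewrite h0; exact: hG.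
have := @is_derive1_comp R (G n) (horner (l%:P + m *: 'X)) 0 _ _ hg h1.
have -> : (l%:P + m *: 'X)^`().[0] = m by rewrite derivD derivC derivZ derivX add0r !hornerE ?mulr1.
by rewrite mulrC.
Qed.

Lemma Ck_cst k (c : R) : Ck k (cst c : plane R -> R).
Proof.
have e v : (fun x : plane R => 'D_v (cst c : plane R -> R) x) = cst 0.
  by apply/funext => x; rewrite derive_cst.
elim: k c e => [|k IHk] c e; first by move=> x; exact: cvg_cst.
split; first by move=> x; exact: cvg_cst.
- by move=> x; exact: derivable_cst.
- by move=> x; exact: derivable_cst.
- by rewrite /dx e; apply: IHk => v; apply/funext => x; rewrite derive_cst.
- by rewrite /dy e; apply: IHk => v; apply/funext => x; rewrite derive_cst.
Qed.

Lemma Ck_ridge k G n (c0 c1 c2 : R) : smooth_seq G ->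
  Ck k (fun y : plane R => G n (c0 + c1 * y.1 + c2 * y.2)).
Proof.
move=> hG; have cr m : continuous (fun y : plane R => G m (c0 + c1 * y.1 + c2 * y.2)).
  move=> y; apply: (@continuous_comp _ _ _ (fun y : plane R => c0 + c1 * y.1 + c2 * y.2) (G m)).
    exact: continuous_affine2.
  exact: smooth_seq_continuous.
elim: k n => [|k IHk] n; first exact: cr.
have dd v x := is_derive_ridge n c0 c1 c2 x v hG.
have de v : 'D_v (fun y : plane R => G n (c0 + c1 * y.1 + c2 * y.2)) =
    cst (c1 * v.1 + c2 * v.2) * (fun y : plane R => G n.+1 (c0 + c1 * y.1 + c2 * y.2)).
  by apply/funext => x; case: (dd v x).
split; first exact: cr.
- by move=> x; case: (dd (1, 0) x).
- by move=> x; case: (dd (0, 1) x).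
- by rewrite /dx de; apply: Ck_mul; [exact: Ck_cst|exact: IHk].
- by rewrite /dy de; apply: Ck_mul; [exact: Ck_cst|exact: IHk].
Qed.

End smooth_functions.

Section flat_function.
Variable R : realType.

(* Closed under differentiation through [flat_step], hence smooth; [flat_seq]
   lists the derivatives of exp(-1/t), extended by zero for t <= 0. *)
Definition flat (p : {poly R}) (t : R) : R :=
  if 0 < t then p.[t^-1] * expR (- t^-1) else 0.

Definition flat_step (p : {poly R}) : {poly R} := 'X^2 * (p - p^`()).

Definition flat_seq (n : nat) : R -> R := flat (iter n flat_step 1).

(** Monomial by monomial: the power [u ^+ i] is at most [i]! times the exponential, by keeping one
    term of its series. *)
Lemma expR_poly_bound (p : {poly R}) : exists2 C, 0 <= C &
  forall u, 0 <= u -> `|p.[u]| * expR (- u) <= C.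
Proof.
exists (\sum_(i < size p) `|p`_i| * (i`!)%:R).
  by rewrite sumr_ge0 // => i _; rewrite mulr_ge0.
move=> u u0; rewrite horner_coef.
apply: (le_trans (ler_wpM2r (expR_ge0 _) (ler_norm_sum _ _ _))).
rewrite mulr_suml; apply: ler_sum => i _.
rewrite normrM -mulrA ler_wpM2l // ger0_norm ?exprn_ge0 //.
rewrite expRN ler_pdivrMr ?expR_gt0 //.
case: (nat_of_ord i) => [|n].
  by rewrite expr0 fact0 mul1r -expR0 ler_expR.
have hu := expR_ge1Dxn n u0.
rewrite mulrC -ler_pdivrMr ?ltr0n ?fact_gt0 //.
by apply: le_trans hu; rewrite lerDr.
Qed.

(** The previous bound, applied to ['X^2 * p] at [t^-1]. Being quadratic, it makes the difference
    quotient at 0 tend to 0. *)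
Lemma flat_bound (p : {poly R}) : exists2 C, 0 <= C &
  forall t, `|flat p t| <= C * t ^+ 2.
Proof.
have [C C0 hC] := expR_poly_bound ('X^2 * p); exists C => // t.
rewrite /flat; case: ifPn => [t0|_]; last by rewrite normr0 mulr_ge0 // sqr_ge0.
have t1 : 0 <= t^-1 by rewrite invr_ge0 ltW.
have := hC _ t1; rewrite hornerM hornerXn normrM [`|_ ^+ 2|]ger0_norm ?exprn_ge0 //.
rewrite normrM [`|expR _|]ger0_norm ?expR_ge0 // -mulrA exprVn mulrC.
by rewrite ler_pdivrMr ?exprn_gt0.
Qed.

Lemma is_derive_flat (p : {poly R}) t : is_derive t (1 : R) (flat p) (flat (flat_step p) t).
Proof.
have [t0|t0|->] := ltgtP t 0.
- have -> : flat (flat_step p) t = 0 by rewrite /flat ltNge (ltW t0).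
  have d0 : is_derive t (1 : R) (cst 0 : R -> R) 0 by exact: is_derive_cst.
  apply: near_eq_is_derive d0.
  by near=> s; rewrite /flat ltNge (ltW (_ : s < 0)) //; near: s; exact: lt_nbhsl.
- have -> : flat (flat_step p) t = (flat_step p).[t^-1] * expR (- t^-1).
    by rewrite /flat t0.
  have tn0 : t != 0 by rewrite gt_eqF.
  have di : is_derive t (1 : R) (fun s => s^-1) (- t ^- 2).
    have := @is_deriveV _ id t 1 1 tn0 (is_derive_id _ _).
    by rewrite /GRing.scale /= mulr1.
  have dni : is_derive t (1 : R) (fun s => - s^-1) (t ^- 2).
    by have := @is_deriveN R R R (fun s => s^-1) t 1 _ di; rewrite opprK.
  have d1 := @is_derive1_comp R (horner p) (fun s => s^-1) t _ _ (is_derive_poly p t^-1) di.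
  have d2 := @is_derive1_comp R expR (fun s => - s^-1) t _ _ (is_derive_expR (- t^-1)) dni.
  have := is_deriveM d1 d2.
  have -> : horner p t^-1 *: (expR (- t^-1) * t ^- 2) + expR (- t^-1) *: (p^`().[t^-1] * - t ^- 2) =
      (flat_step p).[t^-1] * expR (- t^-1).
    rewrite /GRing.scale /= /flat_step hornerM hornerXn hornerD hornerN exprVn /=; ring.
  apply: near_eq_is_derive.
  by near=> s; rewrite /flat ifT //; near: s; exact: lt_nbhsr.
have -> : flat (flat_step p) 0 = 0 by rewrite /flat ltxx.
have [C C0 hC] := flat_bound p.
have L : (fun h : R =>
    h^-1 *: ((flat p \o shift 0) (h *: (1 : R)) - flat p 0)) @ (0 : R)^' --> (0 : R).
  apply/cvgr0Pnorm_lt => e e0; near=> h.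
  have hn0 : h != 0 by near: h; exact: nbhs_dnbhs_neq.
  have f0 : flat p 0 = 0 by rewrite /flat ltxx.
  rewrite /= f0 subr0 addr0 [h%:A]mulr1 /GRing.scale /= normrM normfV.
  rewrite mulrC ltr_pdivrMr ?normr_gt0 //; apply: (le_lt_trans (hC h)).
  have he : `|h| < e / (C + 1).
    by near: h; apply: dnbhs0_lt; rewrite divr_gt0 // ltr_wpDl.
  have h0 : 0 < `|h| by rewrite normr_gt0.
  rewrite -(real_normK (num_real h)) expr2 mulrA ltr_pM2r //.
  rewrite ltr_pdivlMr ?ltr_wpDl // in he; apply: le_lt_trans he.
  by rewrite mulrC ler_wpM2l // lerDl.
by apply: DeriveDef; [apply/cvg_ex; eexists; exact: L|exact: cvg_lim L].
Unshelve. all: by end_near.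
Qed.

Lemma smooth_flat_seq : smooth_seq flat_seq.
Proof. by move=> n t; exact: is_derive_flat. Qed.

Lemma flat0 t : flat_seq 0 t = if 0 < t then expR (- t^-1) else 0.
Proof. by rewrite /flat_seq /flat /=; case: ifP; rewrite // hornerC mul1r. Qed.

Lemma flat0_le1 t : 0 <= flat_seq 0 t <= 1.
Proof.
rewrite flat0; case: ifPn => [t0|_]; last by rewrite lexx ler01.
by rewrite expR_ge0 /= -expR0 ler_expR oppr_le0 invr_ge0 ltW.
Qed.

End flat_function.

(** * Functions vanishing almost everywhere on an open set *)

Section open_zero.
Variable R : realType.
Implicit Types (x : plane R).

Lemma open_not_negligible (U : set (plane R)) : open U -> U !=set0 ->
  ~ (@mu2 R).-negligible U.
Proof.
move=> oU [x Ux] [N [mN N0 UN]].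
have := oU; rewrite openE => /(_ x Ux); rewrite /interior /= => /nbhs_ballP[e /= e0 he].
pose B : set (plane R) := `](x.1 - e), (x.1 + e)[%classic `*` `](x.2 - e), (x.2 + e)[%classic.
have BU : B `<=` U.
  move=> y [/=]; rewrite !in_itv /= => /andP[y1 y2] /andP[y3 y4]; apply: he.
  by split; rewrite /ball /=; rewrite ltr_norml; apply/andP; split; lra.
have mB : @measurable _ (mplane R) B by apply: measurableX; exact: measurable_itv.
have : (@mu2 R B <= @mu2 R N)%E.
  by apply: le_measure; rewrite ?inE //; exact: subset_trans BU UN.
have -> : @mu2 R N = 0%E by [].
have -> : @mu2 R B = (@lebesgue_measure R `](x.1 - e)%R, (x.1 + e)%R[%classic *
    @lebesgue_measure R `](x.2 - e)%R, (x.2 + e)%R[%classic)%E.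
  by rewrite /mu2 /B product_measure1E //; exact: measurable_itv.
rewrite !lebesgue_measure_itv /= !lte_fin !ifT; [|lra..].
rewrite -!EFinD -EFinM lee_fin leNgt mulr_gt0 //; lra.
Qed.

Lemma ae_zero_open (U : set (plane R)) (f : plane R -> R) : open U -> continuous f ->
  {ae @mu2 R, forall x, U x -> f x = 0} -> forall x, U x -> f x = 0.
Proof.
move=> oU cf hae x Ux; apply: contrapT => fx.
pose V := U `&` (f @^-1` [set r | r != 0]).
have oV : open V.
  apply: openI => //; apply: open_comp; first by move=> y _; exact: cf.
  exact: open_neq.
apply: (open_not_negligible oV); first by exists x; split => //; apply/eqP.
by apply: negligibleS hae => y [Uy /eqP fy] /= h; exact/fy/h.
Qed.

(** The partial derivatives vanish on [U] as well; by induction on the degree they are zero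
    polynomials, and [p] is a constant. *)
Lemma peval_zero_open (U : set (plane R)) (p : poly2 R) : open U -> U !=set0 ->
  (forall x, U x -> peval p x = 0) -> p = 0.
Proof.
move=> oU [x0 Ux0]; have [n] := ubnP (mmeasure mdeg p); elim: n p => // n IHn p pn pU.
have hd (q : poly2 R) : (forall x, U x -> peval q x = 0) -> forall i x, U x ->
    peval (mderiv i q) x = 0.
  move=> qU i x Ux.
  have qn : \forall y \near x, peval q y = cst 0 y.
    by have := oU; rewrite openE => /(_ x Ux); rewrite /interior /=; apply: filterS => y /qU.
  case: (ord2_cases i) => ->.
    by rewrite -dx_peval /dx (near_eq_derive _ qn) derive_cst.
  by rewrite -dy_peval /dy (near_eq_derive _ qn) derive_cst.
have cz c : p = mpolyC 2 c -> p = 0.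
  by move=> e; have := pU _ Ux0; rewrite e pevalC => ->; exact: mpolyC0.
have [n0|n0] := leqP (mmeasure mdeg p) 1.
  exact: cz (msize1_polyC n0).
have dz i : mderiv i p = 0.
  apply: IHn; last exact: hd.
  have : Pol R (mmeasure mdeg p).-1 p by rewrite /Pol /= prednK // ltnW.
  move/(Pol_mderiv i); rewrite /Pol /= => h; apply: (leq_ltn_trans h).
  by move: pn n0; case: (mmeasure mdeg p) => // -[|m] //= ? ?; rewrite ltnS.
exact: cz (mderiv_const (dz _) (dz _)).
Qed.

End open_zero.

(** * Square-integrable functions and weak derivatives *)

Section square_integrable.
Variable R : realType.
Implicit Types (A : set (plane R)) (f g : plane R -> R).

Lemma L2P A f : L2 A f <-> measurable_fun setT (fun x : mplane R => \1_A x * f x) /\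
  (@mu2 R).-integrable setT (fun x : mplane R => ((\1_A x * f x) ^+ 2)%:E).
Proof.
rewrite /L2 /=; set h := fun x => _; split => [hL|[mh ih]].
  have mh : measurable_fun setT (h : mplane R -> R).
    by have /sub_Lfun_mfun := hL; rewrite inE.
  split => //; have := Lfun_integrable (ler1n R 2) hL.
  apply: eq_integrable => // x _; rewrite -/(h x) powR_mulrn ?normr_ge0 //.
  by rewrite real_normK // num_real.
rewrite inE; apply/andP; split; first by rewrite inE.
rewrite inE /= /finite_norm unlock /=.
apply: poweR_lty; move/integrableP: ih => [_]; apply: le_lt_trans.
rewrite le_eqVlt; apply/orP; left; apply/eqP; apply: eq_integral => x _ /=.
rewrite powR_mulrn ?normr_ge0 //; congr EFin.
by rewrite -/(h x) real_normK ?num_real // ger0_norm // sqr_ge0.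
Qed.

End square_integrable.

Section integration_on_bounded_sets.
Variable R : realType.
Implicit Types (A : set (plane R)) (f g : plane R -> R).

Lemma aeS (P Q : plane R -> Prop) : (forall x, P x -> Q x) ->
  {ae @mu2 R, forall x, P x} -> {ae @mu2 R, forall x, Q x}.
Proof. by move=> PQ; apply: negligibleS => x /= nQ /PQ. Qed.

Lemma aeI (P Q : plane R -> Prop) : {ae @mu2 R, forall x, P x} ->
  {ae @mu2 R, forall x, Q x} -> {ae @mu2 R, forall x, P x /\ Q x}.
Proof.
move=> hP hQ; apply: negligibleS (negligibleU hP hQ) => x /= /not_andP[h|h];
  by [left|right].
Qed.

Lemma ae_finite (I : finType) (P : I -> plane R -> Prop) :
  (forall i, {ae @mu2 R, forall x, P i x}) -> {ae @mu2 R, forall x, forall i, P i x}.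
Proof.
move=> hP; suff h (s : seq I) : {ae @mu2 R, forall x, forall i, i \in s -> P i x}.
  by apply: aeS (h (enum I)) => x hx i; apply: hx; rewrite mem_enum.
elim: s => [|i s IHs]; first by apply: aeW => x i.
apply: aeS (aeI (hP i) IHs) => x [hi hs] j.
by rewrite inE => /orP[/eqP ->|/hs].
Qed.

Lemma ae_eq_Rintegral A f g : meas A ->
  measurable_fun A (f : mplane R -> R) -> measurable_fun A (g : mplane R -> R) ->
  ae_on A f g -> \int[@mu2 R]_(x in A) f x = \int[@mu2 R]_(x in A) g x.
Proof.
move=> mA mf mg fg; rewrite /Rintegral; congr fine.
apply: ae_eq_integral => //; [exact/measurable_EFinP|exact/measurable_EFinP|].
by apply: aeS fg => x h /h /= ->.
Qed.

Lemma measurable_indicM A f : meas A -> measurable_fun A (f : mplane R -> R) ->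
  measurable_fun setT (fun x : mplane R => \1_A x * f x).
Proof.
move=> mA mf.
have -> : (fun x : mplane R => \1_A x * f x) = f \_ A.
  apply/funext => x; rewrite /patch indicE; case: ifP => _; first by rewrite mul1r.
  by rewrite mul0r.
by apply/(measurable_restrictT _ _).1.
Qed.

Lemma L2_measurable A f : meas A -> L2 A f -> measurable_fun A (f : mplane R -> R).
Proof.
move=> mA /L2P[mf _].
apply: (@eq_measurable_fun _ _ _ _ _ (fun x : mplane R => \1_A x * f x)).
  by move=> x xA; rewrite indicE xA mul1r.
exact: measurable_funTS.
Qed.

Lemma Rintegral_indic A f : \int[@mu2 R]_(x in A) f x = \int[@mu2 R]_x (\1_A x * f x).
Proof.
rewrite Rintegral_mkcond; apply: eq_Rintegral => x _.
by rewrite /patch indicE; case: ifP => _; rewrite ?mul1r ?mul0r.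
Qed.

Lemma L2_bounded A f : meas A -> bounded2 A ->
  measurable_fun A (f : mplane R -> R) -> (exists C, forall x, A x -> `|f x| <= C) -> L2 A f.
Proof.
move=> mA bA mf [C hC]; apply/L2P; split; first exact: measurable_indicM.
have -> : (fun x : mplane R => ((\1_A x * f x) ^+ 2)%:E) = ((EFin \o (fun x => f x ^+ 2)) \_ A).
  apply/funext => x; rewrite /patch indicE /=; case: ifP => _; first by rewrite mul1r.
  by rewrite mul0r expr0n.
apply/(integrable_mkcond _ mA).1.
apply: integrable_bounded => //; first exact: measurable_funX.
exists (C ^+ 2) => x Ax; rewrite normrX ler_sqr ?nnegrE //; first exact: hC.
exact: le_trans (hC x Ax).
Qed.

Lemma L2_ae A f g : meas A -> L2 A f -> measurable_fun A (g : mplane R -> R) ->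
  ae_on A g f -> L2 A g.
Proof.
move=> mA /L2P[mf jf] mg gf; apply/L2P; split; first exact: measurable_indicM.
have mg2 := measurable_funX 2 (measurable_indicM mA mg).
have mf2 := measurable_funX 2 mf.
apply/integrableP; split; first exact/measurable_EFinP.
have [_] := integrableP _ _ _ jf; apply: le_lt_trans.
rewrite le_eqVlt; apply/orP; left; apply/eqP.
apply: ge0_ae_eq_integral => //.
- by apply/measurable_EFinP; exact: measurableT_comp.
- by apply/measurable_EFinP; exact: measurableT_comp.
- apply: aeS gf => x h _ /=; rewrite indicE.
  by case: (asboolP (A x)) => // Ax; [rewrite (h Ax)|rewrite memNset // !mul0r].
Qed.

Lemma integrable_indicM A f : meas A ->
  (@mu2 R).-integrable A (EFin \o f) <->
  (@mu2 R).-integrable setT (fun x : mplane R => (\1_A x * f x)%:E).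
Proof.
move=> mA.
have -> : (fun x : mplane R => (\1_A x * f x)%:E) = ((EFin \o f) \_ A).
  apply/funext => x; rewrite /patch indicE /=; case: ifP => _; first by rewrite mul1r.
  by rewrite mul0r.
exact: (integrable_mkcond _ mA).
Qed.

(** [phi] is bounded on [A], and [|f|] is at most [1 + f ^+ 2], which is integrable since [A] has
    finite measure. *)
Lemma L2_mul_integrable A f phi : meas A -> bounded2 A -> L2 A f -> continuous phi ->
  (@mu2 R).-integrable A (EFin \o (fun x => f x * phi x)).
Proof.
move=> mA bA fL cphi; have mf := L2_measurable mA fL.
have [C C0 hC] := continuous_bound cphi bA.
have /L2P[_ if2] := fL.
have i2 : (@mu2 R).-integrable A (EFin \o (fun x => C * (1 + f x ^+ 2))).
  have i1 : (@mu2 R).-integrable A (EFin \o (fun x => f x ^+ 2)).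
    apply/(integrable_indicM _ mA); apply: eq_integrable if2 => // x _.
    by rewrite indicE; case: (x \in A); rewrite ?mul1r // !mul0r expr0n.
  have ic : (@mu2 R).-integrable A (EFin \o cst 1).
    by apply: integrable_continuous => // x; exact: cvg_cst.
  have := integrableZl mA C (integrableD mA ic i1).
  by apply: eq_integrable => // x _ /=.
apply: le_integrable i2 => //.
  apply/measurable_EFinP; apply: measurable_funM => //.
  by apply: measurable_funTS; exact: continuous_measurable2.
move=> x Ax /=; rewrite lee_fin normrM mulrC.
rewrite [X in _ <= X]ger0_norm; last by rewrite mulr_ge0 // addr_ge0 // sqr_ge0.
apply: ler_pM => //; first exact: hC.
rewrite -(@real_normK _ (f x)) ?num_real //.
by have := sqr_ge0 (`|f x| - 1); nra.
Qed.

Lemma Rintegral_sum A (I : Type) (r : seq I) (h : I -> plane R -> R) : meas A ->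
  (forall i, (@mu2 R).-integrable A (EFin \o h i)) ->
  \int[@mu2 R]_(x in A) (\sum_(i <- r) h i x) = \sum_(i <- r) \int[@mu2 R]_(x in A) h i x.
Proof.
move=> mA hi.
have is_ s : (@mu2 R).-integrable A (EFin \o (fun x => \sum_(i <- s) h i x)).
  elim: s => [|i s IHs].
    apply: (@eq_integrable _ _ _ _ _ mA (cst 0%E)); last exact: integrable0.
    by move=> x _ /=; rewrite big_nil.
  have := integrableD mA (hi i) IHs; apply: eq_integrable => // x _ /=.
  by rewrite big_cons.
elim: r => [|i r IHr].
  rewrite big_nil -(@Rintegral_set0 _ _ _ (@mu2 R) (cst 0)).
  by under eq_Rintegral do rewrite big_nil; rewrite !Rintegral_cst ?measurable0 // mul0r mul0r.
rewrite big_cons -IHr -RintegralD //.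
by apply: eq_Rintegral => x _; rewrite big_cons.
Qed.

End integration_on_bounded_sets.

(** * Piecewise polynomial functions on Omega *)

Section piecewise.
Variables (R : realType) (Th : triangulation R).
Implicit Types (x : plane R) (T : 'I_(ntri Th)) (s : 'I_(ntri Th) -> poly2 R).

Lemma open_Omega : open (Omega Th). Proof. exact: open_interior. Qed.

Lemma meas_Omega : @measurable _ (mplane R) (Omega Th).
Proof. by have := open_measurable2 open_Omega. Qed.

Lemma bounded_Omega : bounded2 (Omega Th).
Proof.
have /choice[M hM] : forall T, exists M, tri T `<=` box M by move=> T; exact: hull3_bounded.
exists (\sum_T `|M T|) => x /interior_subset[T _ xT]; have /boxP[x1 x2] := hM T x xT.
have h : M T <= \sum_T `|M T|.
  by rewrite (bigD1 T) //= (le_trans (ler_norm _)) // lerDl sumr_ge0.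
by apply/boxP; split; exact: le_trans h.
Qed.

Lemma open_itri T : open (interior (tri T)). Proof. exact: open_interior. Qed.

Lemma meas_itri T : @measurable _ (mplane R) (interior (tri T)).
Proof. by have := open_measurable2 (@open_itri T). Qed.

Lemma meas_tri T : @measurable _ (mplane R) (tri T).
Proof. by apply: closed_measurable2; apply: closed_hull3; exact: vtx_area. Qed.

Lemma itri_neq0 T : interior (tri T) !=set0.
Proof.
exists (\sum_k 3^-1 *: vtx T k); rewrite /tri interior_hull3 /=; last exact: vtx_area.
move=> k; rewrite (@bary_baryc _ _ (fun=> 3^-1)) ?invr_gt0 ?ltr0n //; first exact: vtx_area.
by rewrite sum3; field.
Qed.

Lemma pw_in s T x : interior (tri T) x -> pw s x = peval (s T) x.
Proof.
move=> xT; rewrite /pw (bigD1 T) //= indicE mem_set // mul1r big1 ?addr0 // => T' ne.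
rewrite indicE memNset ?mul0r // => xT'; exact: interior_disjoint ne xT' xT.
Qed.

Lemma measurable_pw s : measurable_fun setT (pw s : mplane R -> R).
Proof.
rewrite /pw; apply: measurable_sum => T; apply: measurable_funM.
  by apply: measurable_indic; exact: meas_itri.
exact: continuous_measurable2 (@continuous_peval R (s T)).
Qed.

Lemma bounded_pw s : exists C, forall x, `|pw s x| <= C.
Proof.
have /choice[C hC] : forall T, exists C, 0 <= C /\ forall x, tri T x -> `|peval (s T) x| <= C.
  move=> T; have [C C0 hC] := continuous_bound (@continuous_peval R (s T)) (hull3_bounded (vtx T)).
  by exists C.
exists (\sum_T C T) => x; rewrite /pw; apply: (le_trans (ler_norm_sum _ _ _)).
apply: ler_sum => T _; rewrite normrM indicE; case: (asboolP (interior (tri T) x)) => xT.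
  by rewrite mem_set // normr1 mul1r; apply: (hC T).2; exact: interior_subset.
by rewrite memNset // normr0 mul0r; exact: (hC T).1.
Qed.

Lemma L2_pw s : L2 (Omega Th) (pw s).
Proof.
apply: L2_bounded; [exact: meas_Omega|exact: bounded_Omega| |].
  by apply: measurable_funTS; exact: measurable_pw.
by have [C hC] := bounded_pw s; exists C => x _.
Qed.

Lemma ae_interior : {ae @mu2 R, forall x, forall T, tri T x -> interior (tri T) x}.
Proof.
apply: ae_finite => T.
apply: negligibleS (null_boundary (vtx_area T)) => x /=.
by move=> /not_implyP[xT xi]; split.
Qed.

(** Boundaries of triangles are null sets, so the open pieces of Omega may be exchanged for the
    closed triangles to which Green's formula applies. *)
Lemma Rintegral_pieces (g : 'I_(ntri Th) -> plane R -> R) : (forall T, continuous (g T)) ->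
  \int[@mu2 R]_(x in Omega Th) (\sum_T \1_(interior (tri T)) x * g T x) =
  \sum_T \int[@mu2 R]_(x in tri T) g T x.
Proof.
move=> cg.
have mg T D : measurable_fun D (g T : mplane R -> R).
  by apply: measurable_funTS; exact: continuous_measurable2.
have bO := bounded_Omega; have mO := meas_Omega.
have mig T D : measurable_fun D ((fun x => \1_(interior (tri T)) x * g T x) : mplane R -> R).
  apply: measurable_funTS; have := measurable_indicM (@meas_itri T) (mg T (interior (tri T))).
  by [].
rewrite Rintegral_sum //; last first.
  move=> T; apply: integrable_bounded; [exact: mO|exact: bO|exact: mig|].
  have [C C0 hC] := continuous_bound (cg T) bO; exists C => x Ox.
  by rewrite normrM indicE; case: (_ \in _); rewrite ?normr1 ?mul1r ?normr0 ?mul0r //; exact: hC.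
apply: eq_bigr => T _.
transitivity (\int[@mu2 R]_(x in tri T) (\1_(interior (tri T)) x * g T x)).
  rewrite Rintegral_indic [RHS]Rintegral_indic; apply: eq_Rintegral => x _.
  rewrite !indicE; case: (asboolP (interior (tri T) x)) => xT; last first.
    by rewrite (memNset xT) !mul0r !mulr0.
  have xO : Omega Th x by apply: interior_Omega xT.
  by rewrite (mem_set xT) (mem_set (interior_subset xT)) (mem_set xO).
apply: ae_eq_Rintegral; [exact: meas_tri|exact: mig|exact: mg|].
apply: aeS ae_interior => x h xT; rewrite indicE mem_set ?mul1r //; exact: h.
Qed.

End piecewise.

(** * Green's formula over the triangulation *)

Section global_green.
Variables (R : realType) (Th : triangulation R) (E : interior_edges Th).
Implicit Types (x a b : plane R) (T : 'I_(ntri Th)) (k : 'I_3) (e : 'I_(nedge E)).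
Implicit Types (v : 'I_(ntri Th) -> poly2 R * poly2 R) (phi : plane R -> R).
Local Notation leb := (@lebesgue_measure R).

Definition ejump e v : {poly R} :=
  lpoly (ea e) (eb e) (ncomp (enormal e) (v (Tplus e))) -
  lpoly (ea e) (eb e) (ncomp (enormal e) (v (Tminus e))).

(* On which side of the oriented edge the triangle [Tplus e] lies; relates the
   outward normals of Green's formula to [enormal]. *)
Definition eside e : R :=
  Num.sg (cross (eb e - ea e) (vtx (Tplus e) (ek e true) - ea e)).

Lemma elen_neq0 e : elen e != 0.
Proof.
rewrite /elen /enorm; have := edge_neq_ab e; rewrite eq_sym -subr_eq0.
case: (eb e - ea e) => s t st; rewrite sqrtr_eq0 -ltNge /=.
have [s0|s0] := eqVneq s 0; last by rewrite ltr_pwDl ?sqr_ge0 // exprn_even_gt0.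
have [t0|t0] := eqVneq t 0; last by rewrite ltr_wpDl ?sqr_ge0 // exprn_even_gt0.
by move: st; rewrite s0 t0 eqxx.
Qed.

(** The sign of the area makes this the outward flux, whichever way the vertices of [T] are
    numbered. *)
Definition tflux T k (F1 F2 : plane R -> R) : R :=
  Num.sg (area (vtx T)) * eflux (vtx T (k + 1)) (vtx T (k + (1 + 1))) F1 F2.

(** The sign of the area and the orientation of [(a, b)] combine into the side of the line on which
    the third vertex lies; this sign is opposite for the two triangles of an interior edge. *)
Lemma tflux_edge T k a b F1 F2 : is_edge (vtx T) k a b -> continuous F1 -> continuous F2 ->
  tflux T k F1 F2 = Num.sg (cross (b - a) (vtx T k - a)) * eflux a b F1 F2.
Proof.
move=> h c1 c2; have T0 := vtx_area T.
have [s [e1 e2 e3]] := is_edge_sign T0 h; rewrite e3 bary_vtx // eqxx mulr1.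
rewrite sgrM /tflux e1 e2.
case: s {e1 e2 e3} => /=; last by rewrite expr0 sgr1 mul1r.
by rewrite expr1 sgrN1 mulN1r eflux_rev // mulrN mulNr.
Qed.

(** Incidences on interior edges are indexed injectively by the pairs [(e, s)], and all others
    contribute 0. *)
Lemma ord_pair_imset (S : 'I_(ntri Th) * 'I_3 -> R) :
  (forall T k, (forall (e : 'I_(nedge E)) s, (T, k) <> (eT e s, ek e s)) -> S (T, k) = 0) ->
  \sum_T \sum_k S (T, k) =
  \sum_(e < nedge E) (S (eT e true, ek e true) + S (eT e false, ek e false)).
Proof.
move=> S0; rewrite pair_bigA /=.
pose h (y : 'I_(nedge E) * bool) := (eT y.1 y.2, ek y.1 y.2).
transitivity (\sum_(x in imset h (mem predT)) S x).
  rewrite [RHS]big_mkcond /=; apply: eq_bigr => -[T k] _ /=.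
  case: ifPn => // /imsetP hn; apply: S0 => e s es.
  by apply: hn; exists (e, s).
rewrite big_imset /=; last by move=> y z _ _; exact: edge_pair_inj.
transitivity (\sum_(e < nedge E) \sum_(s : bool) S (eT e s, ek e s)).
  by rewrite pair_bigA.
by apply: eq_bigr => e _; rewrite big_bool.
Qed.

Lemma Rint01_zero (f : R -> R) : continuous f -> (forall t, 0 < t < 1 -> f t = 0) ->
  \int[leb]_(t in `[0, 1]) f t = 0.
Proof.
move=> cf f0; have I01 := cont_integrable 0 1 cf.
have s1 : (`]0, 1]%classic : set R) `<=` `[0, 1]%classic.
  by move=> t /=; rewrite !in_itv /= => /andP[/ltW -> ->].
have s2 : (`]0, 1[%classic : set R) `<=` `[0, 1]%classic.
  by move=> t /=; rewrite !in_itv /= => /andP[/ltW -> /ltW ->].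
rewrite -Rintegral_itv_obnd_cbnd; last first.
  by apply: integrableS I01 => //; exact: measurable_itv.
rewrite -Rintegral_itv_bndo_bndc; last first.
  by apply: integrableS I01 => //; exact: measurable_itv.
rewrite (@eq_Rintegral _ _ _ _ _ (cst 0)) ?Rintegral_cst ?mul0r //.
by move=> t; rewrite inE /= in_itv /= => t01; rewrite f0.
Qed.

Lemma continuous_mul (f g : plane R -> R) : continuous f -> continuous g ->
  continuous (fun x => f x * g x).
Proof. by move=> cf cg x; exact: (cvgM (cf x) (cg x)). Qed.

Lemma eside_minus e :
  Num.sg (cross (eb e - ea e) (vtx (Tminus e) (ek e false) - ea e)) = - eside e.
Proof.
have := opposite_sides (edge_neq e) (ekP e true) (ekP e false).
rewrite /eside /=; set c := cross _ _; set c' := cross _ _ => cc.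
have [c0|c0|c0] := ltgtP c 0.
- have c0' : 0 < c' by rewrite nmulr_rlt0 in cc.
  by rewrite (ltr0_sg c0) (gtr0_sg c0') opprK.
- have c0' : c' < 0 by rewrite pmulr_rlt0 in cc.
  by rewrite ltr0_sg // gtr0_sg.
- by rewrite c0 mul0r ltxx in cc.
Qed.

Lemma eside_neq0 e : eside e != 0.
Proof.
rewrite /eside sgr_eq0; apply: is_edge_cross (ekP e true); exact: vtx_area.
Qed.

Lemma ejumpE e v t : (ejump e v).[t] =
  (enormal e).1 * (peval (v (Tplus e)).1 (epoint e t) - peval (v (Tminus e)).1 (epoint e t)) +
  (enormal e).2 * (peval (v (Tplus e)).2 (epoint e t) - peval (v (Tminus e)).2 (epoint e t)).
Proof.
by rewrite /ejump !lpoly_ncomp hornerD hornerN !hornerD !hornerZ !lpolyE /epoint; ring.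
Qed.

Lemma continuous_ejump_phi e v phi : continuous phi ->
  continuous (fun t : R => (ejump e v).[t] * phi (epoint e t)).
Proof.
move=> cphi t.
have h1 : {for t, continuous (horner (ejump e v))} by exact: continuous_horner.
have h2 : (fun t : R => phi (epoint e t)) @ t --> phi (epoint e t).
  apply: (@cvg_comp _ _ _ (epoint e) phi _ (nbhs (epoint e t))); last exact: cphi.
  exact: continuous_line.
exact: (cvgM h1 h2).
Qed.

Lemma dx_peval_mul (p : poly2 R) phi x : Ck 1 phi ->
  dx (fun y => peval p y * phi y) x = peval p x * dx phi x + phi x * peval (mderiv ord0 p) x.
Proof.
move=> [_ px _ _ _].
have hp y : derivable (peval p) y ((1, 0) : plane R).
  by have [h _] := is_derive_peval p y; case: h.
have h := congr1 (fun f => f x) (dx_mul hp px).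
rewrite dx_peval in h; exact: h.
Qed.

Lemma dy_peval_mul (p : poly2 R) phi x : Ck 1 phi ->
  dy (fun y => peval p y * phi y) x = peval p x * dy phi x + phi x * peval (mderiv ord_max p) x.
Proof.
move=> [_ _ py _ _].
have hp y : derivable (peval p) y ((0, 1) : plane R).
  by have [_ h] := is_derive_peval p y; case: h.
have h := congr1 (fun f => f x) (dy_mul hp py).
rewrite dy_peval in h; exact: h.
Qed.

Lemma green_global v phi : Ck 1 phi -> (forall x, ~ Omega Th x -> phi x = 0) ->
  \int[@mu2 R]_(x in Omega Th)
    (pw (fun T => (v T).1) x * dx phi x + pw (fun T => (v T).2) x * dy phi x) +
  \int[@mu2 R]_(x in Omega Th) (pw (divbr v) x * phi x) =
  - \sum_e eside e * elen e *
      \int[leb]_(t in `[0, 1]) ((ejump e v).[t] * phi (epoint e t)).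
Proof.
move=> hphi phi0; have [cphi cphix cphiy] := Ck1_continuous hphi.
have [_ px py _ _] := hphi.
pose g1 T x := peval (v T).1 x * dx phi x + peval (v T).2 x * dy phi x.
pose g2 T x := peval (divbr v T) x * phi x.
have cp (p : poly2 R) := @continuous_peval R p.
have cg1 T : continuous (g1 T).
  move=> x; exact: (cvgD (cvgM (cp _ x) (cphix x)) (cvgM (cp _ x) (cphiy x))).
have cg2 T : continuous (g2 T) by move=> x; exact: (cvgM (cp _ x) (cphi x)).
have -> : \int[@mu2 R]_(x in Omega Th)
    (pw (fun T => (v T).1) x * dx phi x + pw (fun T => (v T).2) x * dy phi x) =
    \sum_T \int[@mu2 R]_(x in tri T) g1 T x.
  rewrite -(Rintegral_pieces cg1); apply: eq_Rintegral => x _.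
  rewrite /pw !mulr_suml -big_split /=; apply: eq_bigr => T _.
  by rewrite /g1 mulrDr !mulrA.
have -> : \int[@mu2 R]_(x in Omega Th) (pw (divbr v) x * phi x) =
    \sum_T \int[@mu2 R]_(x in tri T) g2 T x.
  rewrite -(Rintegral_pieces cg2); apply: eq_Rintegral => x _.
  by rewrite /pw !mulr_suml; apply: eq_bigr => T _; rewrite /g2 mulrA.
rewrite -big_split /=.
pose F1 T x := peval (v T).1 x * phi x.
pose F2 T x := peval (v T).2 x * phi x.
have ck (p : poly2 R) : Ck 1 (fun x => peval p x * phi x) := Ck_mul (Ck_peval 1 p) hphi.
have cF (p : poly2 R) : continuous (fun x => peval p x * phi x) := continuous_mul (cp p) cphi.
transitivity (\sum_T \sum_k tflux T k (F1 T) (F2 T)).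
  apply: eq_bigr => T _; rewrite -mulr_sumr -(green_triangle (vtx_area T) (ck _) (ck _)).
  have bT := hull3_bounded (vtx T); have mT := meas_tri T.
  rewrite -RintegralD //; try exact: integrable_continuous.
  apply: eq_Rintegral => x _.
  rewrite (dx_peval_mul (v T).1 x hphi) (dy_peval_mul (v T).2 x hphi) /g1 /g2 /divbr pevalD.
  by ring.
(* A boundary edge has no relatively interior point in Omega, so [phi] vanishes along it; its
   endpoints do not matter for the integral. *)
rewrite (ord_pair_imset (S := fun y => tflux y.1 y.2 (F1 y.1) (F2 y.1))) /=; last first.
  move=> T k hTk; rewrite /tflux; set I := eflux _ _ _ _.
  have -> : I = 0; last by rewrite mulr0.
  apply: Rint01_zero; first exact: continuous_eflux (cF _) (cF _).
  move=> t t01.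
  have h : is_edge (vtx T) k (vtx T (k + 1)) (vtx T (k + (1 + 1))) by left.
  have oe := open_edge_param (vtx_area T) h t01.
  have p0 : phi (vtx T (k + 1) + t *: (vtx T (k + (1 + 1)) - vtx T (k + 1))) = 0.
    apply: phi0 => xO; have [e [s [eT0 ek0]]] := edge_onto E oe xO.
    by apply: (hTk e s); rewrite {1}eT0 ek0.
  by rewrite /F1 /F2 p0 !mulr0 subrr.
rewrite -sumrN; apply: eq_bigr => e _.
have h1 := tflux_edge (ekP e true) (cF (v (Tplus e)).1) (cF (v (Tplus e)).2).
have h2 := tflux_edge (ekP e false) (cF (v (Tminus e)).1) (cF (v (Tminus e)).2).
rewrite /= in h1 h2; rewrite h1 h2 eside_minus -/(eside e).
rewrite mulNr -mulrBr -mulrA -mulrN; congr (_ * _).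
have ce T := cont_integrable 0 1 (@continuous_eflux R (ea e) (eb e) _ _ (cF (v T).1) (cF (v T).2)).
have mI : measurable (`[0, 1]%classic : set (measurableTypeR R)) by exact: measurable_itv.
rewrite /eflux -(RintegralB mI (ce _) (ce _)).
have cj := cont_integrable 0 1 (@continuous_ejump_phi e v phi cphi).
rewrite -mulNr -(RintegralZl _ mI cj); apply: eq_Rintegral => t _.
(* The normal in [eflux] has length [elen e] and is opposite to [enormal], whence the factor and the
   minus sign in the formula. *)
rewrite ejumpE /F1 /F2 -/(epoint e t) /enormal /etan /rot /=.
have l0 := elen_neq0 e; case: (eb e - ea e) => s1 s2 /=; rewrite /GRing.scale /=.
by field.
Qed.

End global_green.

Section subcomplex.
Variables (R : realType) (Th : triangulation R) (E : interior_edges Th).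
Implicit Types (x a b : plane R) (T : 'I_(ntri Th)) (e : 'I_(nedge E)).
Implicit Types (u s : 'I_(ntri Th) -> poly2 R) (v : 'I_(ntri Th) -> poly2 R * poly2 R).

Lemma test_function_off (A : set (plane R)) phi : test_function A phi ->
  forall x, ~ A x -> phi x = 0.
Proof. by move=> [_ [K [_ KA hK]]] x nAx; apply: hK => /KA. Qed.

Lemma weak_div_pw v : (forall e, ejump e v = 0) ->
  weak_div (Omega Th) (pwv v) (pw (divbr v)).
Proof.
move=> j0 phi hphi; apply/eqP; rewrite -addr_eq0; apply/eqP.
have := green_global E v (hphi.1 1%N) (test_function_off hphi).
rewrite [in X in _ = X -> _]big1 ?oppr0 //.
move=> e _; rewrite (@eq_Rintegral _ _ _ _ _ (cst 0)) ?Rintegral_cst ?mul0r ?mulr0 //.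
by move=> t _; rewrite j0 horner0 mul0r.
Qed.

Lemma pw0 : pw (fun _ : 'I_(ntri Th) => 0) = cst 0.
Proof. by apply/funext => x; rewrite /pw big1 // => T _; rewrite peval0 mulr0. Qed.

(** The partial derivatives of [u] are the divergences of the fields [(u, 0)] and [(0, u)], which
    have no normal jumps when [u] has no jumps. *)
Lemma weak_grad_pw u :
  (forall e, lpoly (ea e) (eb e) (u (Tplus e)) = lpoly (ea e) (eb e) (u (Tminus e))) ->
  weak_grad (Omega Th) (pw u) (pwv (D0br u)).
Proof.
move=> hu phi hphi; split.
- have j0 e : ejump e (fun T => (u T, 0)) = 0.
    by rewrite /ejump !lpoly_ncomp /= hu subrr.
  have h := weak_div_pw j0 hphi.
  have e1 : divbr (fun T => (u T, 0)) = (fun T => (D0br u T).1).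
    by apply/funext => T; rewrite /divbr /= raddf0 addr0.
  rewrite e1 in h; rewrite /pwv /= in h; rewrite /pwv /= -h.
  by apply: eq_Rintegral => x _; rewrite pw0 /cst mul0r addr0.
- have j0 e : ejump e (fun T => (0, u T)) = 0.
    by rewrite /ejump !lpoly_ncomp /= hu subrr.
  have h := weak_div_pw j0 hphi.
  have e1 : divbr (fun T => (0, u T)) = (fun T => (D0br u T).2).
    by apply/funext => T; rewrite /divbr /= raddf0 add0r.
  rewrite e1 in h; rewrite /pwv /= in h; rewrite /pwv /= -h.
  by apply: eq_Rintegral => x _; rewrite pw0 /cst mul0r add0r.
Qed.

Lemma ae_pw_unique s T (p : poly2 R) : ae_on (interior (tri T)) (pw s) (peval p) -> s T = p.
Proof.
move=> h; apply/eqP; rewrite -subr_eq0; apply/eqP.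
apply: (peval_zero_open (open_itri (T := T)) (@itri_neq0 _ _ T)).
apply: (ae_zero_open (open_itri (T := T))); first exact: continuous_peval.
by apply: aeS h => x hx Tx; rewrite pevalB -(pw_in s Tx) (hx Tx) subrr.
Qed.

Lemma pw_inj s : ae_on (Omega Th) (pw s) (cst 0) -> s = 0.
Proof.
move=> h; apply/funext => T; apply: ae_pw_unique.
by apply: aeS h => x hx /interior_Omega /hx ->; rewrite peval0.
Qed.

Lemma tri_Omega x : Omega Th x -> exists T, tri T x.
Proof. by move=> /interior_subset [T _ h]; exists T. Qed.

Lemma pw_constf c : ae_on (Omega Th) (pw (constf Th c)) (cst c).
Proof.
apply: aeS (ae_interior Th) => x h /tri_Omega[T /h Tx].
by rewrite (pw_in _ Tx) pevalC.
Qed.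

Lemma V1_ejump d loc v : normal_deg d loc -> (forall T, loc (v T)) ->
  C1div E d v = 0 <-> forall e, ejump e v = 0.
Proof.
move=> nl hv; rewrite (C1divP E nl hv); split=> h e; have := h e.
  by move=> he; rewrite /ejump he subrr.
by move/eqP; rewrite subr_eq0 => /eqP.
Qed.

Lemma subspace_V0 d : subspace (V0 E d).
Proof.
split.
  split; first by move=> T; exact: Pol0.
  by apply/C0P => [T|e //]; exact: Pol0.
move=> a u v [hu /C0P cu] [hv /C0P cv].
have h : broken d.+1 (a *: u + v) by move=> T; exact: PolD.
split=> //; apply/C0P => // e.
have E1 T : (a *: u + v) T = a *: u T + v T by [].
by rewrite !E1 !lpolyD !lpolyZ cu // cv.
Qed.

Lemma subspace_V1div d : subspace (V1div E d).
Proof.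
have nd := @VPol_normal_deg R d.
split.
  have h T : VPol R d ((0 : 'I_(ntri Th) -> poly2 R * poly2 R) T) by split; exact: Pol0.
  by split=> //; apply/(C1divP E nd h).
move=> a u v [hu cu] [hv cv].
have h T : VPol R d ((a *: u + v) T).
  by have [h1 h2] := hu T; have [h3 h4] := hv T; split; exact: PolD.
split=> //; apply/(C1divP E nd h) => e.
have cu' := (C1divP E nd hu).1 cu e; have cv' := (C1divP E nd hv).1 cv e.
have E1 T : (a *: u + v) T = a *: u T + v T by [].
have E2 n (p q : poly2 R * poly2 R) : ncomp n (a *: p + q) = a *: ncomp n p + ncomp n q.
  rewrite /ncomp /= !scalerDr !scalerA [n.1 * a]mulrC [n.2 * a]mulrC.
  by rewrite -!addrA; congr (_ + _); rewrite addrCA.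
by rewrite !E1 !E2 lpolyD (lpolyD _ _ (a *: ncomp _ (u (Tminus e)))) 2!lpolyZ cu' cv'.
Qed.

Lemma subspace_broken m : subspace (@broken R Th m).
Proof. by split=> [T|a u v hu hv T]; [exact: Pol0|exact: PolD]. Qed.

Lemma V0_constf d c : V0 E d (constf Th c).
Proof.
have h : broken d.+1 (constf Th c) by move=> T; exact: PolC.
by split=> //; apply/C0P.
Qed.

Lemma V0_V1div d u : V0 E d u -> V1div E d (rotf (D0br u)).
Proof.
by move=> [hu cu]; split; [exact: broken_grad|rewrite C1div_rotgrad // cu mulmx0].
Qed.

Lemma V1div_V2 d v : V1div E d v -> V2 Th d (divbr v).
Proof.
move=> [hv _] T; have [h1 h2] := hv T.
by rewrite -[divbr v T]addrC -[X in X + _]scale1r; apply: PolD; exact: Pol_mderiv.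
Qed.

Lemma rotgrad_constf c : rotf (D0br (constf Th c)) = 0.
Proof. by apply/funext => T; rewrite /rotf /D0br /rot /constf /= !mderivC oppr0. Qed.

Lemma div_rotgrad u : divbr (rotf (D0br u)) = 0.
Proof.
by apply/funext => T; rewrite /divbr /rotf /D0br /rot /= raddfN /= mderiv_comm addNr.
Qed.

Lemma fe_subcomplex_proof d : fe_subcomplex E d.
Proof.
split.
- by split; [exact: subspace_V0|exact: subspace_V1div|exact: subspace_broken].
- split=> [u _|v _|w _]; [exact: pw_inj| |exact: pw_inj].
  move=> h; apply/funext => T.
  have h1 : (fun T => (v T).1) = 0 by apply: pw_inj; apply: aeS h => x hx /hx [].
  have h2 : (fun T => (v T).2) = 0 by apply: pw_inj; apply: aeS h => x hx /hx [].
  rewrite [v T]surjective_pairing.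
  by have /= -> := congr1 (fun f => f T) h1; have /= -> := congr1 (fun f => f T) h2.
- by split; [exact: V0_constf|exact: V0_V1div|exact: V1div_V2].
- by split=> *; [exact: rotgrad_constf|exact: div_rotgrad].
- split.
  + exact: pw_constf.
  + move=> u [hu /C0P cu]; have wg := weak_grad_pw (cu hu).
    split=> //.
      split; first exact: L2_pw.
      by exists (pwv (D0br u)) => //; split; exact: L2_pw.
    apply/funext => x; rewrite /pwv /rotf /rot /=; congr pair.
    rewrite /pw -sumrN; apply: eq_bigr => T _.
    by rewrite pevalN mulrN.
  + move=> v [hv cv]; have wd : weak_div (Omega Th) (pwv v) (pw (divbr v)).
      by apply: weak_div_pw; apply/(V1_ejump (@VPol_normal_deg R d) hv).
    split=> //; split; first by split; exact: L2_pw.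
    by exists (pw (divbr v)) => //; exact: L2_pw.
  + by move=> w _; exact: L2_pw.
Qed.

End subcomplex.

(** * Fields with a weak divergence have no normal jumps *)

Section bump.
Variable R : realType.
Implicit Types (x a b : plane R).
Local Notation leb := (@lebesgue_measure R).

Lemma Rint01_gt0 (f : R -> R) t0 : continuous f -> (forall t, 0 <= f t) ->
  0 < t0 < 1 -> 0 < f t0 -> 0 < \int[leb]_(t in `[0, 1]) f t.
Proof.
move=> cf f0 /andP[t00 t01] ft0.
have nf : \forall t \near t0, 0 < t < 1 /\ f t0 / 2 < f t.
  near=> t; split.
    apply/andP; split.
    - near: t; exact: lt_nbhsr.
    - near: t; exact: lt_nbhsl.
  near: t.
  apply: (cf t0 [set y : R | f t0 / 2 < y]).
  by apply: lt_nbhsr; rewrite ltr_pdivrMr // ltr_pMr // ltr1n.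
have [r /= r0 hr] := nf.
pose s1 := t0 - r / 2; pose s2 := t0 + r / 2.
have hs t : s1 <= t <= s2 -> 0 < t < 1 /\ f t0 / 2 < f t.
  move=> ht; apply: hr => /=; rewrite ltr_norml; move: ht; rewrite /s1 /s2.
  by move=> /andP[? ?]; apply/andP; split; lra.
have s12 : s1 < s2 by rewrite /s1 /s2; lra.
have [/andP[s10 _] _] : 0 < s1 < 1 /\ f t0 / 2 < f s1 by apply: hs; rewrite lexx ltW.
have [/andP[_ s21] _] : 0 < s2 < 1 /\ f t0 / 2 < f s2 by apply: hs; rewrite lexx andbT ltW.
have I01 := cont_integrable 0 1 cf; have Is := cont_integrable s1 s2 cf.
have mI (a b : R) : measurable (`[a, b]%classic : set (measurableTypeR R)) by exact: measurable_itv.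
apply: (@lt_le_trans _ _ (f t0 / 2 * (s2 - s1))); first by rewrite mulr_gt0 ?divr_gt0 // subr_gt0.
apply: (@le_trans _ _ (\int[leb]_(t in `[s1, s2]) f t)).
  have -> : f t0 / 2 * (s2 - s1) = \int[leb]_(t in `[s1, s2]) (cst (f t0 / 2) t).
    rewrite Rintegral_cst //= lebesgue_measure_itv /= lte_fin s12.
    by rewrite EFinN -EFinD.
  apply: le_Rintegral => //; first by apply: cont_integrable => t; exact: cvg_cst.
  by move=> t /=; rewrite in_itv /= => /hs[_ /ltW].
rewrite /Rintegral; apply: fine_le.
- exact: integrable_fin_num.
- exact: integrable_fin_num.
apply: ge0_subset_integral => //.
- by have /integrableP[] := I01.
- by move=> t _; rewrite lee_fin.
- move=> t /=; rewrite !in_itv /= => /andP[h1 h2].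
  by rewrite (le_trans (ltW s10) h1) (le_trans h2 (ltW s21)).
Unshelve. all: by end_near. Qed.

Lemma poly_zero_itv (p : {poly R}) : (forall t, 0 < t < 1 -> p.[t] = 0) -> p = 0.
Proof.
move=> hp; apply/eqP; case: (eqVneq p 0) => // p0; exfalso.
have := @max_poly_roots _ p [seq (n.+2%:R)^-1 : R | n <- iota 0 (size p)] p0.
rewrite size_map size_iota ltnn => h; suff : false by []; apply: h.
  apply/allP => t /mapP[n _ ->]; rewrite /root hp //.
  by rewrite invr_gt0 ltr0n /= invf_lt1 ?ltr0n // ltr1n.
rewrite map_inj_uniq ?iota_uniq // => n m /invr_inj /eqP.
by rewrite eqr_nat => /eqP [].
Qed.

(* Coordinates of [x] in the frame with origin [a] and axes [b - a] and
   [rot (b - a)]. *)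
Definition along a b x : R :=
  ((x - a).1 * (b - a).1 + (x - a).2 * (b - a).2) / ((b - a).1 ^+ 2 + (b - a).2 ^+ 2).
Definition across a b x : R := cross (b - a) (x - a) / ((b - a).1 ^+ 2 + (b - a).2 ^+ 2).

Lemma sqdist_neq0 a b : a != b -> (b - a).1 ^+ 2 + (b - a).2 ^+ 2 != 0.
Proof.
rewrite eq_sym -subr_eq0; case: (b - a) => s t /=; apply: contra.
rewrite paddr_eq0 ?sqr_ge0 // !sqrf_eq0 => /andP[/eqP -> /eqP ->]; exact/eqP.
Qed.

Lemma along_acrossE a b x : a != b ->
  affmap a (b - a) (rot (b - a)) (along a b x, across a b x) = x.
Proof.
move=> /sqdist_neq0; rewrite /affmap /rot /along /across /cross /=.
case: a b x => a1 a2 [b1 b2] [x1 x2] /= h.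
by congr pair; rewrite /= /GRing.scale /=; field.
Qed.

Lemma along_across_affmap a b s t : a != b ->
  along a b (affmap a (b - a) (rot (b - a)) (s, t)) = s /\
  across a b (affmap a (b - a) (rot (b - a)) (s, t)) = t.
Proof.
move=> /sqdist_neq0; rewrite /affmap /rot /along /across /cross /=.
case: a b => a1 a2 [b1 b2] /= h.
by split; rewrite /= /GRing.scale /=; field.
Qed.

Lemma along_line a b t : a != b -> along a b (a + t *: (b - a)) = t.
Proof.
move=> /sqdist_neq0; rewrite /along; case: a b => a1 a2 [b1 b2] /= h.
by rewrite /= /GRing.scale /=; field.
Qed.

Lemma across_line a b t : a != b -> across a b (a + t *: (b - a)) = 0.
Proof.
move=> /sqdist_neq0; rewrite /across /cross; case: a b => a1 a2 [b1 b2] /= h.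
by rewrite /= /GRing.scale /=; field.
Qed.

Lemma null_line_through (p z : plane R) : p != z -> (@mu2 R).-negligible [set q | cross (z - p) (q - p) = 0].
Proof.
move=> pz; have := @null_line R (p.1 * (z - p).2 - p.2 * (z - p).1) (- (z - p).2) (z - p).1.
have -> : (- (z - p).2 != 0) || ((z - p).1 != 0).
  move: pz; apply: contraR; rewrite negb_or !negbK oppr_eq0 => /andP[/eqP h2 /eqP h1].
  by rewrite eq_sym -subr_eq0 [z - p]surjective_pairing h1 h2.
by move=> /(_ isT); apply: negligibleS => q /= <-; rewrite /cross /=; ring.
Qed.

Lemma null_across a b : a != b -> (@mu2 R).-negligible [set x | across a b x = 0].
Proof.
move=> ab; have h := sqdist_neq0 ab; apply: negligibleS (null_line_through ab) => x /= /eqP.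
by rewrite /across mulf_eq0 invr_eq0 (negbTE h) orbF => /eqP.
Qed.

Local Notation h := (@flat_seq R 0).

(* As [n] grows, the supports shrink to a piece of the line through [a] and [b]
   around parameter [t0], while the values on that line do not depend on [n]. *)
Definition bump a b (t0 r : R) (n : nat) x : R :=
  (h (r + (along a b x - t0)) * h (r - (along a b x - t0))) *
  (h (r + n.+1%:R * across a b x) * h (r - n.+1%:R * across a b x)).

Lemma Ck_bump k a b t0 r n : Ck k (bump a b t0 r n).
Proof.
have sm := @smooth_flat_seq R.
set D := (b - a).1 ^+ 2 + (b - a).2 ^+ 2.
have ck c0 c1 c2 (f : plane R -> R) : (forall x, f x = c0 + c1 * x.1 + c2 * x.2) ->
    Ck k (fun x => h (f x)).
  by move=> /funext ->; exact: (@Ck_ridge R k _ 0 c0 c1 c2 sm).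
have al x : along a b x =
    - (a.1 * (b - a).1 + a.2 * (b - a).2) / D + (b - a).1 / D * x.1 + (b - a).2 / D * x.2.
  by rewrite /along -/D /=; ring.
have ac x : across a b x =
    (a.1 * (b - a).2 - a.2 * (b - a).1) / D - (b - a).2 / D * x.1 + (b - a).1 / D * x.2.
  by rewrite /across /cross -/D /=; ring.
pose A0 := - (a.1 * (b - a).1 + a.2 * (b - a).2) / D.
pose B0 := (a.1 * (b - a).2 - a.2 * (b - a).1) / D.
have c1 : Ck k (fun x => h (r + (along a b x - t0))).
  by apply: (ck (r + A0 - t0) ((b - a).1 / D) ((b - a).2 / D)
    (fun x => r + (along a b x - t0))) => x;
    rewrite al /A0; ring.
have c2 : Ck k (fun x => h (r - (along a b x - t0))).
  by apply: (ck (r - A0 + t0) (- (b - a).1 / D) (- (b - a).2 / D)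
    (fun x => r - (along a b x - t0))) => x;
    rewrite al /A0; ring.
have c3 : Ck k (fun x => h (r + n.+1%:R * across a b x)).
  apply: (ck (r + n.+1%:R * B0) (- n.+1%:R * (b - a).2 / D) (n.+1%:R * (b - a).1 / D)
    (fun x => r + n.+1%:R * across a b x)) => x.
  by rewrite ac /B0; ring.
have c4 : Ck k (fun x => h (r - n.+1%:R * across a b x)).
  apply: (ck (r - n.+1%:R * B0) (n.+1%:R * (b - a).2 / D) (- n.+1%:R * (b - a).1 / D)
    (fun x => r - n.+1%:R * across a b x)) => x.
  by rewrite ac /B0; ring.
exact: (Ck_mul (Ck_mul c1 c2) (Ck_mul c3 c4)).
Qed.

Lemma flat0_eq0 t : t <= 0 -> h t = 0.
Proof. by move=> t0; rewrite flat0 ltNge t0. Qed.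

Lemma flat0_gt0 t : 0 < t -> 0 < h t.
Proof. by move=> t0; rewrite flat0 t0 expR_gt0. Qed.

Lemma bump_le1 a b t0 r n x : 0 <= bump a b t0 r n x <= 1.
Proof.
have mul01 (s t : R) : 0 <= s <= 1 -> 0 <= t <= 1 -> 0 <= s * t <= 1.
  by move=> /andP[s0 s1] /andP[u0 u1]; rewrite mulr_ge0 //= mulr_ile1.
by rewrite /bump; apply: (mul01); apply: (mul01); exact: flat0_le1.
Qed.

Lemma bump_supp a b t0 r n x : bump a b t0 r n x != 0 ->
  `|along a b x - t0| <= r /\ `|n.+1%:R * across a b x| <= r.
Proof.
have pos t : h t != 0 -> 0 < t by apply: contraNT; rewrite -leNgt => /flat0_eq0 ->.
rewrite /bump !mulf_eq0 !negb_or => /andP[/andP[/pos h1 /pos h2] /andP[/pos h3 /pos h4]].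
by rewrite !ler_norml; split; apply/andP; split; lra.
Qed.

Lemma bump_line a b t0 r n t : a != b ->
  bump a b t0 r n (a + t *: (b - a)) = h (r + (t - t0)) * h (r - (t - t0)) * h r ^+ 2.
Proof. by move=> ab; rewrite /bump along_line // across_line // mulr0 addr0 subr0. Qed.

Lemma bump_vanish a b t0 r x : across a b x != 0 ->
  \forall n \near \oo, bump a b t0 r n x = 0.
Proof.
move=> ax; have a0 : 0 < `|across a b x| by rewrite normr_gt0.
have := @archi_boundP R (`|r| / `|across a b x|); rewrite divr_ge0 // => /(_ isT) hN.
exists (Num.bound (`|r| / `|across a b x|)) => // n /= Nn.
apply/eqP/negP => /negP /bump_supp[_].
rewrite normrM leNgt => /negP; apply.
rewrite ltr_pdivrMr // in hN.
apply: le_lt_trans (ler_norm _) (lt_le_trans hN _).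
rewrite ler_pM2r // ger0_norm ?ler0n // ler_nat.
by rewrite (leq_trans Nn).
Qed.

End bump.

(** * Testing with bumps along an edge *)

Section hdiv_fields.
Variables (R : realType) (Th : triangulation R) (E : interior_edges Th).
Implicit Types (x a b : plane R) (T : 'I_(ntri Th)) (e : 'I_(nedge E)).
Implicit Types (v : 'I_(ntri Th) -> poly2 R * poly2 R) (w : plane R -> R).
Local Notation O := (Omega Th).
Local Notation leb := (@lebesgue_measure R).
Local Notation h := (@flat_seq R 0).

Lemma closed_segment a b : closed (segment a b).
Proof.
have -> : segment a b = (fun t : R => a + t *: (b - a)) @` `[0, 1]%classic.
  apply/seteqP; split=> x [t t01].
    by move=> ->; exists t => //=; rewrite in_itv.
  by move=> <-; exists t => //; rewrite /= in_itv in t01.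
apply: compact_closed; first exact: norm_hausdorff.
apply: continuous_compact; last exact: segment_compact.
by apply: continuous_subspaceT; exact: continuous_line.
Qed.

(** Omega is open and the other edges are closed, finitely many, and do not pass through the point.
    The neighbourhood is measured in the frame of the edge, in which the supports of the bumps are
    rectangles. *)
Lemma edge_neighborhood e t0 : 0 < t0 < 1 -> exists2 r : R, 0 < r &
  forall x, `|along (ea e) (eb e) x - t0| <= r -> `|across (ea e) (eb e) x| <= r ->
    O x /\ forall e', e' != e -> ~ segment (ea e') (eb e') x.
Proof.
move=> t01; have ab := edge_neq_ab e.
pose U : set (plane R) := [set x | O x /\ forall e', e' != e -> ~ segment (ea e') (eb e') x].
have nU : \forall x \near epoint e t0, U x.
  have n1 : \forall x \near epoint e t0, O x.
    by apply: open_nbhs_nbhs; split; [exact: open_Omega|exact: epoint_Omega].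
  have n2 : \forall x \near epoint e t0, forall e', e' != e -> ~ segment (ea e') (eb e') x.
    apply: (@filter_forall _ _ (fun (e' : 'I_(nedge E)) x => e' != e -> ~ segment (ea e') (eb e') x)
      (nbhs (epoint e t0)) _) => e'.
    have [->|e'e] := eqVneq e' e; first by near=> x.
    have : open (~` segment (ea e') (eb e')) by apply: closed_openC; exact: closed_segment.
    move=> oS; have : nbhs (epoint e t0) (~` segment (ea e') (eb e')).
      by apply: open_nbhs_nbhs; split => //; exact: epoint_other.
    by apply: filterS => x.
  by near=> x; split; near: x.
pose f := affmap (ea e) (eb e - ea e) (rot (eb e - ea e)).
have f0 : f (t0, 0) = epoint e t0 by rewrite /f /affmap /= scale0r addr0.
have : \forall y \near (t0, 0 : R), U (f y).
  by apply: (@continuous_affmap R (ea e) (eb e - ea e) (rot (eb e - ea e)) (t0, 0)); rewrite -/f f0.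
case/nbhs_ballP => r /= r0 hr; exists (r / 2); first by rewrite divr_gt0.
move=> x h1 h2; have := hr (along (ea e) (eb e) x, across (ea e) (eb e) x).
rewrite /f along_acrossE //; apply; split => /=; rewrite /ball /= distrC.
  by rewrite (le_lt_trans h1) // ltr_pdivrMr // ltr_pMr // ltr1n.
by rewrite subr0 (le_lt_trans h2) // ltr_pdivrMr // ltr_pMr // ltr1n.
Unshelve. all: by end_near. Qed.

(** The compact set is the image of a rectangle in the frame of the edge; the factor [n.+1] only
    narrows the support, so one rectangle serves all [n]. *)
Lemma test_bump e t0 r n :
  (forall x, `|along (ea e) (eb e) x - t0| <= r -> `|across (ea e) (eb e) x| <= r -> O x) ->
  test_function O (bump (ea e) (eb e) t0 r n).
Proof.
move=> hr; split; first by move=> k; exact: Ck_bump.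
have ab := edge_neq_ab e.
pose f := affmap (ea e) (eb e - ea e) (rot (eb e - ea e)).
pose B : set (plane R) := `[t0 - r, t0 + r]%classic `*` `[- r, r]%classic.
have sup x : bump (ea e) (eb e) t0 r n x != 0 ->
    B (along (ea e) (eb e) x, across (ea e) (eb e) x).
  move=> /bump_supp [h1 h2]; split=> /=; rewrite in_itv /= -?ler_distl //.
  rewrite -ler_norml; apply: le_trans h2; rewrite (normrM n.+1%:R) ler_peMl //.
  by rewrite ger0_norm ?ler0n // ler1n.
exists (f @` B); split.
- apply: continuous_compact; last by apply: compact_setX; exact: segment_compact.
  by apply: continuous_subspaceT; exact: continuous_affmap.
- move=> _ [[s t] [/= h1 h2] <-]; rewrite !in_itv /= in h1 h2.
  have [al ac] := along_across_affmap s t ab.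
  by apply: hr; rewrite /f ?al ?ac ?ler_distl ?ler_norml.
- move=> x nBx; apply/eqP; apply/negP => /negP /sup hx; apply: nBx.
  by exists (along (ea e) (eb e) x, across (ea e) (eb e) x) => //; exact: along_acrossE.
Qed.

(** Dominated convergence: the bumps are at most 1 and, off the null line through the edge,
    eventually zero. *)
Lemma bump_int_cvg g e t0 r : (@mu2 R).-integrable O (EFin \o g) ->
  (\int[@mu2 R]_(x in O) (g x * bump (ea e) (eb e) t0 r n x)%:E)%E @[n --> \oo] --> 0%E.
Proof.
move=> ig; have mO := meas_Omega Th.
have mg : measurable_fun O (g : mplane R -> R) by apply/measurable_EFinP; have /integrableP[] := ig.
have := @dominated_convergence _ (mplane R) R (@mu2 R) O mO
  (fun n x => (g x * bump (ea e) (eb e) t0 r n x)%:E) (cst 0%E) (abse \o (EFin \o g)).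
rewrite integral0; case.
- move=> n; apply/measurable_EFinP; apply: measurable_funM => //.
  apply: measurable_funTS; apply: continuous_measurable2.
  exact: (@Ck_bump R 0).
- exact: measurable_cst.
- have := null_across (edge_neq_ab e); apply: negligibleS => x /= /not_implyP[Ox nc].
  apply: contrapT => ax; apply: nc.
  have axn : across (ea e) (eb e) x != 0 by apply/eqP.
  have [N _ hN] := bump_vanish t0 r axn.
  apply: cvg_near_cst; exists N => // n /hN ->; by rewrite mulr0.
- exact: integrable_abse.
- apply: aeW => x n _ /=; rewrite lee_fin normrM ler_piMr //.
  by have /andP[b0 b1] := bump_le1 (ea e) (eb e) t0 r n x; rewrite ger0_norm.
by [].
Qed.

(* Green's formula with the bumps of edge [e] equates a constant multiple of a
   weighted mean of the jump with integrals tending to 0. *)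
Lemma weak_div_jump v w : L2 O w -> weak_div O (pwv v) w -> forall e, ejump e v = 0.
Proof.
move=> wL wd e; apply/eqP; case: (eqVneq (ejump e v) 0) => // j0; exfalso.
have [t0 t01 jt0] : exists2 t0 : R, 0 < t0 < 1 & (ejump e v).[t0] != 0.
  apply: contrapT => hn; move/eqP: j0; apply; apply: poly_zero_itv => t t01.
  by apply/eqP; apply/negP => /negP ht; apply: hn; exists t.
have ab := edge_neq_ab e.
have nj : \forall t \near t0, 0 < (ejump e v).[t0] * (ejump e v).[t].
  have : {for t0, continuous (fun t => (ejump e v).[t0] * (ejump e v).[t])}.
    have h1 : {for t0, continuous (horner (ejump e v))} by exact: continuous_horner.
    exact: (cvgM (cvg_cst _) h1).
  move=> /(_ [set y : R | 0 < y]); apply; apply: lt_nbhsr.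
  by rewrite -expr2 exprn_even_gt0.
have [r1 /= r10 hr1] := nj.
have [r2 r20 hr2] := edge_neighborhood e t01.
(* Within [r] of [t0] the jump keeps the sign it has at [t0], and the supports of the bumps stay in
   Omega and off the other edges. *)
pose r := Num.min (r1 / 2) r2.
have r0 : 0 < r by rewrite lt_min divr_gt0.
have rr1 : r < r1 by rewrite gt_min ltr_pdivrMr // ltr_pMr // ltr1n.
have rr2 : r <= r2 by rewrite ge_min lexx orbT.
have hr x : `|along (ea e) (eb e) x - t0| <= r -> `|across (ea e) (eb e) x| <= r -> 
    O x /\ forall e', e' != e -> ~ segment (ea e') (eb e') x.
  by move=> h1 h2; apply: hr2; [exact: le_trans h1 rr2|exact: le_trans h2 rr2].
have tb n := @test_bump e t0 r n (fun x h1 h2 => (hr x h1 h2).1).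
pose g x := pw (divbr v) x - w x.
have mO := meas_Omega Th; have bO := bounded_Omega Th.
have dL := L2_pw (divbr v).
have ifp (f : plane R -> R) phi := @L2_mul_integrable R O f phi mO bO.
have c1 : continuous (cst 1 : plane R -> R) by move=> x; exact: cvg_cst.
have ig : (@mu2 R).-integrable O (EFin \o g).
  have := integrableB mO (ifp _ _ dL c1) (ifp _ _ wL c1).
  by apply: (@eq_integrable _ _ _ _ _ mO) => x _ /=; rewrite !mulr1.
have cb n : continuous (bump (ea e) (eb e) t0 r n) by exact: (@Ck_bump R 0).
pose F t := (ejump e v).[t] * (h (r + (t - t0)) * h (r - (t - t0)) * h r ^+ 2).
have intg n : \int[@mu2 R]_(x in O) (g x * bump (ea e) (eb e) t0 r n x) =
   - (eside e * elen e * \int[leb]_(t in `[0, 1]) F t).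
  pose phi := bump (ea e) (eb e) t0 r n.
  transitivity (\int[@mu2 R]_(x in O) (pw (divbr v) x * phi x) -
      \int[@mu2 R]_(x in O) (w x * phi x)).
    rewrite -(RintegralB mO (ifp _ _ dL (cb n)) (ifp _ _ wL (cb n))).
    by apply: eq_Rintegral => x _; rewrite /g mulrBl.
  rewrite -(wd _ (tb n)) addrC.
  rewrite (green_global E v (Ck_bump 1 _ _ _ _ _) (test_function_off (tb n))).
  rewrite (bigD1 e) //= big1 ?addr0.
    have -> : F = (fun t => (ejump e v).[t] * phi (epoint e t)).
      by apply/funext => t; rewrite /F /phi /epoint bump_line.
    by [].
  move=> e' e'e; rewrite (@eq_Rintegral _ _ _ _ _ (cst 0)) ?Rintegral_cst ?mul0r ?mulr0 //.
  move=> t; rewrite inE /= in_itv /= => t1; rewrite /cst.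
  apply/eqP; rewrite mulf_eq0; apply/orP; right; apply/eqP; apply/eqP; apply/negP => /negP hb.
  have [h1 h2] := bump_supp hb.
  have [] := hr (epoint e' t) h1.
    apply: le_trans h2; rewrite (normrM n.+1%:R) ler_peMl //.
    by rewrite ger0_norm ?ler0n // ler1n.
  by move=> _ /(_ e' e'e); apply; exists t.
pose C := \int[leb]_(t in `[0, 1]) F t.
have cF : continuous F.
  have ch (f : R -> R) : continuous f -> continuous (fun t => h (f t)).
    move=> cf t; apply: (@cvg_comp _ _ _ f h _ (nbhs (f t))); first exact: cf.
    exact: (@smooth_seq_continuous R _ 0 (@smooth_flat_seq R)). 
  have k1 : continuous (fun t : R => h (r + (t - t0))).
    by apply: ch => t; exact: (cvgD (cvg_cst _) (cvgB cvg_id (cvg_cst _))).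
  have k2 : continuous (fun t : R => h (r - (t - t0))).
    by apply: ch => t; exact: (cvgB (cvg_cst _) (cvgB cvg_id (cvg_cst _))).
  have k3 : continuous (horner (ejump e v)) by exact: continuous_horner.
  move=> t; exact: (cvgM (k3 t) (cvgM (cvgM (k1 t) (k2 t)) (cvg_cst _))).
have C0 : 0 < (ejump e v).[t0] * C.
  have mI : measurable (`[0, 1]%classic : set (measurableTypeR R)) by exact: measurable_itv.
  have iF := cont_integrable 0 1 cF.
  rewrite /C -(RintegralZl (ejump e v).[t0] mI iF).
  apply: (@Rint01_gt0 _ _ t0) => //.
  - move=> t; exact: (cvgM (cvg_cst _) (cF t)).
  - move=> t; rewrite /F mulrA.
    have [tr|tr] := ltP `|t0 - t| r1.
      apply: mulr_ge0; first by apply: ltW; exact: hr1.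
      have h0 u : 0 <= h u by have /andP[] := @flat0_le1 R u.
      by rewrite mulr_ge0 ?sqr_ge0 // mulr_ge0.
    have : r <= `|t0 - t| by rewrite (le_trans (ltW rr1)).
    rewrite ler_normr => /orP[h1|h1].
      by rewrite (@flat0_eq0 _ (r + (t - t0))) ?mul0r ?mulr0 //; lra.
    by rewrite (@flat0_eq0 _ (r - (t - t0))) ?mul0r ?mulr0 //; lra.
  - rewrite /F mulrA subrr addr0 subr0.
    have hr0 := flat0_gt0 r0.
    apply: mulr_gt0; first by rewrite -expr2 exprn_even_gt0.
    by apply: mulr_gt0; [exact: mulr_gt0|exact: exprn_gt0].
(* The integrals tending to 0 do not depend on [n], so [C] is 0, against the sign found above. *)
have := @bump_int_cvg g e t0 r ig.
have -> : (fun n => \int[@mu2 R]_(x in O) (g x * bump (ea e) (eb e) t0 r n x)%:E)%E =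
   cst ((- (eside e * elen e * C))%:E).
  apply/funext => n; rewrite /cst -(intg n) /Rintegral fineK //.
  apply: integrable_fin_num => //.
  have := integrableB mO (ifp _ _ dL (cb n)) (ifp _ _ wL (cb n)).
  by apply: (@eq_integrable _ _ _ _ _ mO) => x _ /=; rewrite /g mulrBl.
move=> /(cvg_unique (@ereal_hausdorff R)) /(_ (cvg_cst _)) /eqP.
rewrite eq_sym eqe oppr_eq0 !mulf_eq0 (negbTE (eside_neq0 e)) (negbTE (elen_neq0 e)) /= => /eqP C00.
by rewrite C00 mulr0 ltxx in C0.
Qed.

Lemma measurable_pair_fun (A : set (plane R)) (v : plane R -> plane R) :
  @measurable _ (mplane R) A ->
  measurable_fun A (v : mplane R -> mplane R) <->
  measurable_fun A (fun x : mplane R => (v x).1) /\ measurable_fun A (fun x : mplane R => (v x).2).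
Proof.
move=> mA; split.
  move=> mv; split.
    exact: (measurableT_comp (@measurable_fst _ _ (measurableTypeR R) (measurableTypeR R)) mv).
  exact: (measurableT_comp (@measurable_snd _ _ (measurableTypeR R) (measurableTypeR R)) mv).
move=> [m1 m2].
have := measurable_fun_pair (measurable_indicM mA m1) (measurable_indicM mA m2).
move=> /(measurable_funTS (D := A)); apply: eq_measurable_fun => x xA /=.
by rewrite indicE xA !mul1r; case: (v x).
Qed.

Lemma Rintegral_pwv_ae (v : plane R -> plane R) (s : 'I_(ntri Th) -> poly2 R * poly2 R) phi :
  measurable_fun O (fun x : mplane R => (v x).1) ->
  measurable_fun O (fun x : mplane R => (v x).2) -> ae_on O v (pwv s) -> Ck 1 phi ->
  \int[@mu2 R]_(x in O) ((v x).1 * dx phi x + (v x).2 * dy phi x) =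
  \int[@mu2 R]_(x in O) ((pwv s x).1 * dx phi x + (pwv s x).2 * dy phi x).
Proof.
move=> m1 m2 vs /Ck1_continuous [_ cx cy].
have mx := measurable_funTS (D := O) (continuous_measurable2 cx).
have my := measurable_funTS (D := O) (continuous_measurable2 cy).
have mp s' := measurable_funTS (D := O) (@measurable_pw R Th s').
apply: (ae_eq_Rintegral (meas_Omega Th)).
- exact: (measurable_funD (measurable_funM m1 mx) (measurable_funM m2 my)).
- exact: (measurable_funD (measurable_funM (mp _) mx) (measurable_funM (mp _) my)).
- by apply: aeS vs => x hx /hx ->.
Qed.

Lemma L2fields_Hdiv d loc : normal_deg d loc ->
  L2fields (V1 E d loc) = Hdiv_local Th loc.
Proof.
move=> nl; have mO := meas_Omega Th; have bO := bounded_Omega Th.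
apply/seteqP; split=> v.
- move=> [mv [s [sl cs] vs]]; have [m1 m2] := (measurable_pair_fun v mO).1 mv.
  have a1 : ae_on O (fun x => (v x).1) (pw (fun T => (s T).1)).
    by apply: aeS vs => x hx /hx ->.
  have a2 : ae_on O (fun x => (v x).2) (pw (fun T => (s T).2)).
    by apply: aeS vs => x hx /hx ->.
  split; last first.
    move=> T; exists (s T) => //; apply: aeS (aeI vs (ae_interior Th)) => x [hx hi] /hi Tx.
    rewrite (hx (interior_Omega Tx)) /pwv /veval.
    by rewrite (pw_in (fun T => (s T).1) Tx) (pw_in (fun T => (s T).2) Tx).
  split; first by split; [exact: L2_ae (L2_pw _) m1 a1|exact: L2_ae (L2_pw _) m2 a2].
  exists (pw (divbr s)); first exact: L2_pw.
  move=> phi hphi; rewrite -(weak_div_pw ((V1_ejump E nl sl).1 cs) hphi).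
  exact: (Rintegral_pwv_ae m1 m2 vs (hphi.1 1%N)).
- move=> [[[L1 L2'] [w wL wd]] hv].
  have [m1 m2] := (L2_measurable mO L1, L2_measurable mO L2').
  have /choice [s hs] T : exists p, loc p /\ ae_on (tri T) v (veval p).
    by have [p h1 h2] := hv T; exists p.
  have vs : ae_on O v (pwv s).
    apply: aeS (aeI (ae_finite (fun T => (hs T).2)) (ae_interior Th)) => x [h1 hi] Ox.
    have [T Tx] := tri_Omega Ox.
    rewrite (h1 T Tx) /pwv /veval.
    by rewrite (pw_in (fun T => (s T).1) (hi T Tx)) (pw_in (fun T => (s T).2) (hi T Tx)).
  split; first exact/(measurable_pair_fun v mO).
  exists s => //; split; first by move=> T; have [] := hs T.
  apply/(V1_ejump E nl (fun T => (hs T).1)); apply: (weak_div_jump wL).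
  move=> phi hphi; rewrite -(wd _ hphi).
  exact: (esym (Rintegral_pwv_ae m1 m2 vs (hphi.1 1%N))).
Qed.

End hdiv_fields.

(** * Primitives on simply connected sets *)

Section connectedness.

(** The set where [chi] takes its value at [x] is open and closed relative to [A]; outside [A] the
    function is arbitrary. *)
Lemma connected_locconst (X : topologicalType) (U : Type) (A : set X) (chi : X -> U) :
  connected A -> (forall x, A x -> \forall y \near x, A y -> chi y = chi x) ->
  forall x y, A x -> A y -> chi x = chi y.
Proof.
move=> cA loc x y Ax Ay.
pose B := [set z | A z /\ chi z = chi x].
suff BA : B = A by have [_ ->] : B y by rewrite BA.
apply: cA; first by exists x.
- exists (interior [set z | A z -> chi z = chi x]); first exact: open_interior.
  apply/seteqP; split=> z /= [Az].
    by move=> zx; split=> //; apply: filterS (loc z Az) => w h /h ->.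
  by move=> /interior_subset /(_ Az).
- exists (~` interior [set z | A z -> chi z <> chi x]).
    by apply: open_closedC; exact: open_interior.
  apply/seteqP; split=> z /= [Az].
    by move=> zx; split=> // /interior_subset /(_ Az); apply.
  move=> nz; split=> //; apply: contrapT => zx; apply: nz.
  by apply: filterS (loc z Az) => w h /h ->.
Qed.

(** Close to a point only the closed sets through that point occur, and their labels agree there;
    hence the label of a point is locally constant. *)
Lemma connected_closed_cover (X : topologicalType) (U : Type) (I : finType)
    (A : set X) (C : I -> set X) (c : I -> U) :
  connected A -> (forall i, closed (C i)) -> (forall x, A x -> exists i, C i x) ->
  (forall x i j, A x -> C i x -> C j x -> c i = c j) ->
  forall x y i j, A x -> A y -> C i x -> C j y -> c i = c j.
Proof.
move=> cA clC cov cc x y i j Ax Ay Cix Cjy.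
have [i0 Ci0] := cov x Ax.
pose chi z := c (xget i0 [set k | C k z]).
have chiE z k : A z -> C k z -> chi z = c k.
  move=> Az Ckz; apply: (cc z) => //.
  by have := @xgetPex _ i0 [set k | C k z] (ex_intro _ k Ckz).
rewrite -(chiE _ _ Ax Cix) -(chiE _ _ Ay Cjy).
apply: (connected_locconst cA) => // z Az.
have nk : \forall w \near z, forall k, C k w -> C k z.
  apply: (@filter_forall _ _ (fun (k : I) w => C k w -> C k z) (nbhs z) _) => k.
  have [Ckz|nCkz] := pselect (C k z); first by near=> w.
  have : nbhs z (~` C k) by apply: open_nbhs_nbhs; split => //; exact: closed_openC.
  by apply: filterS => w nCw /nCw.
apply: filterS nk => w hw Aw; have [k Ckw] := cov w Aw.
by rewrite (chiE _ _ Aw Ckw) (chiE _ k Az (hw _ Ckw)).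
Unshelve. all: by end_near. Qed.

End connectedness.

(* The [f i] are local primitives, on convex sets [B i] covering [O], of a common
   closed form; [global_primitive] glues them, by integration along paths. *)
Section monodromy.
Variables (R : realType) (I : Type) (O : set (plane R)) (B : I -> set (plane R))
  (f : I -> plane R -> R).
Implicit Types (x y z p q : plane R) (g : R -> plane R) (psi : R -> R) (s t : R).
Hypothesis cover : forall x, O x -> exists i, nbhs x (B i).
Hypothesis B_sub : forall i, B i `<=` O.
Hypothesis B_convex : forall i y z t, B i y -> B i z -> 0 <= t <= 1 -> B i (y + t *: (z - y)).
Hypothesis compat : forall i j y z, B i y -> B i z -> B j y -> B j z ->
  f i z - f i y = f j z - f j y.
Local Notation I01 := (`[0, 1]%classic : set R).
Local Notation Sq := (`[0, 1]%classic `*` `[0, 1]%classic : set (R * R)).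

(** The integral of the closed form from [y] to [z] when some [B i] contains both; [compat] makes it
    independent of [i], and 0 is a default value. *)
Definition increment y z : R :=
  xget 0 [set r | exists i, [/\ B i y, B i z & r = f i z - f i y]].

Lemma incrementE i y z : B i y -> B i z -> increment y z = f i z - f i y.
Proof.
move=> By Bz; rewrite /increment.
have := @xgetPex _ 0 [set r | exists i, [/\ B i y, B i z & r = f i z - f i y]].
case; first by exists (f i z - f i y), i.
by move=> j [Bjy Bjz ->]; exact: compat.
Qed.

Lemma increment0 x : O x -> increment x x = 0.
Proof.
by move=> /cover [i /nbhs_singleton Bx]; rewrite (incrementE Bx Bx) subrr.
Qed.

Lemma I01P t : I01 t <-> 0 <= t <= 1.
Proof. by rewrite /= in_itv. Qed.

Definition uniform_square (H : R * R -> plane R) (d : R) := forall p, Sq p ->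
  exists i, forall q, Sq q -> `|p.1 - q.1| < d -> `|p.2 - q.2| < d -> B i (H q).

(** Lebesgue number lemma for the cover pulled back to the square, by compactness along the radii
    [n.+1%:R^-1]. *)
Lemma uniform_square_exists (H : R * R -> plane R) : {within Sq, continuous H} ->
  (forall p, Sq p -> O (H p)) -> exists2 d, 0 < d & uniform_square H d.
Proof.
move=> /subspace_continuousP cH HO.
have cS : compact Sq by apply: compact_setX; exact: segment_compact.
have /compact_near_coveringP nc := cS.
pose P (n : nat) p := exists i, forall q, Sq q ->
  `|p.1 - q.1| < n.+1%:R^-1 -> `|p.2 - q.2| < n.+1%:R^-1 -> B i (H q).
have [N _ hN] : \forall n \near \oo, Sq `<=` P n.
  apply: nc => p0 Sp0; have [i Bi] := cover (HO _ Sp0).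
  have /nbhs_ballP [e /= e0 he] := cH p0 Sp0 _ Bi.
  have e20 : 0 < e / 2 by rewrite divr_gt0.
  exists (ball p0 (e / 2), [set n | n.+1%:R^-1 < e / 2]) => /=.
    split; first exact: nbhsx_ballx.
    exact: near_infty_natSinv_lt (PosNum e20).
  move=> [p n] /= [[h1 h2] hn]; exists i => q Sq_ h3 h4.
  have tri_ (a b c : R) : `|a - b| < e / 2 -> `|b - c| < n.+1%:R^-1 -> `|a - c| < e.
    move=> ab bc; rewrite -(subrKA b) (le_lt_trans (ler_normD _ _)) //.
    by rewrite [e]splitr ltrD // (lt_trans bc).
  by apply: he => //; split; [exact: tri_ h1 h3|exact: tri_ h2 h4].
exists N.+1%:R^-1; first by rewrite invr_gt0.
by move=> p Sp; have [i hi] := hN N (leqnn N) p Sp; exists i.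
Qed.

(* The primitive at [p] sums the increments of the local primitives along a fine
   subdivision of the segment from the origin to [p]. *)
Lemma square_primitive (H : R * R -> plane R) : {within Sq, continuous H} ->
  (forall p, Sq p -> O (H p)) -> exists Psi : R * R -> R, exists2 d, 0 < d &
  forall p q, Sq p -> Sq q -> `|p.1 - q.1| < d -> `|p.2 - q.2| < d ->
    Psi q - Psi p = increment (H p) (H q).
Proof.
move=> cH HO; have [d d0 hd] := uniform_square_exists cH HO.
have d20 : 0 < d / 2 by rewrite divr_gt0.
have [n hn] : exists n : nat, n.+1%:R^-1 < d / 2.
  have [N _ hN] := near_infty_natSinv_lt (PosNum d20).
  by exists N; apply: hN => /=.
set m := n.+1 in hn.
pose pt i p : R * R := ((i%:R / m%:R) * p.1, (i%:R / m%:R) * p.2).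
have m0 : 0 < m%:R :> R by rewrite ltr0n.
have mu0 : m%:R != 0 :> R by rewrite lt0r_neq0.
have im i : (i <= m)%N -> 0 <= (i%:R / m%:R : R) <= 1.
  by move=> im; rewrite divr_ge0 ?ler0n //= ler_pdivrMr // mul1r ler_nat.
have mul01 (a b : R) : 0 <= a <= 1 -> 0 <= b <= 1 -> 0 <= a * b <= 1.
  by move=> /andP[a0 a1] /andP[b0 b1]; rewrite mulr_ge0 //= mulr_ile1.
have Sqpt i p : (i <= m)%N -> Sq p -> Sq (pt i p).
  move=> /im hi [/I01P h1 /I01P h2]; split; apply/I01P; exact: mul01.
exists (fun p => \sum_(0 <= i < m) increment (H (pt i p)) (H (pt i.+1 p))), (d / 2) => //.
move=> p q Sp Sq_ h1 h2; rewrite -sumrB.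
(* The images of the four points [pt i p], [pt i.+1 p], [pt i q], [pt i.+1 q] lie in one [B j], so
   the increments around this quadrilateral cancel and the difference of the two sums telescopes. *)
transitivity (\sum_(0 <= i < m) (increment (H (pt i.+1 p)) (H (pt i.+1 q)) -
    increment (H (pt i p)) (H (pt i q)))); last first.
  rewrite telescope_sumr // /pt divff // !mul1r !mul0r -!surjective_pairing.
  rewrite (@increment0 (H (0, 0))) ?subr0 //.
  by apply: HO; split; apply/I01P; rewrite lexx ler01.
apply: eq_big_nat => i /andP[_ iM].
have Si p' : Sq p' -> Sq (pt i p') by apply: Sqpt; exact: ltnW.
have SSi p' : Sq p' -> Sq (pt i.+1 p') by exact: Sqpt.
have [j hj] := hd (pt i p) (Si p Sp).
have small (a b : R) : 0 <= b <= 1 -> `|a - b| < d / 2 ->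
   `|i%:R / m%:R * a - i%:R / m%:R * b| < d /\ `|i%:R / m%:R * a - i.+1%:R / m%:R * b| < d.
  move=> b01 ab.
  have s1 : `|i%:R / m%:R * a - i%:R / m%:R * b| < d / 2.
    have /andP[i0 i1] := im i (ltnW iM).
    rewrite -mulrBr normrM ger0_norm //; apply: le_lt_trans ab.
    by rewrite ler_piMl.
  split; first by rewrite (lt_trans s1) // ltr_pdivrMr // ltr_pMr // ltr1n.
  rewrite -(subrKA (i%:R / m%:R * b)) (le_lt_trans (ler_normD _ _)) //.
  rewrite [d]splitr ltrD // -mulrBl -mulrBl -natr1 opprD addrA subrr sub0r mulN1r.
  have /andP[b0 b1] := b01.
  have im0 : 0 <= m%:R^-1 :> R by rewrite invr_ge0 ler0n.
  rewrite normrM normrN (ger0_norm b0) (ger0_norm im0); apply: le_lt_trans hn.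
  by rewrite ler_piMr.
have near_pt (p' : R * R) : Sq p' -> `|p.1 - p'.1| < d / 2 -> `|p.2 - p'.2| < d / 2 ->
    B j (H (pt i p')) /\ B j (H (pt i.+1 p')).
  move=> Sp' k1 k2; have [/I01P u1 /I01P u2] := Sp'.
  have [l1 l1'] := small _ _ u1 k1; have [l2 l2'] := small _ _ u2 k2.
  by split; apply: hj => //; [exact: Si|exact: SSi].
have [b1 b2] : B j (H (pt i p)) /\ B j (H (pt i.+1 p)).
  by apply: near_pt => //; rewrite subrr normr0.
have [b3 b4] := near_pt q Sq_ h1 h2.
rewrite (incrementE b1 b2) (incrementE b3 b4) (incrementE b1 b3) (incrementE b2 b4).
by ring.
Qed.

(** An antiderivative along the path: [psi 1 - psi 0] is the integral of the closed form over [g].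
    Prescribing increments for nearby parameters avoids any choice of a subdivision. *)
Definition primitive g psi := exists2 d, 0 < d &
  forall s t, 0 <= s <= 1 -> 0 <= t <= 1 -> `|s - t| < d -> psi t - psi s = increment (g s) (g t).

Definition path_in g := {within I01, continuous g} /\ forall t, 0 <= t <= 1 -> O (g t).

Lemma primitive_exists g : path_in g -> exists psi, primitive g psi.
Proof.
move=> [/subspace_continuousP cg gO].
have cH : {within Sq, continuous (fun p : R * R => g p.2)}.
  apply/subspace_continuousP => p [/I01P p1 /I01P p2] A hA.
  have /nbhs_ballP [e /= e0 he] := cg p.2 (proj2 (I01P _) p2) A hA.
  apply/nbhs_ballP; exists e => //= q [_ h2] [_ h3].
  exact: he.
have [|Psi [d d0 hd]] := square_primitive cH.
  by move=> p [_ /I01P p2]; exact: gO.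
exists (fun t => Psi (0, t)), d => // s t s01 t01 st.
by apply: (hd (0, s) (0, t)) => //=; rewrite ?subrr ?normr0 //;
  split; apply/I01P => //=; rewrite lexx ler01.
Qed.

(** The difference of two primitives of one path is locally constant on the unit interval. *)
Lemma primitive_unique g g' psi psi' : primitive g psi -> primitive g' psi' ->
  (forall t, 0 <= t <= 1 -> g t = g' t) -> psi 1 - psi 0 = psi' 1 - psi' 0.
Proof.
move=> [d d0 hd] [d' d0' hd'] gg.
suff : psi 1 - psi' 1 = psi 0 - psi' 0 by move=> h; lra.
apply: (connected_locconst (A := I01) (chi := fun t => psi t - psi' t)).
- exact: segment_connected.
- move=> x /I01P x01; have e0 : 0 < Num.min d d' by rewrite lt_min d0.
  exists (Num.min d d') => //= y /=; rewrite lt_min => /andP[h1 h2] /I01P y01.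
  by have k1 := hd x y x01 y01 h1; have k2 := hd' x y x01 y01 h2; rewrite -gg // -gg // in k2; lra.
- by apply/I01P; rewrite lexx ler01.
- by apply/I01P; rewrite lexx ler01.
Qed.

Lemma primitive_reparam g psi (c m : R) : primitive g psi -> 0 <= c <= 1 -> 0 <= c + m <= 1 ->
  primitive (fun t => g (c + m * t)) (fun t => psi (c + m * t)).
Proof.
move=> [d d0 hd] /andP[c0 c1] /andP[m0 m1]; exists d => // s t s01 t01 st.
have k u : 0 <= u <= 1 -> 0 <= c + m * u <= 1 by move=> /andP[u0 u1]; apply/andP; split; nra.
apply: hd; [exact: k|exact: k|].
have -> : c + m * s - (c + m * t) = m * (s - t) by ring.
rewrite normrM; apply: le_lt_trans st; rewrite ler_piMl // ler_norml.
by apply/andP; split; lra.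
Qed.

Lemma primitive_const g x psi : O x -> (forall t, 0 <= t <= 1 -> g t = x) ->
  primitive g psi -> psi 1 = psi 0.
Proof.
move=> Ox gx h; apply/eqP; rewrite -subr_eq0; apply/eqP.
have h0 : primitive (cst x) (cst 0).
  by exists 1 => // s t _ _ _; rewrite /cst increment0 // subrr.
by rewrite (primitive_unique h h0 gx) /cst subrr.
Qed.

(** The form has a primitive on the square of the homotopy; three sides of the square are mapped to
    a point, so there is no increment along the fourth. *)
Lemma primitive_loop g psi : path_in g -> null_homotopic O g -> primitive g psi ->
  psi 1 = psi 0.
Proof.
move=> gin [H [cH HO H0 H1 Hs]] hp.
have e0 : 0 <= (0 : R) <= 1 by rewrite lexx ler01.
have e1 : 0 <= (1 : R) <= 1 by rewrite lexx ler01.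
have [|Psi [d d0 hd]] := square_primitive cH.
  by move=> [s t] [/= /I01P h1 /I01P h2]; exact: HO.
have SqP s t : 0 <= s <= 1 -> 0 <= t <= 1 -> Sq (s, t).
  by move=> h1 h2; split; apply/I01P.
have v c : 0 <= c <= 1 -> primitive (fun t => H (c, t)) (fun t => Psi (c, t)).
  move=> hc; exists d => // s t s01 t01 st.
  by apply: hd; rewrite /= ?subrr ?normr0 //; exact: SqP.
have w c : 0 <= c <= 1 -> primitive (fun t => H (t, c)) (fun t => Psi (t, c)).
  move=> hc; exists d => // s t s01 t01 st.
  by apply: hd; rewrite /= ?subrr ?normr0 //; exact: SqP.
have Og : O (g 0) by exact: gin.2.
have a1 := primitive_const Og H1 (v 1 e1).
have a2 := primitive_const Og (fun t h => (Hs t h).1) (w 0 e0).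
have a3 := primitive_const Og (fun t h => (Hs t h).2) (w 1 e1).
apply/eqP; rewrite -subr_eq0 (primitive_unique hp (v 0 e0)).
  by rewrite -a3 a1 a2 subrr.
by move=> t t01; rewrite H0.
Qed.

(* The projection of the line onto [0, 1]. *)
Definition clamp t : R := (`|t| - `|t - 1| + 1) / 2.

Lemma clamp_id t : 0 <= t <= 1 -> clamp t = t.
Proof.
move=> /andP[t0 t1]; rewrite /clamp ger0_norm // ler0_norm ?subr_le0 //.
by field.
Qed.

Lemma clamp_lt0 t : t <= 0 -> clamp t = 0.
Proof.
move=> t0; rewrite /clamp ler0_norm // ler0_norm; last by lra.
by field.
Qed.

Lemma clamp_gt1 t : 1 <= t -> clamp t = 1.
Proof.
move=> t1; rewrite /clamp ger0_norm; last by lra.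
by rewrite ger0_norm ?subr_ge0 //; field.
Qed.

Lemma clamp_in t : 0 <= clamp t <= 1.
Proof.
have [t0|/ltW t0] := leP t 0; first by rewrite clamp_lt0 // lexx ler01.
have [t1|/ltW t1] := leP 1 t; first by rewrite clamp_gt1 // lexx ler01.
by rewrite clamp_id ?t0 // t0.
Qed.

Lemma continuous_clamp : continuous clamp.
Proof.
move=> t; have n1 : (fun t : R => `|t|) @ t --> `|t| by apply: cvg_norm; exact: cvg_id.
have n2 : (fun t : R => `|t - 1|) @ t --> `|t - 1|.
  by apply: cvg_norm; exact: (cvgB cvg_id (cvg_cst _)).
exact: (cvgM (cvgD (cvgB n1 n2) (cvg_cst _)) (cvg_cst _)).
Qed.

Lemma continuous_clamped g : {within I01, continuous g} -> continuous (fun t => g (clamp t)).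
Proof.
move=> /subspace_continuousP cg t A hA.
have := cg _ (proj2 (I01P _) (clamp_in t)) A hA => h.
have h' : \forall u \near t, I01 (clamp u) -> A (g (clamp u)) by exact: (continuous_clamp h).
by apply: filterS h' => u; apply; apply/I01P; exact: clamp_in.
Qed.

Lemma continuous_clamped_affine g (c m : R) : {within I01, continuous g} ->
  continuous (fun t => g (clamp (c + m * t))).
Proof.
move=> cg t; have h : (fun t : R => c + m * t) @ t --> c + m * t.
  exact: (cvgD (cvg_cst _) (cvgM (cvg_cst _) cvg_id)).
apply: (@cvg_comp _ _ _ (fun t : R => c + m * t) (fun t => g (clamp t)) _ (nbhs (c + m * t))) => //.
exact: continuous_clamped.
Qed.

(* The concatenation of two paths with [g 1 = g' 0]: one of the two terms is always
   equal to that common point. *)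
Definition join g g' t : plane R := g (clamp (0 + 2 * t)) + g' (clamp (-1 + 2 * t)) - g 1.

Lemma join_left g g' t : g 1 = g' 0 -> 0 <= t <= 1 -> join g g' (0 + 2^-1 * t) = g t.
Proof.
move=> gg t01; rewrite /join.
have -> : 0 + 2 * (0 + 2^-1 * t) = t by field.
rewrite clamp_id // clamp_lt0 -?gg ?addrK //.
by move/andP: t01 => [? ?]; lra.
Qed.

Lemma join_right g g' t : g 1 = g' 0 -> 0 <= t <= 1 -> join g g' (2^-1 + 2^-1 * t) = g' t.
Proof.
move=> gg t01; rewrite /join.
have -> : -1 + 2 * (2^-1 + 2^-1 * t) = t by field.
rewrite (clamp_id t01) clamp_gt1; first by rewrite addrAC subrr add0r.
by move/andP: t01 => [? ?]; lra.
Qed.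

Lemma join_path g g' : path_in g -> path_in g' -> g 1 = g' 0 -> path_in (join g g').
Proof.
move=> [cg gO] [cg' gO'] gg; split.
  apply: continuous_subspaceT => t.
  have h1 := @continuous_clamped_affine g 0 2 cg t.
  have h2 := @continuous_clamped_affine g' (-1) 2 cg' t.
  exact: (cvgB (cvgD h1 h2) (cvg_cst _)).
move=> t /andP[t0 t1]; have [h|h] := leP t 2^-1.
  have -> : t = 0 + 2^-1 * (2 * t) by field.
  have h2 : 0 <= 2 * t <= 1 by apply/andP; split; lra.
  by rewrite join_left //; exact: gO.
have -> : t = 2^-1 + 2^-1 * (2 * t - 1) by field.
have h2 : 0 <= 2 * t - 1 <= 1 by apply/andP; split; lra.
by rewrite join_right //; exact: gO'.
Qed.

Lemma primitive_join g g' psi psi' Psi : g 1 = g' 0 -> primitive g psi -> primitive g' psi' ->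
  primitive (join g g') Psi ->
  Psi 1 - Psi 0 = (psi 1 - psi 0) + (psi' 1 - psi' 0).
Proof.
move=> gg p1 p2 p3.
have h0 : 0 <= (2^-1 : R) <= 1 by apply/andP; split; lra.
have q1 : primitive (fun t => join g g' (0 + 2^-1 * t)) (fun t => Psi (0 + 2^-1 * t)).
  by apply: primitive_reparam => //; rewrite ?lexx ?ler01 ?add0r.
have q2 : primitive (fun t => join g g' (2^-1 + 2^-1 * t)) (fun t => Psi (2^-1 + 2^-1 * t)).
  by apply: primitive_reparam => //; apply/andP; split; lra.
have e1 := primitive_unique p1 q1 (fun t h => esym (join_left gg h)).
have e2 := primitive_unique p2 q2 (fun t h => esym (join_right gg h)).
rewrite /= in e1 e2; rewrite e1 e2 !mulr1 !mulr0 !addr0 add0r.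
have -> : 2^-1 + 2^-1 = 1 :> R by field.
by ring.
Qed.

Hypothesis sc : simply_connected O.

(** [g] followed by [g'] reversed is a loop, along which a primitive has no increment. *)
Lemma primitive_independent g g' psi psi' : path_in g -> path_in g' ->
  g 0 = g' 0 -> g 1 = g' 1 -> primitive g psi -> primitive g' psi' ->
  psi 1 - psi 0 = psi' 1 - psi' 0.
Proof.
move=> gin gin' g0 g1 p1 p2.
pose r t := g' (1 + -1 * t).
have h1 : 0 <= (1 : R) <= 1 by rewrite lexx ler01.
have h0 : 0 <= (1 : R) + -1 <= 1 by rewrite subrr lexx ler01.
have pr : primitive r (fun t => psi' (1 + -1 * t)) by exact: primitive_reparam.
have gr : g 1 = r 0 by rewrite /r mulr0 addr0.
have rin : path_in r.
  have [cg gO] := gin'; split; last first.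
    by move=> t /andP[t0 t1]; apply: gO; apply/andP; split; lra.
  apply: (@subspace_eq_continuous _ _ _ (fun t => g' (clamp (1 + -1 * t)))).
    move=> t; rewrite inE => /I01P /andP[t0 t1]; rewrite /r clamp_id //.
    by apply/andP; split; lra.
  by apply: continuous_subspaceT; exact: continuous_clamped_affine.
have jin := join_path gin rin gr.
have [Psi pj] := primitive_exists jin.
have := primitive_join gr p1 pr pj.
have e0 : 0 <= (0 : R) <= 1 by rewrite lexx ler01.
have j0 : join g r 0 = g 0 by have := join_left gr e0; rewrite mulr0 addr0.
have j1 : join g r 1 = r 1.
  by have := join_right gr h1; rewrite mulr1; have -> : 2^-1 + 2^-1 = 1 :> R by field.
have jl : join g r 0 = join g r 1 by rewrite j0 j1 /r mulr1 subrr g0.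
rewrite (primitive_loop jin (sc.2 _ jin.1 jin.2 jl) pj) subrr mulr1 mulr0 subrr addr0.
by move=> h; lra.
Qed.

(** [G] is the integral along a path from a base point. A path to [y] is prolonged to [z] by the
    segment, which stays in the convex set [B i], and compared with the path chosen for [z]. *)
Lemma global_primitive : exists G : plane R -> R, forall i y z, B i y -> B i z ->
  G z - G y = f i z - f i y.
Proof.
have [[x0 O0]|nO] := pselect (O !=set0); last first.
  by exists (cst 0) => i y z /B_sub Oy _; case: nO; exists y.
have [pc _] := sc.
have /choice [G hG] y : exists r, O y -> exists g psi,
    [/\ path_in g, g 0 = x0, g 1 = y, primitive g psi & r = psi 1 - psi 0].
  have [Oy|nOy] := pselect (O y); last by exists 0 => /nOy.
  have [g [cg gO g0 g1]] := pc _ _ O0 Oy.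
  have [psi hpsi] : exists psi, primitive g psi by exact: primitive_exists.
  by exists (psi 1 - psi 0) => _; exists g, psi.
exists G => i y z By Bz.
have [g [psi [gin g0 g1 pg ->]]] := hG y (B_sub By).
have [g' [psi' [gin' g0' g1' pg' ->]]] := hG z (B_sub Bz).
pose l t := y + t *: (z - y).
have lin : path_in l.
  split; first by apply: continuous_subspaceT; exact: continuous_line.
  by move=> t t01; apply: (@B_sub i); exact: B_convex.
have pl : primitive l (fun t => f i (l t)).
  by exists 1 => // s t s01 t01 _; rewrite (incrementE (i := i)) //; exact: B_convex.
have l0 : l 0 = y by rewrite /l scale0r addr0.
have l1 : l 1 = z by rewrite /l scale1r addrC subrK.
have gl : g 1 = l 0 by rewrite l0.
have jin := join_path gin lin gl.
have [Psi pj] := primitive_exists jin.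
have e0 : 0 <= (0 : R) <= 1 by rewrite lexx ler01.
have e1 : 0 <= (1 : R) <= 1 by rewrite lexx ler01.
have j0 : join g l 0 = g 0 by have := join_left gl e0; rewrite mulr0 addr0.
have j1 : join g l 1 = l 1.
  by have := join_right gl e1; rewrite mulr1; have -> : 2^-1 + 2^-1 = 1 :> R by field.
have := primitive_join gl pg pl pj.
rewrite (primitive_independent jin gin' _ _ pj pg') ?j0 ?j1 ?g0 ?g0' ?l1 ?g1' //.
by rewrite l0 => ->; ring.
Qed.

End monodromy.

(** * Exactness *)

Section triangulation_connectedness.
Variables (R : realType) (Th : triangulation R) (E : interior_edges Th).
Implicit Types (a b x y z p q : plane R) (T : 'I_(ntri Th)) (e : 'I_(nedge E)).
Local Notation O := (Omega Th).

Lemma toward_interior T y q t : tri T y -> interior (tri T) q -> 0 < t <= 1 ->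
  interior (tri T) (y + t *: (q - y)).
Proof.
have A0 := vtx_area T.
rewrite /tri interior_hull3 // hull3E // => /= hy hq /andP[t0 t1] k.
rewrite bary_affine; apply: ltr_wpDl; first by rewrite mulr_ge0 ?subr_ge0.
exact: mulr_gt0 t0 (hq k).
Qed.

Lemma interior_tri_uniq T T' y : interior (tri T) y -> tri T' y -> T = T'.
Proof.
move=> Ty T'y; apply/eqP; case: eqP => // /eqP TT'; exfalso.
have [q hq] := @itri_neq0 _ _ T'.
have oy : interior (interior (tri T)) y by apply: (open_itri (T := T)).
have [e e0 he] := near0_gt0 (interior_move (q - y) oy).
pose t := Num.min e 1.
have t0 : 0 < t by rewrite lt_min e0 ltr01.
have t1 : t <= 1 by rewrite ge_min lexx orbT.
have h1 : interior (tri T) (y + t *: (q - y)).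
  by apply: he; rewrite gtr0_norm // ge_min lexx.
have h2 : interior (tri T') (y + t *: (q - y)) by apply: toward_interior => //; rewrite t0.
exact: interior_disjoint TT' h1 h2.
Qed.

Lemma common_edge T T' k k' a b : T != T' ->
  is_edge (vtx T) k a b -> is_edge (vtx T') k' a b ->
  exists e s, [/\ T = eT e s, T' = eT e (~~ s) & segment a b = segment (ea e) (eb e)].
Proof.
move=> TT' h h'; have [e [s [Ts ks]]] := edge_enum E TT' h h'.
have h2 : is_edge (vtx T) k (ea e) (eb e) by rewrite Ts ks; exact: ekP.
have ab : (ea e = a /\ eb e = b) \/ (ea e = b /\ eb e = a).
  case: h h2 => [[<- <-]|[<- <-]] [[-> ->]|[-> ->]]; by [left|right].
exists e, s; split => //; last by case: ab => [[-> ->]//|[-> ->]]; rewrite segmentC.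
have h3 : is_edge (vtx T') k' (ea e) (eb e).
  by case: ab => [[-> ->]//|[-> ->]]; exact: is_edgeC.
have [h4|h4] := two_sides (ekP e s) (ekP e (~~ s)) h3 (eTN e s) => //.
by rewrite Ts h4 eqxx in TT'.
Qed.

(** If two barycentric coordinates vanish, the third is 1 and the point is a vertex. *)
Lemma nonvertex_cases T y : tri T y -> (forall k, vtx T k != y) ->
  interior (tri T) y \/ exists k, open_edge (vtx T) k y.
Proof.
move=> Ty nv; have A0 := vtx_area T.
have b0 : forall k, 0 <= bary (vtx T) k y by move: Ty; rewrite /tri hull3E.
have [[k hk]|hn] := pselect (exists k, bary (vtx T) k y = 0); last first.
  left; rewrite /tri interior_hull3 // => k.
  by rewrite lt_def b0 andbT; apply/negP => /eqP h; apply: hn; exists k.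
right; exists k.
have nz j : j != k -> 0 < bary (vtx T) j y.
  move=> jk; rewrite lt_def b0 andbT; apply/negP => /eqP hj.
  have [i hi] := ord3_pair jk.
  have [z1 z2] : bary (vtx T) (i + 1) y = 0 /\ bary (vtx T) (i + (1 + 1)) y = 0.
    by case: hi => -[-> ->].
  have := bary_sum y A0; rewrite (sum3k i) z1 z2 !addr0 => z3.
  have := bary_comb y A0; rewrite (sum3k i) z1 z2 z3 scale1r !scale0r !addr0 => yi.
  by have := nv i; rewrite -yi eqxx.
by split => //; apply: nz; rewrite ord3_neq.
Qed.

Lemma nonvertex_edge T T' y : T != T' -> O y -> tri T y -> tri T' y ->
  (forall k, vtx T k != y) -> exists e s, T = eT e s /\ T' = eT e (~~ s).
Proof.
move=> TT' Oy Ty T'y nv; have [h|[k oe]] := nonvertex_cases Ty nv.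
  by move: TT'; rewrite (interior_tri_uniq h T'y) eqxx.
have [k' h'] := open_edge_meet TT' oe T'y.
have h : is_edge (vtx T) k (vtx T (k + 1)) (vtx T (k + (1 + 1))) by left.
by have [e [s [h1 h2 _]]] := common_edge TT' h h'; exists e, s.
Qed.

Lemma generic_point (U : set (plane R)) (J : finType) (N : J -> set (plane R)) :
  open U -> U !=set0 -> (forall j, (@mu2 R).-negligible (N j)) ->
  exists2 x, U x & forall j, ~ N j x.
Proof.
move=> oU U0 hN; apply: contrapT => hn; apply: (open_not_negligible oU U0).
have h : {ae @mu2 R, forall x, forall j, ~ N j x}.
  by apply: ae_finite => j; apply: negligibleS (hN j) => x /= /contrapT.
apply: negligibleS h => x Ux /= h; apply: hn; by exists x.
Qed.

Lemma null_point z : (@mu2 R).-negligible [set z].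
Proof.
have := @null_line R (- z.1) 1 0; rewrite oner_neq0 => /(_ isT).
by apply: negligibleS => x /= ->; rewrite mul1r mul0r addr0 addNr.
Qed.

Lemma ball_convex x (r : R) y z t : ball x r y -> ball x r z -> 0 <= t <= 1 ->
  ball x r (y + t *: (z - y)).
Proof.
move=> [y1 y2] [z1 z2] /andP[t0 t1].
have c (a b d : R) : `|a - b| < r -> `|a - d| < r -> `|a - (b + t * (d - b))| < r.
  have -> : a - (b + t * (d - b)) = (1 - t) * (a - b) + t * (a - d) by ring.
  move=> h1 h2; apply: (@le_lt_trans _ _ (Num.max `|a - b| `|a - d|)); last by rewrite gt_max h1.
  apply: le_trans (ler_normD _ _) _; rewrite !normrM (ger0_norm t0) ger0_norm ?subr_ge0 //.
  set m := Num.max _ _.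
  have m1 : `|a - b| <= m by rewrite le_max lexx.
  have m2 : `|a - d| <= m by rewrite le_max lexx orbT.
  by move: m1 m2 t0 t1; clear; nra.
by split; apply: c.
Qed.

Lemma closed_tri T : closed (tri T).
Proof. exact/closed_hull3/vtx_area. Qed.

Lemma closed_line_tri p q T : closed [set t : R | tri T (p + t *: (q - p))].
Proof.
apply: (@closed_comp _ _ (fun t : R => p + t *: (q - p)) (tri T)).
  by move=> t _; exact: continuous_line.
exact: closed_tri.
Qed.

Section edgewise_constant.
Variables (U : Type) (c : 'I_(ntri Th) -> U).
Hypothesis cE : forall e, c (Tplus e) = c (Tminus e).

Lemma edgewise_eT e s s' : c (eT e s) = c (eT e s').
Proof. by case: s s' => [] [] //=; rewrite cE. Qed.

(* Inside a ball contained in Omega, two triangles through the center are joined by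
   a segment chosen generically so as to avoid all vertices. *)
Lemma edgewise_local x T T' : O x -> tri T x -> tri T' x -> c T = c T'.
Proof.
move=> Ox Tx T'x.
have : nbhs x O by apply: open_nbhs_nbhs; split=> //; exact: open_Omega.
case/nbhs_ballP => r /= r0 hr.
have near_int T1 : tri T1 x -> (ball x r `&` interior (tri T1)) !=set0.
  move=> T1x; have [q hq] := @itri_neq0 _ _ T1.
  have ob : interior (ball x r) x by exact: nbhsx_ballx.
  have [e e0 he] := near0_gt0 (interior_move (q - x) ob).
  pose t := Num.min e 1.
  have t0 : 0 < t by rewrite lt_min e0 ltr01.
  have t1 : t <= 1 by rewrite ge_min lexx orbT.
  exists (x + t *: (q - x)); split.
    by apply: he; rewrite gtr0_norm // ge_min lexx.
  by apply: toward_interior => //; rewrite t0.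
have oB T1 : open (ball x r `&` interior (tri T1)).
  by apply: openI; [exact: ball_open|exact: open_itri].
(* [p] avoids the vertices, so that the lines joining it to them are null sets; [q] is then chosen
   off these lines, and the line from [p] to [q] meets no vertex. *)
have [p [Bp Tp] np] := @generic_point _ _
  (fun j : 'I_(ntri Th) * 'I_3 => [set vtx j.1 j.2]) (oB T) (near_int T Tx)
  (fun j => null_point _).
have [q [Bq Tq] nq] := @generic_point _ _
  (fun j : 'I_(ntri Th) * 'I_3 => [set q | cross (vtx j.1 j.2 - p) (q - p) = 0])
  (oB T') (near_int T' T'x)
  (fun j => null_line_through (introN eqP (np j))).
have seg t : 0 <= t <= 1 -> O (p + t *: (q - p)).
  by move=> t01; apply: hr; exact: ball_convex.
have nv t T1 k : vtx T1 k != p + t *: (q - p).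
  apply/negP => /eqP h; apply: (nq (T1, k)) => /=.
  by rewrite h /cross /= /GRing.scale /=; ring.
have key := @connected_closed_cover R U 'I_(ntri Th) `[0, 1]%classic
  (fun T1 => [set t : R | tri T1 (p + t *: (q - p))]) c.
apply: (key _ _ _ _ (0 : R) (1 : R) T T').
- exact: segment_connected.
- by move=> i; exact: closed_line_tri.
- by move=> t /=; rewrite in_itv /= => /seg /tri_Omega.
- move=> t T1 T2; rewrite /= in_itv /= => /seg Ot h1 h2.
  have [->//|TT] := eqVneq T1 T2.
  have [e [s [-> ->]]] := nonvertex_edge TT Ot h1 h2 (nv t T1).
  exact: edgewise_eT.
- by rewrite /= in_itv /= lexx ler01.
- by rewrite /= in_itv /= lexx ler01.
- by rewrite /= scale0r addr0; exact: interior_subset.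
- by rewrite /= scale1r addrC subrK; exact: interior_subset.
Qed.

Lemma edgewise_global : connected O -> forall T T', c T = c T'.
Proof.
move=> cO T T'; have [x Tx] := @itri_neq0 _ _ T; have [y Ty] := @itri_neq0 _ _ T'.
apply: (connected_closed_cover cO closed_tri (@tri_Omega _ Th) edgewise_local
  (interior_Omega Tx) (interior_Omega Ty)); exact: interior_subset.
Qed.

End edgewise_constant.

End triangulation_connectedness.

Section exactness.
Variables (R : realType) (Th : triangulation R) (E : interior_edges Th).
Implicit Types (a b x y z p q : plane R) (T : 'I_(ntri Th)) (e : 'I_(nedge E)).
Implicit Types (u : 'I_(ntri Th) -> poly2 R) (v : 'I_(ntri Th) -> poly2 R * poly2 R).
Local Notation O := (Omega Th).

Lemma constf_inj : O !=set0 -> injective (constf Th).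
Proof.
move=> [x /tri_Omega [T _]] c c' cc; have := congr1 (fun s => peval (s T) 0) cc.
by rewrite /constf !pevalC.
Qed.

Lemma rotgrad_kernel d : O !=set0 -> connected O ->
  [set u | V0 E d u /\ rotf (D0br u) = 0] = range (constf Th).
Proof.
move=> [x Ox] cO; have [T0 _] := tri_Omega Ox.
apply/seteqP; split=> u; last first.
  by move=> [c _ <-]; split; [exact: V0_constf|exact: rotgrad_constf].
move=> [[hu /(C0P E hu) cu] gu].
pose c T := mcoeff mnm0 (u T).
have uc T : u T = mpolyC 2 (c T).
  have h1 : - mderiv ord_max (u T) = 0 := congr1 (fun s => (s T).1) gu.
  have h2 : mderiv ord0 (u T) = 0 := congr1 (fun s => (s T).2) gu.
  apply: mderiv_const; first exact: h2.
  by rewrite -[LHS]opprK h1 oppr0.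
have cc e : c (Tplus e) = c (Tminus e).
  have := cu e; rewrite !uc !lpolyC => /(congr1 (fun p : {poly R} => p.[0])).
  by rewrite !hornerC.
exists (c T0) => //; apply/funext => T.
by rewrite /constf uc (edgewise_global cc cO T0 T).
Qed.

Lemma deriv_eq_horner (p q : {poly R}) s t : p^`() = q^`() ->
  p.[t] - p.[s] = q.[t] - q.[s].
Proof.
move=> pq; have : p - q = ((p - q)`_0)%:P.
  apply/polyP => -[|i]; rewrite coefC //=.
  have : (p - q)^`()`_i = 0 by rewrite derivB pq subrr coef0.
  by rewrite coef_deriv => /eqP; rewrite mulrn_eq0 /= => /eqP.
move=> h; have ht r : p.[r] - q.[r] = (p - q)`_0 by rewrite -hornerN -hornerD h hornerC coefC.
by have := ht t; have := ht s => h1 h2; lra.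
Qed.

Section cocycle.
Variable u : 'I_(ntri Th) -> poly2 R.
Hypothesis du : forall e, (lpoly (ea e) (eb e) (u (Tplus e)))^`() =
  (lpoly (ea e) (eb e) (u (Tminus e)))^`().

(** Distinct triangles with two distinct common points share an edge, along which [du] makes the two
    polynomials differ by a constant. *)
Lemma cocycle_uniq T T' x y : tri T x -> tri T y -> tri T' x -> tri T' y ->
  peval (u T) y - peval (u T) x = peval (u T') y - peval (u T') x.
Proof.
move=> Tx Ty T'x T'y.
have [->//|TT] := eqVneq T T'; have [->|xy] := eqVneq x y; first by rewrite !subrr.
case: (conforming TT) => [h|[a [_ _ h]]|[a [b h]]].
- by have : set0 x by rewrite -h.
- have : [set a] x by rewrite -h.
  have : [set a] y by rewrite -h.
  by move=> /= hy hx; rewrite hx hy eqxx in xy.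
- have [[k hk] [k' hk']] := share_edgeP h.
  have [e [s [-> -> seg]]] := common_edge E TT hk hk'.
  have [_ [_ _ _ _ hs]] := h.
  have [r _ rx] : segment (ea e) (eb e) x by rewrite -seg -hs.
  have [t _ ty] : segment (ea e) (eb e) y by rewrite -seg -hs.
  rewrite rx ty -!lpolyE; apply: deriv_eq_horner.
  by case: s => /=; rewrite du.
Qed.

(** The increment of the multivalued stream function between two points of a common triangle; 0 is a
    default value. *)
Definition cocycle x y : R :=
  xget 0 [set r | exists T, [/\ tri T x, tri T y & r = peval (u T) y - peval (u T) x]].

Lemma cocycleE T x y : tri T x -> tri T y -> cocycle x y = peval (u T) y - peval (u T) x.
Proof.
move=> Tx Ty; rewrite /cocycle.
have := @xgetPex _ 0 [set r | exists T, [/\ tri T x, tri T y & r = peval (u T) y - peval (u T) x]].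
case; first by exists (peval (u T) y - peval (u T) x), T.
by move=> T' [T'x T'y ->]; exact: cocycle_uniq.
Qed.

(** The center belongs to every triangle that meets the ball, so [cocycle] from the center is
    meaningful throughout it. The conditions are part of membership, unsuitable pairs giving the
    empty set, so that all pairs of a center and a radius can serve as indices. *)
Definition good_ball (i : plane R * R) : set (plane R) := [set y |
  [/\ ball i.1 i.2 `<=` O, forall z, ball i.1 i.2 z -> forall T, tri T z -> tri T i.1 &
    ball i.1 i.2 y]].

Lemma good_ball_cover x : O x -> exists2 r, 0 < r & ball x r `<=` good_ball (x, r).
Proof.
move=> Ox; have nO : nbhs x O by apply: open_nbhs_nbhs; split=> //; exact: open_Omega.
have : \forall z \near x, O z /\ forall T, tri T z -> tri T x.
  by apply: filterI nO (@near_tri_subset R Th x).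
case/nbhs_ballP => r /= r0 hr; exists r => // y By; split => //= z Bz.
  by have [] := hr z Bz.
by have [_] := hr z Bz.
Qed.

(** At a common point [w] lying in [T] the two local functions differ by [c T], which does not
    depend on [w]. These labels agree whenever two triangles meet on the segment from [y] to [z], so
    they are constant along it. *)
Lemma cocycle_compat i j y z : good_ball i y -> good_ball i z -> good_ball j y -> good_ball j z ->
  cocycle i.1 z - cocycle i.1 y = cocycle j.1 z - cocycle j.1 y.
Proof.
move=> [iO iT iy] [_ _ iz] [jO jT jy] [_ _ jz].
pose l t := y + t *: (z - y).
have [[T0 Ty] [T1 Tz]] := (tri_Omega (iO _ iy), tri_Omega (iO _ iz)).
pose c T := peval (u T) j.1 - peval (u T) i.1.
have cE w T : ball i.1 i.2 w -> ball j.1 j.2 w -> tri T w ->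
    cocycle i.1 w - cocycle j.1 w = c T.
  move=> iw jw Tw; rewrite (cocycleE (iT w iw T Tw) Tw) (cocycleE (jT w jw T Tw) Tw) /c.
  by ring.
suff : c T0 = c T1 by rewrite -(cE y) // -(cE z) // => h; lra.
have key := @connected_closed_cover R R 'I_(ntri Th) `[0, 1]%classic
  (fun T => [set t : R | tri T (l t)]) c.
apply: (key _ _ _ _ (0 : R) (1 : R) T0 T1).
- exact: segment_connected.
- by move=> T; exact: closed_line_tri.
- move=> t /=; rewrite in_itv /= => t01.
  by have := iO _ (ball_convex iy iz t01) => /tri_Omega.
- move=> t T T'; rewrite /= in_itv /= => t01 h1 h2.
  have bi := ball_convex iy iz t01; have bj := ball_convex jy jz t01.
  by rewrite -(cE _ _ bi bj h1) -(cE _ _ bi bj h2).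
- by rewrite /= in_itv /= lexx ler01.
- by rewrite /= in_itv /= lexx ler01.
- by rewrite /= /l scale0r addr0.
- by rewrite /= /l scale1r addrC subrK.
Qed.

Lemma cocycle_primitive : simply_connected O -> exists G : plane R -> R,
  forall x r y z, good_ball (x, r) y -> good_ball (x, r) z ->
    G z - G y = cocycle x z - cocycle x y.
Proof.
move=> sc; have [|||G hG] := global_primitive (I := plane R * R) (O := O) (B := good_ball)
  (f := fun i => cocycle i.1) _ _ _ cocycle_compat sc.
- move=> x /good_ball_cover [r r0 hr]; exists (x, r).
  by apply: filterS hr _; exact: nbhsx_ballx.
- by move=> i y [h _ By]; exact: h.
- by move=> i y z t [h1 h2 By] [_ _ Bz] t01; split => //; exact: ball_convex.
by exists G => x r y z h1 h2; exact: (hG (x, r)).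
Qed.

(** [G] minus the polynomial of [T] is locally constant along the segment from a point of [T] in
    Omega to a fixed interior point of [T], hence constant there. With these constants added, all
    local polynomials are restrictions of the single function [G]. *)
Lemma cocycle_constants : simply_connected O -> exists c : 'I_(ntri Th) -> R,
  forall e, lpoly (ea e) (eb e) (u (Tplus e) + mpolyC 2 (c (Tplus e))) =
    lpoly (ea e) (eb e) (u (Tminus e) + mpolyC 2 (c (Tminus e))).
Proof.
move=> /cocycle_primitive [G hG].
have /choice [c hc] T : exists c, forall w, tri T w -> O w -> G w = peval (u T) w + c.
  have [q Tq] := @itri_neq0 _ _ T.
  exists (G q - peval (u T) q) => w Tw Ow.
  pose l t := w + t *: (q - w).
  have l0 : l 0 = w by rewrite /l scale0r addr0.
  have l1 : l 1 = q by rewrite /l scale1r addrC subrK.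
  have hl t : `[0, 1]%classic t -> tri T (l t) /\ O (l t).
    rewrite /= in_itv /= => /andP[]; rewrite le_eqVlt => /orP[/eqP <- _|t0 t1].
      by rewrite l0.
    have := @toward_interior _ _ T w q t Tw Tq; rewrite t0 t1 => /(_ isT) h.
    by split; [exact: interior_subset|exact: interior_Omega h].
  suff : G (l 0) - peval (u T) (l 0) = G (l 1) - peval (u T) (l 1).
    by rewrite l0 l1 => h; lra.
  have key := @connected_locconst R R `[0, 1]%classic (fun t => G (l t) - peval (u T) (l t)).
  apply: (key _ _ 0 1).
  - exact: segment_connected.
  - move=> t /hl [Tt Ot]; have [r r0 hr] := good_ball_cover Ot.
    have nb : \forall s \near t, ball (l t) r (l s).
      by apply: (@continuous_line R w q t); exact: nbhsx_ballx.
    apply: filterS nb => s bs /hl [Ts Os].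
    have := hG _ _ _ _ (hr _ (ballxx _ r0)) (hr _ bs).
    by rewrite (cocycleE Tt Tt) (cocycleE Tt Ts) => h; lra.
  - by rewrite /= in_itv /= lexx ler01.
  - by rewrite /= in_itv /= lexx ler01.
exists c => e; apply/eqP; rewrite -subr_eq0; apply/eqP; apply: poly_zero_itv => t t01.
rewrite hornerD hornerN !lpolyE !pevalD !pevalC -/(epoint e t).
have Ot := epoint_Omega e t01.
have h s := open_edge_tri (epoint_open e s t01).
by rewrite -(hc (Tplus e) _ (h true) Ot) -(hc (Tminus e) _ (h false) Ot) subrr.
Qed.

End cocycle.

Lemma div_kernel d : simply_connected O ->
  [set v | V1div E d v /\ divbr v = 0] = [set rotf (D0br u) | u in V0 E d].
Proof.
move=> sc; apply/seteqP; split=> v; last first.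
  by move=> [u hu <-]; split; [exact: V0_V1div|exact: div_rotgrad].
move=> [[hv cv] dv].
have /choice [u hu] T : exists f, Pol R d.+1 f /\ rot (mderiv ord0 f, mderiv ord_max f) = v T.
  have [|f h1 h2] := poly_stream (hv T); last by exists f.
  by have := congr1 (fun s => s T) dv.
have uv : rotf (D0br u) = v by apply/funext => T; have [_] := hu T.
have du e : (lpoly (ea e) (eb e) (u (Tplus e)))^`() = (lpoly (ea e) (eb e) (u (Tminus e)))^`().
  have := (C1divP E (@VPol_normal_deg R d) hv).1 cv e.
  rewrite -uv !lpoly_normal_rotgrad => /scalerI; apply.
  by rewrite invr_eq0 elen_neq0.
have [c hc] := cocycle_constants du sc.
pose u' T := u T + mpolyC 2 (c T).
have hu' : broken d.+1 u'.
  by move=> T; rewrite /u' -[u T]scale1r; apply: PolD; [have [] := hu T|exact: PolC].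
exists u'; first by split=> //; apply/(C0P E hu').
rewrite -uv; apply/funext => T; rewrite /rotf /D0br /u' /=.
by rewrite !mderivD !mderivC !addr0.
Qed.

End exactness.

(** * Existence of a boundary edge *)

Section boundary_edge.
Variables (R : realType) (Th : triangulation R) (E : interior_edges Th).
Implicit Types (a b x y z p q : plane R) (T : 'I_(ntri Th)) (e : 'I_(nedge E)).

Lemma point_at_infinity : exists2 U : set (plane R), open U /\ U !=set0 &
  forall x T, U x -> ~ tri T x.
Proof.
have hM (T : 'I_(ntri Th)) : exists M, tri T `<=` box M by exact: hull3_bounded.
have [M hM'] := choice hM.
pose N := \sum_T `|M T|.
have MN T : M T <= N.
  by rewrite /N (bigD1 T) //= (le_trans (ler_norm _)) // lerDl sumr_ge0.
exists [set x : plane R | N < x.1].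
  split; last by exists (N + 1, 0) => /=; rewrite ltrDl ltr01.
  have -> : [set x : plane R | N < x.1] = fst @^-1` [set y : R | N < y] by [].
  by apply: open_comp; [move=> x _; exact: cvg_fst|exact: open_gt].
move=> x T /= Nx /hM' /boxP [h _].
by have := le_lt_trans (le_trans h (MN T)) Nx; rewrite ltNge ler_norm.
Qed.

(* Otherwise the union of the triangles would be open off the vertices, and a
   generic segment could not leave it. *)
Lemma boundary_slot : (exists x, Omega Th x) -> exists T k, forall e s, (T, k) <> (eT e s, ek e s).
Proof.
move=> [x0 /tri_Omega [T0 _]]; apply: contrapT => hn.
have all_int T k : exists e s, T = eT e s /\ k = ek e s.
  apply: contrapT => h; apply: hn; exists T, k => e s [h1 h2].
  by apply: h; exists e, s.
pose D := [set x : plane R | exists T, tri T x].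
have [U [oU U0] hU] := point_at_infinity.
have [p Tp np] := generic_point (open_itri (T := T0)) (@itri_neq0 _ _ T0)
  (fun j : 'I_(ntri Th) * 'I_3 => @null_point R (vtx j.1 j.2)).
have [q Uq nq] := generic_point oU U0
  (fun j : 'I_(ntri Th) * 'I_3 => @null_line_through R p (vtx j.1 j.2) (introN eqP (np j))).
pose l t := p + t *: (q - p).
have nv t T k : vtx T k != l t.
  apply/negP => /eqP h; apply: (nq (T, k)) => /=.
  by rewrite h /l /cross /= /GRing.scale /=; ring.
have intD t T : tri T (l t) -> \forall s \near t, D (l s).
  move=> Tt; suff nD : nbhs (l t) D by exact: (@continuous_line R p q t).
  have [h|[k oe]] := nonvertex_cases Tt (nv t T).
    by apply: filterS h => y Ty; exists T.
  have [e [s [Ts ks]]] := all_int T k.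
  have h2 := ekP e s; rewrite -Ts -ks in h2.
  have TT : T != eT e (~~ s) by rewrite {1}Ts eTN.
  have := open_edge_interior TT h2 (ekP e (~~ s)) oe.
  by apply: filterS => y [Ty|Ty]; [exists T|exists (eT e (~~ s))].
have outD t : ~ D (l t) -> \forall s \near t, ~ D (l s).
  move=> nDt.
  have h : \forall s \near t, forall T, ~ tri T (l s).
    apply: (@filter_forall _ _ (fun T s => ~ tri T (l s)) (nbhs t) _) => T.
    have : nbhs t (~` [set t : R | tri T (l t)]).
      apply: open_nbhs_nbhs; split; first by apply: closed_openC; exact: closed_line_tri.
      by move=> Tt; apply: nDt; exists T.
    by [].
  by apply: filterS h => s hs [T]; exact: hs.
have key := @connected_locconst R bool `[0, 1]%classic (fun t => `[< D (l t) >]).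
have : `[< D (l 0) >] = `[< D (l 1) >].
  apply: (key _ _ 0 1).
  - exact: segment_connected.
  - move=> t _; have [[T Tt]|nD] := pselect (D (l t)).
      apply: filterS (intD t T Tt) => s Ds _.
      by rewrite (asboolT Ds) asboolT //; exists T.
    apply: filterS (outD t nD) => s Ds _.
    by rewrite (asboolF Ds) asboolF.
  - by rewrite /= in_itv /= lexx ler01.
  - by rewrite /= in_itv /= lexx ler01.
rewrite asboolT; last by exists T0; rewrite /l scale0r addr0; exact: interior_subset.
move/esym/asboolP => [T]; rewrite /l scale1r addrC subrK; exact: hU.
Qed.

End boundary_edge.

(** * Linear functions and bubbles attached to an edge *)

Section edge_functions.
Variables (R : realType) (Th : triangulation R) (E : interior_edges Th).
Implicit Types (a b x y z : plane R) (T : 'I_(ntri Th)) (e : 'I_(nedge E)) (p q : {poly R}).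

Lemma bary_poly_ex (P : 'I_3 -> plane R) k :
  exists f : poly2 R, Pol R 1 f /\ forall x, peval f x = bary P k x.
Proof.
have [c0 [c1 [c2 h]]] := bary_affine2 P k.
exists (c1 *: var R ord0 + (c2 *: var R ord_max + mpolyC 2 c0)); split.
  apply: PolD; first exact: Pol_var.
  by apply: PolD; [exact: Pol_var|exact: PolC].
by move=> x; rewrite h !pevalD !pevalZ !pevalX pevalC /=; ring.
Qed.

Definition bary_poly P k : poly2 R := sval (cid (bary_poly_ex P k)).

Lemma Pol_bary_poly P k : Pol R 1 (bary_poly P k).
Proof. by rewrite /bary_poly; case: cid => f []. Qed.

Lemma lpoly_bary_poly P k a b :
  lpoly a b (bary_poly P k) = (bary P k a)%:P + (bary P k b - bary P k a) *: 'X.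
Proof.
apply: poly_ext => t; rewrite lpolyE hornerD hornerC hornerZ hornerX.
rewrite /bary_poly; case: cid => f [_ hf] /=; rewrite hf bary_affine; ring.
Qed.

(* The linear function on [T] which is 1 at the vertex [x] and 0 at the others
   (and 0 if [x] is not a vertex of [T]). *)
Definition hat T x : poly2 R := \sum_j (vtx T j == x)%:R *: bary_poly (vtx T) j.

Lemma Pol_hat T x : Pol R 1 (hat T x).
Proof. by apply: Pol_sum => j _; apply: PolZ; exact: Pol_bary_poly. Qed.

Lemma lpoly_sum a b (I : Type) (r : seq I) (F : I -> poly2 R) :
  lpoly a b (\sum_(i <- r) F i) = \sum_(i <- r) lpoly a b (F i).
Proof.
elim: r => [|i r IHr]; first by rewrite !big_nil -[0]/(mpolyC 2 0) lpolyC polyC0.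
by rewrite !big_cons lpolyD IHr.
Qed.

Lemma bary_poly_comb_edge T (c : 'I_3 -> R) i j : 
  lpoly (vtx T i) (vtx T j) (\sum_k c k *: bary_poly (vtx T) k) = (c i)%:P + (c j - c i) *: 'X.
Proof.
have A0 := vtx_area T.
have s (m : 'I_3) : \sum_k c k * bary (vtx T) k (vtx T m) = c m.
  rewrite (bigD1 m) //= bary_vtx // eqxx mulr1 big1 ?addr0 // => k km.
  by rewrite bary_vtx // eq_sym (negbTE km) mulr0.
rewrite lpoly_sum; apply: poly_ext => t; rewrite hornerD hornerC hornerZ hornerX.
rewrite horner_sum -{1}(s i) -(s j) -(s i) -sumrB mulr_suml -big_split /=.
apply: eq_bigr => k _.
by rewrite lpolyZ lpoly_bary_poly hornerZ hornerD hornerC hornerZ hornerX; ring.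
Qed.

Lemma edge_vtx e s : exists i j, vtx (eT e s) i = ea e /\ vtx (eT e s) j = eb e.
Proof.
by case: (ekP e s) => [[h1 h2]|[h1 h2]];
  [exists (ek e s + 1), (ek e s + (1 + 1))|exists (ek e s + (1 + 1)), (ek e s + 1)].
Qed.

Lemma lpoly_hat e s x : lpoly (ea e) (eb e) (hat (eT e s) x) =
  (ea e == x)%:R%:P + ((eb e == x)%:R - (ea e == x)%:R) *: 'X.
Proof.
have [i [j [<- <-]]] := edge_vtx e s.
exact: (bary_poly_comb_edge _ (fun k => (vtx (eT e s) k == x)%:R)).
Qed.

(** The antiderivative vanishing at 0; the factor [(i != 0)] clears the constant coefficient, for
    which [i.-1] would be read as 0. *)
Definition primp p : {poly R} := \poly_(i < (size p).+1) (p`_i.-1 * (i != 0)%:R / i%:R).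

Lemma deriv_primp p : (primp p)^`() = p.
Proof.
apply/polyP => i; rewrite coef_deriv coef_poly ltnS.
case: ltnP => [_|h] /=; last by rewrite mul0rn nth_default.
by rewrite mulr1 -[LHS]mulr_natr divfK // pnatr_eq0.
Qed.

Lemma primp0 p : (primp p).[0] = 0.
Proof. by rewrite horner_coef0 coef_poly /= mulr0 mul0r. Qed.

Lemma size_primp p : (size (primp p) <= (size p).+1)%N.
Proof. exact: size_poly. Qed.

Lemma bubble_factor p n : p.[0] = 0 -> p.[1] = 0 -> (size p <= n.+2)%N ->
  exists2 q, p = 'X * (1 - 'X) * q & (size q <= n)%N.
Proof.
move=> p0 p1 sp; have [p00|pn0] := eqVneq p 0.
  by exists 0; rewrite ?mulr0 ?size_poly0.
have /factor_theorem [r hr] : root p 0 by rewrite /root p0.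
have /factor_theorem [q hq] : root r 1.
  by move: p1; rewrite hr hornerM hornerXsubC subr0 mulr1 => h; rewrite /root h.
exists (- q); first by rewrite hr hq subr0; ring.
rewrite size_polyN.
have q0 : q != 0 by apply: contraNneq pn0 => q0; rewrite hr hq q0 !mul0r.
have r0 : r != 0 by apply: contraNneq pn0 => r0; rewrite hr r0 !mul0r.
move: sp; rewrite hr size_Mmonic ?monicXsubC // size_XsubC addn2 /= ltnS.
by rewrite hq size_Mmonic ?monicXsubC // size_XsubC addn2.
Qed.

Definition compp q (f : poly2 R) : poly2 R := \sum_(i < size q) q`_i *: f ^+ i.

Lemma Pol_compp q f n : Pol R 1 f -> (size q <= n.+1)%N -> Pol R n (compp q f).
Proof.
move=> hf sq; apply: Pol_sum => i _; apply: PolZ.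
have h m : Pol R m (f ^+ m).
  elim: m => [|m IHm]; first by rewrite expr0; exact: PolC.
  by rewrite exprS -add1n; exact: PolM.
apply: leq_trans (h i) _; rewrite ltnS.
by rewrite -ltnS (leq_trans _ sq) // ltn_ord.
Qed.

Lemma lpoly_compp a b q f : lpoly a b (compp q f) = q \Po lpoly a b f.
Proof.
have hX m : lpoly a b (f ^+ m) = lpoly a b f ^+ m.
  by elim: m => [|m IHm]; [rewrite expr0 lpolyC|rewrite !exprS lpolyM IHm].
rewrite comp_polyE lpoly_sum; apply: eq_bigr => i _.
by rewrite lpolyZ hX.
Qed.

(** On [e] the two hats are [1 - t] and [t], so the restriction is their product times [q]. Along
    any other edge of the triangle one of the hats vanishes. *)
Definition bubble e q : poly2 R :=
  hat (Tplus e) (ea e) * hat (Tplus e) (eb e) * compp q (hat (Tplus e) (eb e)).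

Lemma Pol_bubble e q n : (size q <= n)%N -> (0 < n)%N -> Pol R n.+1 (bubble e q).
Proof.
case: n => // n sq _; rewrite -addn2 addnC; apply: PolM.
  by rewrite -[2%N]/(1 + 1)%N; apply: PolM; exact: Pol_hat.
by apply: Pol_compp => //; exact: Pol_hat.
Qed.

Lemma lpoly_bubble e q : lpoly (ea e) (eb e) (bubble e q) = 'X * (1 - 'X) * q.
Proof.
have ab := edge_neq_ab e.
have h x := lpoly_hat e true x; rewrite /= in h.
rewrite /bubble !lpolyM lpoly_compp !h !eqxx (negbTE ab) eq_sym (negbTE ab).
rewrite subr0 sub0r !scale1r scaleN1r polyC0 add0r comp_polyXr polyC1.
by ring.
Qed.

Lemma lpoly_bubble_other e e' s q : e' != e -> Tplus e = eT e' s ->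
  lpoly (ea e') (eb e') (bubble e q) = 0.
Proof.
move=> ee Te; rewrite /bubble Te !lpolyM.
have z x : ea e' != x -> eb e' != x -> lpoly (ea e') (eb e') (hat (eT e' s) x) = 0.
  by move=> h1 h2; rewrite lpoly_hat (negbTE h1) (negbTE h2) subrr scale0r polyC0 addr0.
have ab := edge_neq_ab e; have ab' := edge_neq_ab e'.
have no : ~ [/\ (ea e' == ea e) || (eb e' == ea e) & (ea e' == eb e) || (eb e' == eb e)].
  move=> [h1 h2]; move/eqP: ee; apply; apply: edge_inj.
  case/orP: h1 => /eqP h1; case/orP: h2 => /eqP h2.
  - by move: ab; rewrite -h1 -h2 eqxx.
  - by rewrite h1 h2.
  - by rewrite h1 h2 segmentC.
  - by move: ab; rewrite -h1 -h2 eqxx.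
have [h1|/norP[h1 h1']] := boolP ((ea e' == ea e) || (eb e' == ea e)); last first.
  by rewrite z // !mul0r.
have [h2|/norP[h2 h2']] := boolP ((ea e' == eb e) || (eb e' == eb e)); first by case: no.
by rewrite (z (eb e)) // mulr0 mul0r.
Qed.

End edge_functions.

(** * Surjectivity of the divergence *)

Section divergence_onto.
Variables (R : realType) (Th : triangulation R) (E : interior_edges Th).
Implicit Types (a b x y z : plane R) (T : 'I_(ntri Th)) (e : 'I_(nedge E)) (k j : 'I_3) (s : bool).

Definition sgb s : R := if s then 1 else -1.

(** When [e] is an edge of [T], the slope along [e], in the edge parameter, of the hat function of
    the [j]-th vertex of [T]. *)
Definition rise e T j : R := (vtx T j == eb e)%:R - (vtx T j == ea e)%:R.

(** The effect on the mean of the tangential jump across [e] of the nodal value at vertex [j] of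
    [T]. Nodal values on different triangles are independent, the functions being broken. *)
Definition jump_coef T j e : R := \sum_(s : bool) sgb s * ((T == eT e s)%:R * rise e T j).

Lemma rise_slot e s : exists2 c : R, `|c| = 1 & forall j,
  rise e (eT e s) j = c * ((j == ek e s + (1 + 1))%:R - (j == ek e s + 1)%:R).
Proof.
have inj := vtx_inj (vtx_area (eT e s)).
case: (ekP e s) => [[h1 h2]|[h1 h2]]; [exists 1|exists (-1)]; rewrite ?normrN ?normr1 //;
  move=> j; rewrite /rise -h1 -h2 !(inj_eq inj); ring.
Qed.

(* The coefficients [lam] on the edges of a triangle agree up to sign; hence they
   agree up to sign everywhere, and vanish as some triangle has a boundary edge. *)
Lemma jump_coef_inj (lam : 'I_(nedge E) -> R) : Omega Th !=set0 -> connected (Omega Th) ->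
  (forall T j, \sum_e jump_coef T j e * lam e = 0) -> forall e, lam e = 0.
Proof.
move=> O0 cO h.
have /choice [c hc] (es : 'I_(nedge E) * bool) : exists c : R, `|c| = 1 /\ forall j,
    rise es.1 (eT es.1 es.2) j =
    c * ((j == ek es.1 es.2 + (1 + 1))%:R - (j == ek es.1 es.2 + 1)%:R).
  by have [c h1 h2] := rise_slot es.1 es.2; exists c.
(* The signs [sgb] and [c] turn the unknown of an edge into one value per incidence, of the same
   absolute value; [mu] extends these values by 0 to boundary edges. *)
pose nu (es : 'I_(nedge E) * bool) := sgb es.2 * c es * lam es.1.
have nnu es : `|nu es| = `|lam es.1|.
  rewrite /nu !normrM (hc es).1 mulr1 /sgb; case: es.2; by rewrite ?normrN normr1 mul1r.
pose mu T k := \sum_(es : 'I_(nedge E) * bool) ((T, k) == (eT es.1 es.2, ek es.1 es.2))%:R * nu es.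
have muE e s : mu (eT e s) (ek e s) = nu (e, s).
  rewrite /mu (bigD1 (e, s)) //= eqxx mul1r big1 ?addr0 // => es esn.
  case: eqP => [h1|_]; last by rewrite mul0r.
  by move: esn; rewrite (edge_pair_inj (x1 := es) (x2 := (e, s))) ?eqxx.
have hmu T j : \sum_e jump_coef T j e * lam e =
    \sum_k mu T k * ((j == k + (1 + 1))%:R - (j == k + 1)%:R).
  transitivity (\sum_(es : 'I_(nedge E) * bool) (T == eT es.1 es.2)%:R *
      (nu es * ((j == ek es.1 es.2 + (1 + 1))%:R - (j == ek es.1 es.2 + 1)%:R))).
    transitivity (\sum_e \sum_(s : bool) (T == eT e s)%:R *
        (nu (e, s) * ((j == ek e s + (1 + 1))%:R - (j == ek e s + 1)%:R))); last first.
      by rewrite pair_bigA /=; apply: eq_bigr => -[e s] _.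
    apply: eq_bigr => e _; rewrite /jump_coef mulr_suml; apply: eq_bigr => s _.
    case: eqP => [->|_]; last by rewrite !mul0r mulr0 mul0r.
    by rewrite ((hc (e, s)).2 j) /nu /=; ring.
  rewrite /mu (eq_bigr (fun k => \sum_(es : 'I_(nedge E) * bool)
    ((T, k) == (eT es.1 es.2, ek es.1 es.2))%:R * nu es *
    ((j == k + (1 + 1))%:R - (j == k + 1)%:R))); last first.
    by move=> k _; rewrite mulr_suml.
  rewrite exchange_big /=; apply: eq_bigr => es _.
  rewrite (bigD1 (ek es.1 es.2)) //= big1 ?addr0.
    by rewrite xpair_eqE eqxx andbT mulrA.
  by move=> k kn; rewrite xpair_eqE (negbTE kn) andbF !mul0r.
(* The equation at vertex [k] involves only the two edges of [T] through that vertex, with opposite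
   signs. *)
have mu_const T k : mu T (k + 1) = mu T (k + (1 + 1)).
  have := hmu T k; rewrite h (sum3k k) => /esym.
  have e1 : k + 1 + 1 = k + (1 + 1) by rewrite addrA.
  have e2 : k + 1 + (1 + 1) = k by rewrite -addrA ord3_eqs addr0.
  have e3 : k + (1 + 1) + 1 = k by rewrite -addrA !ord3_eqs addr0.
  have e4 : k + (1 + 1) + (1 + 1) = k + 1 by rewrite -addrA !ord3_eqs.
  rewrite e1 e2 e3 e4 !eqxx !ord3_eqF !subrr !mulr0 add0r subr0 sub0r mulr1 mulrN1.
  by move/eqP; rewrite subr_eq0 => /eqP.
have mu_all T k k' : mu T k = mu T k'.
  have m1 := mu_const T k; have m2 := mu_const T (k + 1).
  have e1 : k + 1 + 1 = k + (1 + 1) by rewrite addrA.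
  have e2 : k + 1 + (1 + 1) = k by rewrite -addrA ord3_eqs addr0.
  rewrite e1 e2 in m2.
  by have [->|->|->] := ord3_casek k k'; rewrite ?m1 ?m2.
have [T0 [k0 hb]] := boundary_slot E O0.
have mu0 : mu T0 k0 = 0.
  rewrite /mu big1 // => -[e s] _ /=; case: eqP => [h1|_]; last by rewrite mul0r.
  by case: (hb e s).
(* Only absolute values pass from a triangle to its neighbour, since the two incidences of an edge
   may carry different signs. *)
have cE e : `|mu (Tplus e) k0| = `|mu (Tminus e) k0|.
  rewrite (mu_all (Tplus e) k0 (ek e true)) (mu_all (Tminus e) k0 (ek e false)).
  by rewrite (muE e true) (muE e false) !nnu.
move=> e; apply/eqP; rewrite -normr_eq0 -(nnu (e, true)) -muE /= (mu_all _ _ k0).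
have -> : `|mu (Tplus e) k0| = `|mu T0 k0|.
  exact: (edgewise_global (c := fun T => `|mu T k0|) cE cO).
by rewrite mu0 normr0.
Qed.

(** The matrix of the jump means has a transpose with trivial kernel, hence is surjective. *)
Lemma jump_coef_onto (g : 'I_(nedge E) -> R) : Omega Th !=set0 -> connected (Omega Th) ->
  exists y : 'I_(ntri Th) -> 'I_3 -> R, forall e,
    \sum_T \sum_j y T j * jump_coef T j e = g e.
Proof.
move=> O0 cO; pose I := ('I_(ntri Th) * 'I_3)%type.
pose M : 'M[R]_(#|{: I}|, nedge E) := \matrix_(i, e) jump_coef (enum_val i).1 (enum_val i).2 e.
have rf : row_full M.
  rewrite /row_full -mxrank_tr -/(row_free M^T); apply: inj_row_free => v vM.
  apply/rowP => e; rewrite mxE; apply: (jump_coef_inj (lam := fun e => v 0 e) O0 cO) => T j.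
  transitivity ((v *m M^T) 0 (enum_rank ((T, j) : I))); last by rewrite vM mxE.
  rewrite mxE; apply: eq_bigr => e' _.
  by rewrite !mxE enum_rankK /= mulrC.
have /submxP [y hy] := submx_full (\row_e g e) rf.
exists (fun T j => y 0 (enum_rank ((T, j) : I))) => e.
have := congr1 (fun A : 'rV_(nedge E) => A 0 e) hy; rewrite !mxE => ->.
rewrite pair_bigA /= (reindex (@enum_val _ {: I})) /=; last first.
  by exists enum_rank => i _; [exact: enum_valK|exact: enum_rankK].
apply: eq_bigr => i _; rewrite mxE -surjective_pairing enum_valK //.
Qed.

Lemma jump_coefE (y : 'I_(ntri Th) -> 'I_3 -> R) e :
  \sum_T \sum_j y T j * jump_coef T j e =
  \sum_j y (Tplus e) j * rise e (Tplus e) j - \sum_j y (Tminus e) j * rise e (Tminus e) j.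
Proof.
have d T : \sum_j y T j * jump_coef T j e =
    (T == Tplus e)%:R * (\sum_j y T j * rise e T j) -
    (T == Tminus e)%:R * (\sum_j y T j * rise e T j).
  rewrite !mulr_sumr -sumrB; apply: eq_bigr => j _; rewrite /jump_coef big_bool /=; ring.
rewrite (eq_bigr _ (fun T _ => d T)) sumrB; congr (_ - _).
  rewrite (bigD1 (Tplus e)) //= eqxx mul1r [X in _ + X]big1 ?addr0 // => T /negbTE ->; exact: mul0r.
rewrite (bigD1 (Tminus e)) //= eqxx mul1r [X in _ + X]big1 ?addr0 // => T /negbTE ->; exact: mul0r.
Qed.

Lemma lpoly_slope e s (y : 'I_3 -> R) :
  (lpoly (ea e) (eb e) (\sum_j y j *: bary_poly (vtx (eT e s)) j))^`() =
  (\sum_j y j * rise e (eT e s) j)%:P.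
Proof.
have [i [k [hi hk]]] := edge_vtx e s; have inj := vtx_inj (vtx_area (eT e s)).
rewrite -hi -hk bary_poly_comb_edge derivD derivC add0r derivZ derivX alg_polyC.
congr (_%:P); rewrite /rise -hi -hk.
have S (m : 'I_3) : \sum_j y j * (vtx (eT e s) j == vtx (eT e s) m)%:R = y m.
  rewrite (bigD1 m) //= eqxx mulr1 big1 ?addr0 // => j jm.
  by rewrite (inj_eq inj) (negbTE jm) mulr0.
by rewrite -(S k) -[in LHS](S i) -sumrB; apply: eq_bigr => j _; rewrite mulrBr.
Qed.

(** A primitive of [K e] is the sum of its secant, whose slope is the mean of [K e], and a remainder
    vanishing at both endpoints. Broken linear functions realize all the slopes at once; a bubble on
    [Tplus e] realizes the remainder without affecting other edges. *)
Lemma prescribed_jumps n (K : 'I_(nedge E) -> {poly R}) : Omega Th !=set0 -> connected (Omega Th) ->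
  (0 < n)%N -> (forall e, (size (K e) <= n.+1)%N) ->
  exists2 u : 'I_(ntri Th) -> poly2 R, broken n.+1 u &
    forall e, (lpoly (ea e) (eb e) (u (Tplus e)))^`() -
      (lpoly (ea e) (eb e) (u (Tminus e)))^`() = K e.
Proof.
move=> O0 cO n0 sK.
have [y hy] := jump_coef_onto (fun e => (primp (K e)).[1]) O0 cO.
have /choice [q hq] e : exists q, primp (K e) - (primp (K e)).[1] *: 'X = 'X * (1 - 'X) * q /\
    (size q <= n)%N.
  have [|||q h1 h2] := @bubble_factor R (primp (K e) - (primp (K e)).[1] *: 'X) n.
  - by rewrite hornerD hornerN hornerZ hornerX primp0 mulr0 subr0.
  - by rewrite hornerD hornerN hornerZ hornerX mulr1 subrr.
  - rewrite (leq_trans (size_polyD _ _)) // geq_max size_polyN.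
    rewrite (leq_trans (size_primp _)) ?ltnS //=.
    by rewrite (leq_trans (size_scale_leq _ _)) // size_polyX.
  by exists q.
pose u T := \sum_j y T j *: bary_poly (vtx T) j +
  \sum_(e < nedge E) (Tplus e == T)%:R *: bubble e (q e).
have hb T : broken n.+1 u.
  move=> T'; rewrite /u -[X in X + _]scale1r; apply: PolD.
    apply: Pol_sum => j _; apply: PolZ.
    by apply: leq_trans (Pol_bary_poly _ _) _.
  by apply: Pol_sum => e _; apply: PolZ; apply: Pol_bubble => //; exact: (hq e).2.
exists u; first by move=> T; exact: hb.
move=> e.
have l T s : T = eT e s -> (lpoly (ea e) (eb e) (u T))^`() =
    (\sum_j y T j * rise e T j)%:P + (Tplus e == T)%:R *: ('X * (1 - 'X) * q e)^`().
  move=> ->; rewrite /u lpolyD derivD lpoly_slope; congr (_ + _).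
  rewrite lpoly_sum (bigD1 e) //= big1 ?addr0.
    by rewrite lpolyZ lpoly_bubble derivZ.
  move=> e' e'e; rewrite lpolyZ; case: eqP => [h|_]; last by rewrite scale0r.
  by rewrite (@lpoly_bubble_other _ _ E e' e s) ?scaler0 // eq_sym.
rewrite (l _ true) // (l _ false) // eqxx (negbTE (edge_neq e)) scale0r addr0 scale1r.
rewrite addrAC -polyCB -jump_coefE hy -(hq e).1 derivB deriv_primp derivZ derivX alg_polyC.
by rewrite addrC subrK.
Qed.

Lemma div_onto d : Omega Th !=set0 -> connected (Omega Th) -> (0 < d)%N ->
  [set divbr v | v in V1div E d] = V2 Th d.
Proof.
move=> O0 cO d0; apply/seteqP; split=> w.
  by move=> [v hv <-]; exact: (@V1div_V2 _ _ E).
move=> hw; have nd := @VPol_normal_deg R d.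
pose v0 T : poly2 R * poly2 R := (antideriv ord0 (w T), 0).
have hv0 T : VPol R d (v0 T).
  by split; [rewrite -(prednK d0); exact: Pol_antideriv|exact: Pol0].
(* The factor [elen e] cancels the inverse length in the normal component of a rotated gradient. *)
pose K e := - (elen e *: ejump e v0).
have sK e : (size (K e) <= d.+1)%N.
  rewrite size_polyN (leq_trans (size_scale_leq _ _)) // (leq_trans (size_polyD _ _)) //.
  by rewrite geq_max size_polyN !nd //; exact: enormal_orth.
have [u hu hj] := prescribed_jumps O0 cO d0 sK.
exists (fun T => v0 T + rotf (D0br u) T).
  have h T : VPol R d (v0 T + rotf (D0br u) T).
    have [h1 h2] := hv0 T; have [h3 h4] := broken_grad hu T.
    by split; rewrite /= -[X in X + _]scale1r; exact: PolD.
  split=> //; apply/(V1_ejump E nd h) => e.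
  have nD (n : plane R) (p q : poly2 R * poly2 R) : ncomp n (p + q) = ncomp n p + ncomp n q.
    by rewrite /ncomp /= !scalerDr addrACA.
  rewrite /ejump !nD (lpolyD _ _ (ncomp _ (v0 (Tplus e)))) (lpolyD _ _ (ncomp _ (v0 (Tminus e))))
    !lpoly_normal_rotgrad opprD addrACA -scalerBr hj /K.
  by rewrite -/(ejump e v0) scalerN scalerA mulVf ?elen_neq0 // scale1r subrr.
apply/funext => T; have := congr1 (fun f => f T) (div_rotgrad u).
rewrite /divbr /= !mderivD => h.
rewrite addrACA h /v0 /= mderiv_antideriv.
by rewrite raddf0 !addr0.
Qed.

End divergence_onto.

Theorem theorem4p5 (R : realType) (Th : triangulation R)
    (E : interior_edges Th) (d : nat)
    (Omega_neq0 : Omega Th !=set0) (Omega_connected : connected (Omega Th))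
    (d_ge1 : (1 <= d)%N) :
  [/\ forall u : 'I_(ntri Th) -> poly2 R, broken d.+1 u ->
        C1div E d (rotf (D0br u)) = B0 E d *m C0 E d.+1 u,
      fe_subcomplex E d,
      simply_connected (Omega Th) -> fe_exact E d,
      L2fields (V1div E d) = Hdiv_local Th (VPol R d) &
      L2fields (V1 E d (RTpol R d)) = Hdiv_local Th (RTpol R d)].
Proof.
split.
- by move=> u hu; exact: C1div_rotgrad.
- exact: fe_subcomplex_proof.
- move=> sc; split; [exact: constf_inj|exact: rotgrad_kernel|exact: div_kernel|exact: div_onto].
- exact: (L2fields_Hdiv E (@VPol_normal_deg R d)).
- exact: (L2fields_Hdiv E (@RTpol_normal_deg R d)).
Qed.
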